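(* Generic discrete rotation nets with two independent curvature line trajectories are $n$D-consistent. That is: let $n\ge3$, let $M,N$ be skew lines in the moving space, let $e_1,\dots,e_n$ be the standard basis of $\mathbb{Z}^n$, and let displacements $a_{\vec{0}}$ and $a_{e_1},\dots,a_{e_n}$ be given such that each relative displacement $a_{e_j}\star a_{\vec{0}}^{-1}$ is a rotation whose axis in the moving space intersects $M$ and $N$. If these input data are generic, then they extend without contradiction, and uniquely, to the whole $n$-dimensional cube: there is exactly one family of displacements $(a_{\vec{i}})_{\vec{i}\in\{0,1\}^n}$ with the given values at $\vec{0},e_1,\dots,e_n$ such that for every two-dimensional face $\{\vec{i},\vec{i}+e_j,\vec{i}+e_j+e_k,\vec{i}+e_k\}$ of the cube the quadrilateral $[a_{\vec{i}},a_{\vec{i}+e_j},a_{\vec{i}+e_j+e_k},a_{\vec{i}+e_k}]$ is a rotation quadrilateral all of whose relative revolute axes in the moving space intersect $M$ and $N$.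
   Context: Displacements. Dual quaternions $a=\tilde a+\varepsilon\hat a$ ($\tilde a,\hat a$ quaternions, $\varepsilon^2=0$, $\varepsilon$ commuting with the quaternion units, product $\star$) are identified with vectors $(a_0,\dots,a_7)\in\mathbb{R}^8$, $\tilde a=(a_0,\dots,a_3)$, $\hat a=(a_4,\dots,a_7)$. Put $\langle a,b\rangle=\sum_{i=0}^{3}(a_ib_{i+4}+a_{i+4}b_i)$ and $a_\varepsilon=\tilde a-\varepsilon\hat a$. The points with $\tilde x\ne0$ of the Study quadric $\mathcal{S}=\{x\in P^7:\langle x,x\rangle=0\}$ are identified with proper Euclidean displacements from the moving to the fixed space: if $\Vert\tilde a\Vert=1$, then $a$ maps $x\in\mathbb{R}^3$ (as vector-valued quaternion) to $x'$ with $1+\varepsilon x'=a_\varepsilon\star(1+\varepsilon x)\star a^{-1}$. The line joining displacements $a,b$ is contained in $\mathcal{S}$ iff $\langle a,b\rangle=0$, iff the relative displacement $b\star a^{-1}$ is a rotation. Its axis in the moving space (the relative revolute axis) is the image, under the inverse of the displacement $a$, of the axis of $b\star a^{-1}$ in the fixed space. Rotation quadrilaterals and nets. A rotation quadrilateral $[b_0,b_1,b_2,b_3]$ is a quadrilateral on $\mathcal{S}$ whose vertices (displacements) and edges (the lines joining $b_i$ and $b_{i+1}$, indices modulo $4$) are contained in $\mathcal{S}$; quadrilaterals are understood to be non-degenerate, i.e. to have four distinct vertices. A rotation net is a quadrilateral net of displacements, indexed by $\mathbb{Z}^n$, all of whose edges are contained in $\mathcal{S}$. An oriented contact element is a point together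 with an oriented plane through it; its axis is the line through the point orthogonal to the plane. A net of contact elements is a principal contact element net (a discrete curvature line net) if neighbouring contact elements have a common oriented tangent sphere. A rotation net has two independent curvature line trajectories, traced by contact elements with skew axes $M$ and $N$ in the moving space, precisely when all its relative revolute axes in the moving space intersect $M$ and $N$. $n$D-consistency. Generically, three consecutive positions of a rotation quadrilateral with axes meeting $M$ and $N$ determine the fourth. Thus the input at $\vec{0},e_1,\dots,e_n$ determines $a_{e_j+e_k}$, and further vertices can be computed in several ways by completing different faces; $n$D-consistency means that all these ways lead to the same positions. Genericity. ''Generic input data'' means data outside a proper algebraic subset of the variety of all admissible input data $(M,N,a_{\vec{0}},a_{e_1},\dots,a_{e_n})$. *)

(* Defs.v *)
(* Library world: MathComp, with realType from MathComp-Analysis. *)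
From HB Require Import structures.
From mathcomp Require Import all_boot all_order all_algebra.
From mathcomp Require Import reals.
From mathcomp Require Import mpoly.

Set Implicit Arguments.
Unset Strict Implicit.
Unset Printing Implicit Defensive.

Import GRing.Theory.
Local Open Scope ring_scope.

Section Vectors.
Variable R : realType.

Definition dot (m : nat) (u v : 'rV[R]_m) : R := \sum_i u 0 i * v 0 i.

(* The indices j + 1 and j + 2 are taken modulo 3, in 'I_3. *)
Definition cross (u v : 'rV[R]_3) : 'rV[R]_3 :=
  \row_j (u 0 (j + 1) * v 0 (j + 1 + 1) - u 0 (j + 1 + 1) * v 0 (j + 1)).

End Vectors.

Section DualQuaternions.
Variable R : realType.

Definition quat := 'rV[R]_(1 + 3).

Definition qscal (q : quat) : R := q 0 0.
Definition qvec (q : quat) : 'rV[R]_3 := rsubmx q.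
Definition mkquat (s : R) (v : 'rV[R]_3) : quat := row_mx s%:M v.

Definition qmul (p q : quat) : quat :=
  mkquat (qscal p * qscal q - dot (qvec p) (qvec q))
         (qscal p *: qvec q + qscal q *: qvec p + cross (qvec p) (qvec q)).

Definition qinv (q : quat) : quat :=
  (dot q q)^-1 *: mkquat (qscal q) (- qvec q).

(* The coordinates (a_0, ..., a_7): first the primal part, then the dual
   part. *)
Definition dquat := 'rV[R]_((1 + 3) + (1 + 3)).

Definition primal (a : dquat) : quat := lsubmx a.
Definition dual (a : dquat) : quat := rsubmx a.
Definition mkdq (p d : quat) : dquat := row_mx p d.

Definition dmul (a b : dquat) : dquat :=
  mkdq (qmul (primal a) (primal b))
       (qmul (primal a) (dual b) + qmul (dual a) (primal b)).

(* The two-sided inverse for dmul as soon as primal a != 0. *)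
Definition dinv (a : dquat) : dquat :=
  mkdq (qinv (primal a))
       (- qmul (qmul (qinv (primal a)) (dual a)) (qinv (primal a))).

Definition deps (a : dquat) : dquat := mkdq (primal a) (- dual a).

Definition bform (a b : dquat) : R :=
  dot (primal a) (dual b) + dot (dual a) (primal b).

End DualQuaternions.

Section Displacements.
Variable R : realType.

(* Points of P^7 are given by representatives in R^8, equal up to a nonzero
   factor; likewise for lines below. *)
Definition on_study (a : dquat R) : Prop := bform a a = 0.

Definition is_displacement (a : dquat R) : Prop :=
  on_study a /\ primal a != 0.

Definition same_point (a b : dquat R) : Prop :=
  exists c : R, c != 0 /\ b = c *: a.

(* The image x' of x, where 1 + eps x' = a_eps (1 + eps x) a^-1.  Since a^-1
   is the actual inverse, this is homogeneous of degree 0 in a, and no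
   normalisation of a is needed. *)
Definition displace (a : dquat R) (x : 'rV[R]_3) : 'rV[R]_3 :=
  qvec (dual (dmul (dmul (deps a) (mkdq (mkquat 1 0) (mkquat 0 x)))
                   (dinv a))).

Definition relative_displacement (a b : dquat R) : dquat R := dmul b (dinv a).

Definition joining_line_on_study (a b : dquat R) : Prop :=
  forall s t : R, on_study (s *: a + t *: b).

(* A line of Euclidean space, by Pluecker coordinates: direction g, moment
   x * g (cross product) for any point x of the line. *)
Definition line := 'rV[R]_(3 + 3).

Definition direction (L : line) : 'rV[R]_3 := lsubmx L.
Definition moment (L : line) : 'rV[R]_3 := rsubmx L.

Definition is_line (L : line) : Prop :=
  direction L != 0 /\ dot (direction L) (moment L) = 0.

Definition on_line (L : line) (x : 'rV[R]_3) : Prop :=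
  cross x (direction L) = moment L.

Definition parallel (L L' : line) : Prop :=
  exists c : R, direction L' = c *: direction L.

Definition skew (L L' : line) : Prop :=
  ~ parallel L L' /\ ~ (exists x, on_line L x /\ on_line L' x).

(* A rotation is a displacement whose fixed points are exactly the points of
   a line, its axis; this excludes the identity and the translations. *)
Definition is_rotation (c : dquat R) : Prop :=
  is_displacement c /\
  exists L : line, is_line L /\ forall x, displace c x = x <-> on_line L x.

Definition fixed_axis (c : dquat R) (x : 'rV[R]_3) : Prop := displace c x = x.

Definition relative_revolute_axis (a b : dquat R) (y : 'rV[R]_3) : Prop :=
  exists x, fixed_axis (relative_displacement a b) x /\
            y = displace (dinv a) x.

Definition meets (l : 'rV[R]_3 -> Prop) (L : line) : Prop :=
  exists x, l x /\ on_line L x.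

Definition revolute_meeting (M N : line) (a b : dquat R) : Prop :=
  [/\ is_rotation (relative_displacement a b),
      meets (relative_revolute_axis a b) M &
      meets (relative_revolute_axis a b) N].

(* ordS is the successor modulo 4. *)
Definition rotation_quadrilateral (b : 4.-tuple (dquat R)) : Prop :=
  [/\ forall i, is_displacement (tnth b i),
      forall i, joining_line_on_study (tnth b i) (tnth b (ordS i)) &
      forall i j, i != j -> ~ same_point (tnth b i) (tnth b j)].

Definition quadrilateral_axes_meet (M N : line) (b : 4.-tuple (dquat R)) :
    Prop :=
  forall i, revolute_meeting M N (tnth b i) (tnth b (ordS i)).

End Displacements.

Section Input.
Variables (R : realType) (n : nat).

(* Row j of in_e is the displacement a_{e_j}. *)
Record input := Input {
  in_M : line R;
  in_N : line R;
  in_0 : dquat R;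
  in_e : 'M[R]_(n, (1 + 3) + (1 + 3)) }.

Definition admissible (D : input) : Prop :=
  [/\ is_line (in_M D), is_line (in_N D), skew (in_M D) (in_N D),
      is_displacement (in_0 D) &
      forall j, is_displacement (row j (in_e D)) /\
                revolute_meeting (in_M D) (in_N D) (in_0 D) (row j (in_e D))].

Definition ncoords : nat :=
  (3 + 3) + (3 + 3) + ((1 + 3) + (1 + 3)) + n * ((1 + 3) + (1 + 3)).

Definition coords (D : input) : 'rV[R]_ncoords :=
  row_mx (row_mx (row_mx (in_M D) (in_N D)) (in_0 D)) (mxvec (in_e D)).

Definition evalp (p : {mpoly R[ncoords]}) (D : input) : R :=
  p.@[fun i => coords D 0 i].

Definition rescale (cM cN c0 : R) (c : 'rV[R]_n) (D : input) : input :=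
  Input (cM *: in_M D) (cN *: in_N D) (c0 *: in_0 D) (diag_mx c *m in_e D).

(* Homogeneous in each group of homogeneous coordinates separately; R being
   infinite, this is a property of the polynomial itself. *)
Definition multihomogeneous (p : {mpoly R[ncoords]}) : Prop :=
  exists (dM dN d0 : nat) (d : 'I_n -> nat),
  forall (cM cN c0 : R) (c : 'rV[R]_n) (D : input),
    evalp p (rescale cM cN c0 c D) =
    cM ^+ dM * cN ^+ dN * c0 ^+ d0 * (\prod_j c 0 j ^+ d j) * evalp p D.

(* Z is a proper algebraic subset of V, where V is a set of points of
   P^5 x P^5 x (P^7)^(n+1).  Finitely many equations suffice by Hilbert's
   basis theorem. *)
Definition proper_algebraic_subset (V Z : input -> Prop) : Prop :=
  (exists S : seq {mpoly R[ncoords]},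
     (forall p, p \in S -> multihomogeneous p) /\
     (forall D, Z D <-> V D /\ forall p, p \in S -> evalp p D = 0)) /\
  (exists D, V D /\ ~ Z D).

(* A vertex of {0,1}^n is encoded by its support I, so that adding e_j to it
   (when its j-th coordinate is 0) gives j |: I. *)
Definition face (a : {set 'I_n} -> dquat R) (I : {set 'I_n}) (j k : 'I_n) :
    4.-tuple (dquat R) :=
  [tuple a I; a (j |: I); a (k |: (j |: I)); a (k |: I)].

Definition extends_to_cube (D : input) (a : {set 'I_n} -> dquat R) : Prop :=
  [/\ forall I, is_displacement (a I),
      same_point (in_0 D) (a set0),
      forall j, same_point (row j (in_e D)) (a [set j]) &
      forall (I : {set 'I_n}) (j k : 'I_n), j != k -> j \notin I -> k \notin I ->
        rotation_quadrilateral (face a I j k) /\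
        quadrilateral_axes_meet (in_M D) (in_N D) (face a I j k)].

End Input.

(* Main.v *)
Require Import Defs.
From HB Require Import structures.
From mathcomp Require Import all_boot all_order all_algebra.
From mathcomp Require Import reals.
From mathcomp Require Import mpoly.
From mathcomp Require Import ring lra.

Set Implicit Arguments.
Unset Strict Implicit.
Unset Printing Implicit Defensive.

Import Order.TTheory GRing.Theory Num.Theory.
Local Open Scope ring_scope.

(** For skew lines M, N let W be the five-dimensional space of dual quaternions r
    with <r, 1> = <r, M> = <r, N> = 0, where M and N also denote the vector-valued
    dual quaternions (direction, - moment).  The relative axis of displacements
    a, b meets M and N iff conj(a) b lies in W and its direction g satisfies
    g . (dM x dN) <> 0.  So the fourth vertex of a face a, b, c is a null vector of
    an at most two-dimensional space containing a; generically it is the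
    reflection of a in the orthogonal complement of a vector of cofactors, which
    is polynomial in the data.

    3D-consistency.  For unit vectors M, N put V1 = M + N, V2 = M - N; these are
    orthogonal over the dual numbers.  In the frame 1, V1, V2, V1 x V2 an element of
    W has five real coordinates, which are stored in a 2 x 2 matrix
      [ a z^2 + s z - b          c + d z           ]
      [ (1 - z^2) (c - d z)      - a z^2 + s z + b ]
    over R[z].  A product of two elements of W is determined linearly by the
    product of their matrices, and elements of W that are null correspond to
    matrices whose determinant is, up to scale and z^2, determined by one ratio.
    Faces of the cube thus become refactorisations e x = f y of products of
    matrices.  These exist and are unique because the map (x, y) -> e x - f y goes
    from a space of dimension ten to one of dimension nine, and the two
    completions of the cube agree by the Bezout identity for the determinants.

    Rearranging the star (a; b_1, ..., b_n) of a vertex into the star of the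
    neighbour b_j is thus an involution up to scale, and two such steps commute,
    so that the cube is filled in from any order of steps.  The excluded set is
    the zero set of the product, over sequences of at most n steps, of the
    nondegeneracy conditions.  It is proper: for one fixed pair of lines the
    admissible inputs are parametrised rationally, so a product of polynomials
    not vanishing identically there does not vanish identically, composition
    with a step preserves this by involutivity, and each nondegeneracy condition
    is checked at one explicit input. *)

(** * Lax matrices *)

(** Origin of the matrices: let [v1], [v2] be the norms of V1, V2 over the dual numbers, so that
    [v1 + v2 = 4], and let z be a formal square root of [- v1 / v2]. Then [laxmx e] divided by z
    represents the dual quaternion [lax_ev e] by 2 x 2 matrices, since the basis elements square and
    multiply as required. So an identity between matrix products specialises to one between dual
    quaternions, and the norm is the determinant divided by z^2. Skewness gives [v1 / v2] a nonzero
    dual part; with w its real part, the norm is real exactly when [norm0] is w^2 times [norm4],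
    which leaves the ratio of [norm2] to [norm4]. The passage back from dual quaternions to matrices
    is blocked: matrix products have nine coefficients, dual quaternions eight coordinates, and a
    face equation between dual quaternions always has the solution that returns to the starting
    vertex. The ninth coefficient rules that solution out. *)

Section Lax.
Variable R : realFieldType.

(* Coordinates on the five-dimensional space W of the header, see lax_ev. *)
Record lax := Lax { ls : R; la : R; lb : R; lc : R; ld : R }.
Implicit Types e x y z v : lax.

Definition mx2 (T : Type) (a b c d : T) : 'M[T]_2 :=
  \matrix_(i, j) if i == 0 then (if j == 0 then a else b)
                 else (if j == 0 then c else d).

Lemma mx2P (T : Type) (A B : 'M[T]_2) :
  A 0 0 = B 0 0 -> A 0 1 = B 0 1 -> A 1 0 = B 1 0 -> A 1 1 = B 1 1 -> A = B.
Proof.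
move=> h00 h01 h10 h11; apply/matrixP=> i j.
have e1 : forall k : 'I_2, k = 0 \/ k = 1.
  by case=> [[|[|//]]] k; [left|right]; apply/val_inj.
by case: (e1 i) => ->; case: (e1 j) => ->.
Qed.

Lemma mulmx2 (T : pzRingType) (A B : 'M[T]_2) i j :
  (A *m B) i j = A i 0 * B 0 j + A i 1 * B 1 j.
Proof.
rewrite mxE !big_ord_recl big_ord0 addr0.
by congr (_ + A i _ * B _ j); apply/val_inj.
Qed.

Lemma detmx2 (T : comPzRingType) (A : 'M[T]_2) :
  \det A = A 0 0 * A 1 1 - A 0 1 * A 1 0.
Proof.
rewrite (expand_det_row A 0) !big_ord_recl big_ord0 addr0 /cofactor.
have e1 : lift (0 : 'I_2) 0 = 1 :> 'I_2 by apply/val_inj.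
have e2 : lift (1 : 'I_2) 0 = 0 :> 'I_2 by apply/val_inj.
rewrite !det_mx11 !mxE e1 e2 /= addn0 add0n expr0 mul1r /bump /= expr1.
by rewrite mulN1r mulrN.
Qed.

Local Notation X2 := (1 - 'X^2 : {poly R}).
Definition flip (p : {poly R}) : {poly R} := p \Po (- 'X).

Definition laxUL e : {poly R} := (la e)%:P * 'X^2 + (ls e)%:P * 'X - (lb e)%:P.
Definition laxUR e : {poly R} := (lc e)%:P + (ld e)%:P * 'X.

Definition laxmx e : 'M[{poly R}]_2 :=
  mx2 (laxUL e) (laxUR e) (X2 * flip (laxUR e)) (- flip (laxUL e)).

(** For k = 1 or -1 this says that P(z) = k J P(-z) J^-1 with J = [0, 1; z^2 - 1, 0]. As J^2 is
    scalar and J is even in z, this is an involutive symmetry compatible with products, and it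
    reduces every matrix identity below to the first row. *)
Definition twisted (k : R) (P : 'M[{poly R}]_2) :=
  P 1 1 = k%:P * flip (P 0 0) /\ P 1 0 = - k%:P * X2 * flip (P 0 1).

Lemma flipM p q : flip (p * q) = flip p * flip q. Proof. exact: comp_polyM. Qed.
Lemma flipD p q : flip (p + q) = flip p + flip q. Proof. exact: comp_polyD. Qed.
Lemma flipN p : flip (- p) = - flip p.
Proof. by rewrite /flip raddfN. Qed.
Lemma flipC c : flip c%:P = c%:P. Proof. exact: comp_polyC. Qed.
Lemma flip1 : flip 1 = 1. Proof. exact: flipC. Qed.
Lemma flipX : flip 'X = - 'X. Proof. exact: comp_polyX. Qed.
Lemma flipXn2 : flip 'X^2 = 'X^2.
Proof. by rewrite expr2 flipM flipX mulrNN. Qed.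
Lemma flipK p : flip (flip p) = p.
Proof.
by rewrite /flip -comp_polyA raddfN /= comp_polyX opprK comp_polyXr.
Qed.
Definition flipE := (flipM, flipD, flipN, flipC, flip1, flipXn2, flipX, flipK).

Lemma twisted_lax e : twisted (- 1) (laxmx e).
Proof. by split; rewrite !mxE /= polyCN ?opprK ?mul1r ?mulN1r. Qed.

Lemma twistedM k l P Q : k ^+ 2 = 1 -> l ^+ 2 = 1 ->
  twisted k P -> twisted l Q -> twisted (k * l) (P *m Q).
Proof.
move=> hk hl [P1 P2] [Q1 Q2].
have hl' : l%:P * l%:P = 1 :> {poly R} by rewrite -polyCM -expr2 hl.
split; rewrite !mulmx2 P1 P2 Q1 Q2 !flipE polyCM; first by ring: hl'.
by ring: hl'.
Qed.

Lemma twisted_eq k P Q : twisted k P -> twisted k Q ->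
  P 0 0 = Q 0 0 -> P 0 1 = Q 0 1 -> P = Q.
Proof.
by move=> [P1 P2] [Q1 Q2] h0 h1; apply: mx2P; rewrite // ?P1 ?P2 ?Q1 ?Q2 ?h0 ?h1.
Qed.

Definition laxconj e := Lax (ls e) (- la e) (- lb e) (- lc e) (- ld e).

Lemma flipUL e : flip (laxUL e) = (la e)%:P * 'X^2 - (ls e)%:P * 'X - (lb e)%:P.
Proof. by rewrite /laxUL !flipE mulrN. Qed.
Lemma flipUR e : flip (laxUR e) = (lc e)%:P - (ld e)%:P * 'X.
Proof. by rewrite /laxUR !flipE mulrN. Qed.

Definition norm4 e := - (la e ^+ 2 + ld e ^+ 2).
Definition norm2 e := ls e ^+ 2 + 2 * la e * lb e + lc e ^+ 2 + ld e ^+ 2.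
Definition norm0 e := - (lb e ^+ 2 + lc e ^+ 2).
Definition lnorm e : {poly R} :=
  (norm4 e)%:P * 'X^4 + (norm2 e)%:P * 'X^2 + (norm0 e)%:P.

Lemma det_lax e : \det (laxmx e) = lnorm e.
Proof.
rewrite detmx2 !mxE /= flipUL flipUR /laxUL /laxUR /lnorm /norm4 /norm2 /norm0.
rewrite !(rmorphN, rmorphD, rmorphM, rmorphXn) /= rmorph1; ring.
Qed.

Lemma lnorm_even e : flip (lnorm e) = lnorm e.
Proof.
by rewrite /lnorm !flipE; ring.
Qed.

Lemma lax_conjl e : laxmx (laxconj e) *m laxmx e = (lnorm e)%:M.
Proof.
have t : twisted 1 (laxmx (laxconj e) *m laxmx e).
  by rewrite -[1]mulr1 -mulrNN; apply: twistedM; rewrite ?sqrrN ?expr1n //;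
    exact: twisted_lax.
apply: (twisted_eq t); first by split; rewrite !mxE /= ?mulr1n ?mulr0n ?lnorm_even ?mul1r // /flip comp_poly0 mulr0.
  rewrite mulmx2 !mxE /= flipUR /laxUL /laxUR /lnorm /norm4 /norm2 /norm0 /=.
  rewrite !(rmorphN, rmorphD, rmorphM, rmorphXn) /= rmorph1; ring.
rewrite mulmx2 !mxE /= flipUL /laxUL /laxUR /= !rmorphN /=; ring.
Qed.

Lemma laxconjK e : laxconj (laxconj e) = e.
Proof. by case: e => *; rewrite /laxconj /= !opprK. Qed.

Lemma lnorm_conj e : lnorm (laxconj e) = lnorm e.
Proof.
by congr (_%:P * _ + _%:P * _ + _%:P); rewrite /norm4 /norm2 /norm0 /=; ring.
Qed.

Lemma lax_conjr e : laxmx e *m laxmx (laxconj e) = (lnorm e)%:M.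
Proof. by rewrite -{1}(laxconjK e) lax_conjl lnorm_conj. Qed.

Lemma size_laxUL e : (size (laxUL e) <= 3)%N.
Proof.
apply/leq_sizeP => j hj; rewrite /laxUL !coefE.
by move: hj; case: j => [|[|[|j]]] //= _; rewrite !mulr0 ?addr0 ?subr0.
Qed.

Lemma size_laxUR e : (size (laxUR e) <= 2)%N.
Proof.
apply/leq_sizeP => j hj; rewrite /laxUR !coefE.
by move: hj; case: j => [|[|j]] //= _; rewrite !mulr0 ?addr0 ?subr0.
Qed.

Lemma lax_of_twisted (S : 'M[{poly R}]_2) :
  twisted (- 1) S -> (size (S 0%R 0%R) <= 3)%N -> (size (S 0%R 1%R) <= 2)%N ->
  exists v, S = laxmx v.
Proof.
move=> tS s0 s1.
exists (Lax (S 0 0)`_1 (S 0 0)`_2 (- (S 0 0)`_0) (S 0 1)`_0 (S 0 1)`_1).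
apply: (twisted_eq tS (twisted_lax _)); rewrite !mxE /=; apply/polyP => i.
  rewrite /laxUL /= !coefE; move: (leq_sizeP _ _ s0 i).
  by case: i => [_|[_|[_|i /(_ isT) ->]]] /=; ring.
rewrite /laxUR /= !coefE; move: (leq_sizeP _ _ s1 i).
by case: i => [_|[_|i /(_ isT) ->]] /=; ring.
Qed.

Lemma laxmx_inj v w : laxmx v = laxmx w -> v = w.
Proof.
move=> /matrixP h; have := h 0 0; have := h 0 1.
rewrite !mxE /= => /polyP h1 /polyP h0.
move: (h1 0%N) (h1 1%N) (h0 0%N) (h0 1%N) (h0 2%N).
rewrite /laxUL /laxUR !coefE /= !mulr0 !mulr1 ?addr0 ?subr0 ?add0r.
case: v w {h h0 h1} => [? ? ? ? ?] [? ? ? ? ?] /= -> -> /oppr_inj -> -> ->.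
by [].
Qed.

(** [norm4] and [norm0] are negated sums of squares, so an ordered field is essential here. It makes
    every nonzero Lax matrix cancellable. *)
Lemma lnorm_neq0 e : e <> Lax 0 0 0 0 0 -> lnorm e != 0.
Proof.
move=> he; apply/eqP => /polyP h0.
move: (h0 4%N) (h0 2%N) (h0 0%N); rewrite /lnorm !coefE /=.
rewrite !mulr0 !mulr1 !addr0 !add0r /norm4 /norm2 /norm0.
case: e he {h0} => s a b c d /= he h4 h2 h0.
have [a0 d0] : a = 0 /\ d = 0 by split; nra.
have [b0 c0] : b = 0 /\ c = 0 by split; nra.
have s0 : s = 0 by nra.
by case: he; rewrite s0 a0 b0 c0 d0.
Qed.

End Lax.

Section LaxKernel.
Variable R : realFieldType.
Implicit Types e x y z v : lax R.
Local Notation lax0 := (Lax 0 0 0 0 0 : lax R).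

Lemma size_mul_le (p q : {poly R}) m n :
  (size p <= m.+1)%N -> (size q <= n.+1)%N -> (size (p * q)%R <= (m + n).+1)%N.
Proof.
move=> hp hq; apply: leq_trans (size_polyMleq p q) _.
by rewrite -subn1 leq_subLR add1n -addnS -addSn leq_add.
Qed.

Lemma size_add_le (p q : {poly R}) n :
  (size p <= n)%N -> (size q <= n)%N -> (size (p + q)%R <= n)%N.
Proof.
by move=> hp hq; apply: leq_trans (size_polyD p q) _; rewrite geq_max hp.
Qed.

Lemma size_flip (p : {poly R}) : size (flip p) = size p.
Proof. by rewrite /flip size_comp_poly2 // size_polyN size_polyX. Qed.

Lemma size_twist (p : {poly R}) n :
  (size p <= n.+1)%N -> (size ((1 - 'X^2) * flip p)%R <= n.+3)%N.
Proof.
move=> hp; rewrite -[n.+3]/((2 + n).+1).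
apply: size_mul_le; rewrite ?size_flip //.
by apply: size_add_le; rewrite ?size_poly1 ?size_polyN ?size_polyXn.
Qed.

(* Weights in the grading of the loop algebra: a product of k Lax matrices
   has entries of degree at most 2k and 2k - 1 in its first row. *)
Definition weight k (P : 'M[{poly R}]_2) :=
  (size (P 0%R 0%R) <= k.*2.+1)%N /\ (size (P 0%R 1%R) <= k.*2)%N.

Lemma weight_lax e : weight 1 (laxmx e).
Proof. by split; rewrite !mxE /=; [apply: size_laxUL | apply: size_laxUR]. Qed.

Lemma weightM s k e P : twisted s P -> (0 < k)%N -> weight k P ->
  weight k.+1 (laxmx e *m P).
Proof.
move=> [t1 t2]; case: k => // k _ [h0 h1].
have g0 := size_laxUL e; have g1 := size_laxUR e.
split; rewrite mulmx2 !mxE /= ?t1 ?t2; apply: size_add_le.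
- exact: size_mul_le g0 h0.
- apply: (@size_mul_le _ _ 1 (0 + (k.*2.+1).+2)) => //; rewrite -mulrA.
  by apply: size_mul_le (size_twist h1); rewrite size_polyN size_polyC leq_b1.
- exact: size_mul_le g0 h1.
- apply: (@size_mul_le _ _ 1 (0 + k.*2.+2)) => //.
  by apply: size_mul_le; rewrite ?size_flip // size_polyC leq_b1.
Qed.

Lemma twisted_lax2 e x : twisted 1 (laxmx e *m laxmx x).
Proof.
by rewrite -[1]mulr1 -mulrNN; apply: twistedM; rewrite ?sqrrN ?expr1n //;
  exact: twisted_lax.
Qed.

(** Determinants give [lnorm e * lnorm x = lnorm f * lnorm y]. Because both pairs of outer
    coefficients have ratio w, [norm4 f * lnorm e - norm4 e * lnorm f] is a nonzero multiple of
    ['X^2]; so the two norms are coprime and swap sides. The proof carries this out on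
    coefficients. *)
Lemma lax_transfer (w : R) e f x y :
  norm0 e = w * norm4 e -> norm0 f = w * norm4 f -> w != 0 ->
  norm4 f * norm2 e != norm4 e * norm2 f ->
  laxmx e *m laxmx x = laxmx f *m laxmx y ->
  exists k, lnorm x = k%:P * lnorm f /\ lnorm y = k%:P * lnorm e.
Proof.
move=> he hf w0 hC hE.
have hN : lnorm e * lnorm x = lnorm f * lnorm y.
  by rewrite -!det_lax -!det_mulmx hE.
have f0 : lnorm f != 0.
  apply: lnorm_neq0 => f0; move: hC; rewrite f0 /norm4 /norm2 /=.
  by rewrite !expr0n /= !(mulr0, addr0, mul0r, oppr0) eqxx.
have hc i : (lnorm e * lnorm x)`_i = (lnorm f * lnorm y)`_i by rewrite hN.
have E z : lnorm z = (norm4 z)%:P * 'X^4 + (norm2 z)%:P * 'X^2 + (norm0 z)%:P.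
  by [].
have coefs z t i : (lnorm z * lnorm t)`_i =
  norm4 z * norm4 t * (i == 8)%:R
  + (norm4 z * norm2 t + norm2 z * norm4 t) * (i == 6)%:R
  + (norm4 z * norm0 t + norm2 z * norm2 t + norm0 z * norm4 t) * (i == 4)%:R
  + (norm2 z * norm0 t + norm0 z * norm2 t) * (i == 2)%:R
  + norm0 z * norm0 t * (i == 0)%:R.
  have -> : lnorm z * lnorm t = (norm4 z * norm4 t)%:P * 'X^8
    + (norm4 z * norm2 t + norm2 z * norm4 t)%:P * 'X^6
    + (norm4 z * norm0 t + norm2 z * norm2 t + norm0 z * norm4 t)%:P * 'X^4
    + (norm2 z * norm0 t + norm0 z * norm2 t)%:P * 'X^2
    + (norm0 z * norm0 t)%:P by rewrite !E !(rmorphD, rmorphM) /=; ring.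
  rewrite !coefD !coefCM !coefXn coefC; congr (_ + _).
  by case: i => [|i]; rewrite ?mulr1 ?mulr0.
have h8 := hc 8%N; have h6 := hc 6%N; have h4 := hc 4%N; have h2 := hc 2%N.
have h0 := hc 0%N; move: h8 h6 h4 h2 h0; rewrite !coefs /=.
rewrite !mulr0 !mulr1 !addr0 !add0r he hf.
set p := norm4 e; set q := norm2 e; set p' := norm4 f; set q' := norm2 f.
rewrite -/p -/q -/p' -/q' in he hf hC *.
set x4 := norm4 x; set x2 := norm2 x; set x0 := norm0 x.
set y4 := norm4 y; set y2 := norm2 y; set y0 := norm0 y.
move=> h8 h6 h4 h2; rewrite -!mulrA => /(mulfI w0) h0.
have C0 : p' * q - p * q' != 0 by rewrite subr_eq0.
(* In degree 4 the outer terms cancel by the equations of degrees 8 and 0. *)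
have hq : q * x2 = q' * y2 by have hh1 := congr1 ( *%R w) h8; lra.
set T := p' * y2 - p * x2; exists (T / (p' * q - p * q')).
have key (a b : R) : (p' * q - p * q') * a = T * b ->
    a = T / (p' * q - p * q') * b.
  by move=> h; apply: (mulfI C0); rewrite h mulrA [_ * (T / _)]mulrC divfK.
have k4 : x4 = T / (p' * q - p * q') * p'.
  apply: key; rewrite /T.
  by have g1 := congr1 ( *%R p') h6; have g2 := congr1 ( *%R q') h8; lra.
have k2 : x2 = T / (p' * q - p * q') * q'.
  by apply: key; rewrite /T; have g1 := congr1 ( *%R p') hq; lra.
have k0 : x0 = T / (p' * q - p * q') * (w * p').
  apply: key; rewrite /T.
  by have g1 := congr1 ( *%R p') h2; have g2 := congr1 ( *%R q') h0; lra.
have hx : lnorm x = (T / (p' * q - p * q'))%:P * lnorm f.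
  rewrite !E hf -/x4 -/x2 -/x0 -/p' -/q' k4 k2 k0.
  by move: (T / _) => k; rewrite !polyCM; ring.
split=> //; apply: (mulfI f0); rewrite -hN hx; ring.
Qed.

Definition lax_of_row n (v : 'rV[R]_n.+1) (k : nat) : lax R :=
  Lax (v 0 (inord k)) (v 0 (inord (k + 1))) (v 0 (inord (k + 2)))
      (v 0 (inord (k + 3))) (v 0 (inord (k + 4))).

Lemma lax_of_row_linear n (v w : 'rV[R]_n.+1) (c : R) k :
  laxmx (lax_of_row (c *: v + w) k) =
  c%:P *: laxmx (lax_of_row v k) + laxmx (lax_of_row w k).
Proof.
apply: mx2P; rewrite !mxE /= ?flipUL ?flipUR /laxUL /laxUR /= !mxE
  !(rmorphD, rmorphM) /=; ring.
Qed.

Lemma lax_kernel e f : exists x y, ~ (x = lax0 /\ y = lax0) /\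
  laxmx e *m laxmx x = laxmx f *m laxmx y.
Proof.
pose D (v : 'rV[R]_10) := laxmx e *m laxmx (lax_of_row v 0)
  - laxmx f *m laxmx (lax_of_row v 5).
have lD c u w : D (c *: u + w) = c%:P *: D u + D w.
  rewrite /D !lax_of_row_linear !mulmxDr -!scalemxAr.
  by rewrite scalerBr opprD addrACA.
(* The first row of a product of two Lax matrices has entries of degree at most 4 and 3, hence 5 + 4
   coefficients against ten unknowns; the second row follows by [twisted]. *)
pose g u : 'rV[R]_(5 + 4) := row_mx (\row_i (D u 0 0)`_i) (\row_i (D u 0 1)`_i).
have lg : linear g.
  move=> c u w; rewrite /g scale_row_mx add_row_mx lD.
  by congr row_mx; apply/rowP => i; rewrite !mxE coefD coefCM.
pose G : {linear 'rV[R]_10 -> 'rV[R]_(5 + 4)} :=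
  HB.pack g (GRing.isLinear.Build _ _ _ _ g lg).
pose v := nz_row (kermx (lin1_mx G)).
have v0 : v != 0.
  rewrite nz_row_eq0 -mxrank_eq0 mxrank_ker subn_eq0 -ltnNge.
  exact: leq_ltn_trans (rank_leq_col _) _.
have gv : g v = 0.
  by have /sub_kermxP := nz_row_sub (kermx (lin1_mx G)); rewrite mul_rV_lin1.
exists (lax_of_row v 0), (lax_of_row v 5); split.
  case=> [[a0 a1 a2 a3 a4] [b0 b1 b2 b3 b4]]; case/eqP: v0.
  apply/rowP => i; rewrite mxE -[i]inord_val.
  by case: i => [[|[|[|[|[|[|[|[|[|[|//]]]]]]]]]] hi].
have t z x := twisted_lax2 z x.
have w z x : weight 2 (laxmx z *m laxmx x).
  by apply: weightM (weight_lax _) => //; apply: twisted_lax.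
have [/rowP r0 /rowP r1] : \row_(i < 5) (D v 0 0)`_i = 0
    /\ \row_(i < 4) (D v 0 1)`_i = 0.
  by apply/eq_row_mx; rewrite row_mx0.
have [[a0 a1] [b0 b1]] := (w e (lax_of_row v 0), w f (lax_of_row v 5)).
apply: (twisted_eq (t _ _) (t _ _)); apply/eqP; rewrite -subr_eq0; apply/eqP.
  apply/polyP => i; rewrite coef0; case: (ltnP i 5) => hi.
    by have := r0 (Ordinal hi); rewrite !mxE.
  by rewrite coefB !nth_default ?subr0 //; apply: leq_trans hi.
apply/polyP => i; rewrite coef0; case: (ltnP i 4) => hi.
  by have := r1 (Ordinal hi); rewrite !mxE.
by rewrite coefB !nth_default ?subr0 //; apply: leq_trans hi.
Qed.

End LaxKernel.

(** * Division by a Lax matrix *)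

Section LaxDivision.
Variable R : realFieldType.
Implicit Types e f x y z v : lax R.
Local Notation lax0 := (Lax 0 0 0 0 0 : lax R).

Definition lax_scale (c : R) e :=
  Lax (c * ls e) (c * la e) (c * lb e) (c * lc e) (c * ld e).

Lemma laxmx_scale c e : laxmx (lax_scale c e) = c%:P *: laxmx e.
Proof.
apply: mx2P; rewrite !mxE /= ?flipUL ?flipUR /laxUL /laxUR /= ?rmorphM /=; ring.
Qed.

Lemma scalemx_inj (T : idomainType) m n (c : T) (A B : 'M[T]_(m, n)) :
  c != 0 -> c *: A = c *: B -> A = B.
Proof.
move=> c0 /matrixP h; apply/matrixP => i j.
by have := h i j; rewrite !mxE => /(mulfI c0).
Qed.

Lemma lax_canl e (A B : 'M[{poly R}]_2) : e <> lax0 ->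
  laxmx e *m A = laxmx e *m B -> A = B.
Proof.
move=> e0 h; apply: (scalemx_inj (lnorm_neq0 e0)).
by rewrite -!mul_scalar_mx -!lax_conjl -!mulmxA h.
Qed.

Lemma lax_canr e (A B : 'M[{poly R}]_2) : e <> lax0 ->
  A *m laxmx e = B *m laxmx e -> A = B.
Proof.
move=> e0 h; apply: (scalemx_inj (lnorm_neq0 e0)).
by rewrite -!mul_mx_scalar -!lax_conjr !mulmxA h.
Qed.

Lemma twistedZ c k P : flip c = c -> twisted k P -> twisted k (c *: P : 'M[{poly R}]_2).
Proof.
by move=> hc [h1 h2]; split; rewrite !mxE ?h1 ?h2 flipM hc; ring.
Qed.

Lemma size_lnorm e : norm4 e != 0 -> size (lnorm e) = 5.
Proof.
move=> h; have s4 : size ((norm4 e)%:P * 'X^4) = 5 by rewrite size_Cmul // size_polyXn.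
rewrite /lnorm -addrA size_polyDl s4 //; apply/leq_sizeP => j hj.
by rewrite !coefE; move: hj; case: j => [|[|[|[|j]]]] //= _; rewrite mulr0 addr0.
Qed.

(** With V = conj(x) P and V' = conj(y) Q, the face equation turns e P = f Q into
    [lnorm e *: V = lnorm f *: V']. The norms are coprime, so [lnorm f] divides V, and the quotient
    is twisted and of small enough degree to be a Lax matrix. *)
Lemma lax_division (w : R) e f x y P Q :
  norm0 e = w * norm4 e -> norm0 f = w * norm4 f -> w != 0 ->
  norm4 f != 0 -> norm4 f * norm2 e != norm4 e * norm2 f ->
  laxmx e *m laxmx x = laxmx f *m laxmx y -> x <> lax0 ->
  twisted 1 P -> weight 2 P -> twisted 1 Q ->
  laxmx e *m P = laxmx f *m Q ->
  exists v, P = laxmx x *m laxmx v /\ Q = laxmx y *m laxmx v.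
Proof.
move=> he hf w0 f4 hC hE x0 tP [wP0 wP1] tQ hPQ.
have [k [hx hy]] := lax_transfer he hf w0 hC hE.
have e0 : e <> lax0.
  by move=> h; move: hC; rewrite h /norm2 /norm4 /= !expr0n /= !(mulr0, addr0, mul0r, oppr0) eqxx.
have f0 : f <> lax0.
  by move=> h; move: f4; rewrite h /norm4 /= expr0n /= addr0 oppr0 eqxx.
have k0 : k != 0.
  by apply: contra_neq (lnorm_neq0 x0) => k0; rewrite hx k0 mul0r.
pose V := laxmx (laxconj x) *m P; pose V' := laxmx (laxconj y) *m Q.
have hc z u : laxmx (laxconj u) *m laxmx (laxconj z) *m (laxmx z *m laxmx u)
    = (lnorm z * lnorm u)%:M.
  rewrite mulmxA -[_ *m _ *m laxmx z]mulmxA lax_conjl mul_mx_scalar.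
  by rewrite -scalemxAl lax_conjl scale_scalar_mx.
have f0n := lnorm_neq0 f0; have x0n := lnorm_neq0 x0.
have y0 : y <> lax0.
  move=> y0; have := lnorm_neq0 e0; apply/negP; rewrite negbK.
  have : lnorm lax0 = 0 :> {poly R}.
    by rewrite /lnorm /norm4 /norm2 /norm0 /= !expr0n /= !(mulr0, addr0, mul0r, oppr0).
  by rewrite -y0 hy => /eqP; rewrite mulf_eq0 polyC_eq0 (negbTE k0).
have hB : laxmx (laxconj x) *m laxmx (laxconj e) =
          laxmx (laxconj y) *m laxmx (laxconj f).
  apply: (lax_canr e0); apply: (lax_canr x0); rewrite -!mulmxA [in RHS]hE.
  rewrite mulmxA hc mulmxA hc hx hy; congr (_%:M); ring.
have hV : lnorm e *: V = lnorm f *: V'.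
  rewrite /V /V' !scalemxAr -!mul_scalar_mx -!lax_conjl -[_ *m _ *m P]mulmxA.
  by rewrite hPQ -[_ *m _ *m Q]mulmxA !(mulmxA, hB).
pose p := norm4 e; pose p' := norm4 f; pose C := p' * norm2 e - p * norm2 f.
have C0 : C != 0 by rewrite subr_eq0.
(* The Bezout identity: the outer coefficients cancel since they have the same ratio w, and only the
   middle term survives. *)
have hCX : C%:P * 'X^2 = p'%:P * lnorm e - p%:P * lnorm f.
  rewrite /lnorm he hf -/p -/p' /C !(rmorphB, rmorphM) /=; ring.
pose S := p'%:P *: V' - p%:P *: V.
have hS : (C%:P * 'X^2) *: V = lnorm f *: S.
  rewrite hCX /S scalerBl -!scalerA hV scalerBr !scalerA.
  by rewrite ![lnorm f * _]mulrC.
(* The constant term of [lnorm f] is [w * norm4 f], which is nonzero. *)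
have cop : coprimep 'X^2 (lnorm f).
  rewrite coprimep_expl // coprimep_sym coprimepX rootE /lnorm !hornerE /=.
  by rewrite !mulr0 !add0r hf mulf_neq0.
have div i j : {T | C%:P * V i j = lnorm f * T}.
  have hd : 'X^2 %| lnorm f * S i j.
    by have /matrixP/(_ i j) := hS; rewrite !mxE => <-; rewrite mulrAC dvdp_mull.
  rewrite Gauss_dvdpr // in hd; exists (S i j %/ 'X^2).
  apply: (mulIf (x := 'X^2)); first by rewrite -size_poly_eq0 size_polyXn.
  rewrite -[RHS]mulrA divpK // mulrAC.
  by have /matrixP/(_ i j) := hS; rewrite !mxE.
have [T0 hT0] := div 0 0; have [T1 hT1] := div 0 1.
(* Only the first row is divided; the second is imposed by the symmetry. *)
pose T := mx2 T0 T1 ((1 - 'X^2) * flip T1) (- flip T0).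
have tT : twisted (-1) T.
  by split; rewrite !mxE /= polyCN ?opprK ?mul1r ?mulN1r.
have tV : twisted (-1) V.
  by rewrite -[-1]mulr1; apply: twistedM; rewrite ?sqrrN ?expr1n //;
    apply: twisted_lax.
have wV : (size (V 0%R 0%R) <= 7)%N /\ (size (V 0%R 1%R) <= 6)%N.
  exact: weightM tP _ (conj wP0 wP1).
have hT : C%:P *: V = lnorm f *: T.
  have tCV := twistedZ (flipC C) tV; have tfT := twistedZ (lnorm_even f) tT.
  apply: (twisted_eq tCV tfT).
    by rewrite [LHS]mxE hT0 [RHS]mxE [T 0 0]mxE.
  by rewrite [LHS]mxE hT1 [RHS]mxE [T 0 1]mxE.
have sf := size_lnorm f4.
(* V has sizes at most 7 and 6 in its first row, and [lnorm f] has degree 4, which leaves the sizes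
   3 and 2 of a Lax matrix. *)
have szT (A B : {poly R}) n : C%:P * A = lnorm f * B -> (size A <= n + 4)%N ->
    (size B <= n)%N.
  move=> h hA; have [->|B0] := eqVneq B 0; first by rewrite size_poly0.
  move: hA; rewrite -(size_Cmul A C0) h size_mul // sf -subn1 leq_subLR.
  by rewrite addnCA [(5 + _)%N]addnC (leq_add2r 5).
have s0 : (size (T 0%R 0%R) <= 3)%N by rewrite mxE /=; exact: (szT _ _ 3 hT0 wV.1).
have s1 : (size (T 0%R 1%R) <= 2)%N by rewrite mxE /=; exact: (szT _ _ 2 hT1 wV.2).
have [v hv] := lax_of_twisted tT s0 s1.
have key : P = laxmx x *m laxmx (lax_scale (C * k)^-1 v).
  have ck : C * k != 0 by rewrite mulf_neq0.
  apply: (scalemx_inj (c := (C * k)%:P)); first by rewrite polyC_eq0.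
  rewrite laxmx_scale -scalemxAr scalerA -polyCM mulfV // scale1r.
  apply: (scalemx_inj f0n); rewrite scalerA mulrC polyCM -mulrA -hx -scalerA.
  rewrite -[lnorm x *: P]mul_scalar_mx -lax_conjr -mulmxA -/V scalemxAr hT hv.
  by rewrite -scalemxAr.
exists (lax_scale (C * k)^-1 v); split=> //.
by apply: (lax_canl f0); rewrite -hPQ key mulmxA hE mulmxA.
Qed.
End LaxDivision.

(** * Dual quaternions in coordinates *)

(** A separate name, because pairs already carry the componentwise product as a ring structure. *)
Definition dnum (R : Type) : Type := (R * R)%type.

Section DualNumbers.
Variable R : comNzRingType.
HB.instance Definition _ := GRing.Zmodule.copy (dnum R) (R * R)%type.

Definition dnum_one : dnum R := (1, 0).
Definition dnum_mul (x y : dnum R) : dnum R := (x.1 * y.1, x.1 * y.2 + x.2 * y.1).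

Fact dnum_mulA : associative dnum_mul.
Proof. by move=> [a b] [c d] [e f]; congr pair => /=; ring. Qed.
Fact dnum_mulC : commutative dnum_mul.
Proof. by move=> [a b] [c d]; congr pair => /=; ring. Qed.
Fact dnum_mul1 : left_id dnum_one dnum_mul.
Proof. by move=> [a b]; congr pair => /=; ring. Qed.
Fact dnum_mulD : left_distributive dnum_mul +%R.
Proof. by move=> [a b] [c d] [e f]; congr pair => /=; ring. Qed.
Fact dnum_one_neq0 : dnum_one != 0.
Proof. by apply/eqP => -[/eqP]; rewrite oner_eq0. Qed.
HB.instance Definition _ := GRing.Zmodule_isComNzRing.Build (dnum R)
  dnum_mulA dnum_mulC dnum_mul1 dnum_mulD dnum_one_neq0.

Definition real_dnum (c : R) : dnum R := (c, 0).
End DualNumbers.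

Section Coordinates.
Variable R : realType.
Implicit Types a b c : dquat R.
Local Notation D := (dnum R).

Definition o0 : 'I_3 := 0.
Definition o1 : 'I_3 := 1.
Definition o2 : 'I_3 := 1 + 1.

(** Primal and dual components are paired into one dual number, so that identities between dual
    quaternions become [ring] goals in four coordinates. *)
Definition q0 a : D := (primal a 0 0, dual a 0 0).
Definition qv (j : 'I_3) a : D := (primal a 0 (rshift 1 j), dual a 0 (rshift 1 j)).
Definition q1 := qv o0.
Definition q2 := qv o1.
Definition q3 := qv o2.

Lemma ord3 (P : 'I_3 -> Prop) : P o0 -> P o1 -> P o2 -> forall j, P j.
Proof.
move=> h0 h1 h2 [[|[|[|//]]] hj].
- by rewrite (_ : Ordinal hj = o0) //; apply/val_inj.
- by rewrite (_ : Ordinal hj = o1) //; apply/val_inj.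
- by rewrite (_ : Ordinal hj = o2) //; apply/val_inj.
Qed.

Lemma sum3 (T : nmodType) (F : 'I_3 -> T) : \sum_i F i = F o0 + F o1 + F o2.
Proof.
rewrite !big_ord_recl big_ord0 addr0 addrA.
by congr (F _ + F _ + F _); apply/val_inj.
Qed.

Lemma sum4 (T : nmodType) (F : 'I_(1 + 3) -> T) :
  \sum_i F i = F 0 + F (rshift 1 o0) + F (rshift 1 o1) + F (rshift 1 o2).
Proof.
rewrite big_ord_recl sum3 !addrA.
by congr (F _ + F _ + F _ + F _); apply/val_inj.
Qed.

Lemma ord4 (P : 'I_(1 + 3) -> Prop) : P 0 -> (forall j, P (rshift 1 j)) -> forall i, P i.
Proof.
move=> h0 h i; case: (@splitP 1 3 i) => j hj.
  by rewrite (_ : i = 0) //; apply/val_inj; rewrite /= hj ord1.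
by rewrite (_ : i = rshift 1 j) //; apply/val_inj.
Qed.

Lemma dqP a b : q0 a = q0 b -> q1 a = q1 b -> q2 a = q2 b -> q3 a = q3 b -> a = b.
Proof.
move=> [e0 f0] [e1 f1] [e2 f2] [e3 f3].
rewrite -[a]hsubmxK -[b]hsubmxK; congr row_mx; apply/rowP.
  by apply: ord4 => //; apply: ord3.
by apply: ord4 => //; apply: ord3.
Qed.

Lemma dotE3 (u v : 'rV[R]_3) :
  dot u v = u 0 o0 * v 0 o0 + u 0 o1 * v 0 o1 + u 0 o2 * v 0 o2.
Proof. exact: sum3. Qed.

Lemma dotE4 (u v : 'rV[R]_(1 + 3)) :
  dot u v = u 0 0 * v 0 0 + u 0 (rshift 1 o0) * v 0 (rshift 1 o0)
   + u 0 (rshift 1 o1) * v 0 (rshift 1 o1) + u 0 (rshift 1 o2) * v 0 (rshift 1 o2).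
Proof. exact: sum4. Qed.

Lemma dot_gt0 m (u : 'rV[R]_m) : u != 0 -> 0 < dot u u.
Proof.
case/rV0Pn => i hi; rewrite lt_def /dot sumr_ge0 ?andbT; last first.
  by move=> j _; rewrite -expr2 sqr_ge0.
rewrite psumr_neq0; last by move=> j _; rewrite -expr2 sqr_ge0.
by apply/hasP; exists i; [exact: mem_index_enum|rewrite -expr2 lt_def sqrf_eq0 hi sqr_ge0].
Qed.

Lemma cross0 (u v : 'rV[R]_3) :
  (cross u v) 0 o0 = u 0 o1 * v 0 o2 - u 0 o2 * v 0 o1.
Proof. by rewrite mxE; congr (u 0 _ * v 0 _ - u 0 _ * v 0 _); apply/val_inj. Qed.
Lemma cross1 (u v : 'rV[R]_3) :
  (cross u v) 0 o1 = u 0 o2 * v 0 o0 - u 0 o0 * v 0 o2.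
Proof. by rewrite mxE; congr (u 0 _ * v 0 _ - u 0 _ * v 0 _); apply/val_inj. Qed.
Lemma cross2 (u v : 'rV[R]_3) :
  (cross u v) 0 o2 = u 0 o0 * v 0 o1 - u 0 o1 * v 0 o0.
Proof. by rewrite mxE; congr (u 0 _ * v 0 _ - u 0 _ * v 0 _); apply/val_inj. Qed.
Definition crossE := (cross0, cross1, cross2).

Lemma mkquat0 s (v : 'rV[R]_3) : mkquat s v 0 0 = s.
Proof.
transitivity ((row_mx s%:M v : 'rV_(1 + 3)) 0 (lshift 3 0)).
  by congr (row_mx _ _ _ _); apply/val_inj.
by rewrite row_mxEl mxE mulr1n.
Qed.
Lemma mkquatv s (v : 'rV[R]_3) j : mkquat s v 0 (rshift 1 j) = v 0 j.
Proof. by rewrite /mkquat row_mxEr. Qed.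
Lemma qvecE (p : quat R) j : qvec p 0 j = p 0 (rshift 1 j).
Proof. by rewrite mxE. Qed.

Lemma qmul0 (p q : quat R) : qmul p q 0 0 = p 0 0 * q 0 0
  - p 0 (rshift 1 o0) * q 0 (rshift 1 o0) - p 0 (rshift 1 o1) * q 0 (rshift 1 o1)
  - p 0 (rshift 1 o2) * q 0 (rshift 1 o2).
Proof. by rewrite /qmul mkquat0 dotE3 !qvecE /qscal; ring. Qed.
Lemma qmul1 (p q : quat R) : qmul p q 0 (rshift 1 o0) = p 0 0 * q 0 (rshift 1 o0)
  + p 0 (rshift 1 o0) * q 0 0 + p 0 (rshift 1 o1) * q 0 (rshift 1 o2)
  - p 0 (rshift 1 o2) * q 0 (rshift 1 o1).
Proof. by rewrite /qmul mkquatv 2!mxE crossE !mxE /qscal; ring. Qed.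
Lemma qmul2 (p q : quat R) : qmul p q 0 (rshift 1 o1) = p 0 0 * q 0 (rshift 1 o1)
  + p 0 (rshift 1 o1) * q 0 0 + p 0 (rshift 1 o2) * q 0 (rshift 1 o0)
  - p 0 (rshift 1 o0) * q 0 (rshift 1 o2).
Proof. by rewrite /qmul mkquatv 2!mxE crossE !mxE /qscal; ring. Qed.
Lemma qmul3 (p q : quat R) : qmul p q 0 (rshift 1 o2) = p 0 0 * q 0 (rshift 1 o2)
  + p 0 (rshift 1 o2) * q 0 0 + p 0 (rshift 1 o0) * q 0 (rshift 1 o1)
  - p 0 (rshift 1 o1) * q 0 (rshift 1 o0).
Proof. by rewrite /qmul mkquatv 2!mxE crossE !mxE /qscal; ring. Qed.

Lemma primal_mk (p d : quat R) : primal (mkdq p d) = p.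
Proof. exact: row_mxKl. Qed.
Lemma dual_mk (p d : quat R) : dual (mkdq p d) = d.
Proof. exact: row_mxKr. Qed.

Lemma quat_addE (p q : quat R) k : (p + q) 0 k = p 0 k + q 0 k.
Proof. by rewrite mxE. Qed.

Lemma q0M a b : q0 (dmul a b) = q0 a * q0 b - q1 a * q1 b - q2 a * q2 b - q3 a * q3 b.
Proof.
rewrite /q0 /q1 /q2 /q3 /qv /dmul primal_mk dual_mk quat_addE !qmul0.
by congr pair => /=; ring.
Qed.
Lemma q1M a b : q1 (dmul a b) = q0 a * q1 b + q1 a * q0 b + q2 a * q3 b - q3 a * q2 b.
Proof.
rewrite /q0 /q1 /q2 /q3 /qv /dmul primal_mk dual_mk quat_addE !qmul1.
by congr pair => /=; ring.
Qed.
Lemma q2M a b : q2 (dmul a b) = q0 a * q2 b + q2 a * q0 b + q3 a * q1 b - q1 a * q3 b.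
Proof.
rewrite /q0 /q1 /q2 /q3 /qv /dmul primal_mk dual_mk quat_addE !qmul2.
by congr pair => /=; ring.
Qed.
Lemma q3M a b : q3 (dmul a b) = q0 a * q3 b + q3 a * q0 b + q1 a * q2 b - q2 a * q1 b.
Proof.
rewrite /q0 /q1 /q2 /q3 /qv /dmul primal_mk dual_mk quat_addE !qmul3.
by congr pair => /=; ring.
Qed.

Lemma q0D a b : q0 (a + b) = q0 a + q0 b.
Proof. by congr pair; rewrite /= /primal /dual !mxE. Qed.
Lemma qvD j a b : qv j (a + b) = qv j a + qv j b.
Proof. by congr pair; rewrite /= /primal /dual !mxE. Qed.
Lemma q0Z k a : q0 (k *: a) = real_dnum k * q0 a.
Proof. by congr pair; rewrite /= /primal /dual !mxE /= ?mul0r ?addr0. Qed.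
Lemma qvZ j k a : qv j (k *: a) = real_dnum k * qv j a.
Proof. by congr pair; rewrite /= /primal /dual !mxE /= ?mul0r ?addr0. Qed.

Definition dconj a : dquat R :=
  mkdq (mkquat (qscal (primal a)) (- qvec (primal a)))
       (mkquat (qscal (dual a)) (- qvec (dual a))).
Lemma q0conj a : q0 (dconj a) = q0 a.
Proof. by rewrite /q0 primal_mk dual_mk !mkquat0. Qed.
Lemma qvconj j a : qv j (dconj a) = - qv j a.
Proof. by rewrite /qv primal_mk dual_mk !mkquatv !mxE. Qed.

Definition qdot a b : D := q0 a * q0 b + q1 a * q1 b + q2 a * q2 b + q3 a * q3 b.
Lemma bformE a b : bform a b = (qdot a b).2.
Proof. by rewrite /bform !dotE4 /qdot /=; ring. Qed.

Definition qE := (q0M, q1M, q2M, q3M, q0D, q0Z, q0conj,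
  (fun a b => qvD o0 a b : q1 (a + b) = q1 a + q1 b),
  (fun a b => qvD o1 a b : q2 (a + b) = q2 a + q2 b),
  (fun a b => qvD o2 a b : q3 (a + b) = q3 a + q3 b),
  (fun k a => qvZ o0 k a : q1 (k *: a) = real_dnum k * q1 a),
  (fun k a => qvZ o1 k a : q2 (k *: a) = real_dnum k * q2 a),
  (fun k a => qvZ o2 k a : q3 (k *: a) = real_dnum k * q3 a),
  (fun a => qvconj o0 a : q1 (dconj a) = - q1 a),
  (fun a => qvconj o1 a : q2 (dconj a) = - q2 a),
  (fun a => qvconj o2 a : q3 (dconj a) = - q3 a)).

Lemma dmulA a b c : dmul a (dmul b c) = dmul (dmul a b) c.
Proof. by apply: dqP; rewrite !qE; ring. Qed.
Lemma dmulZl k a b : dmul (k *: a) b = k *: dmul a b.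
Proof. by apply: dqP; rewrite !qE; ring. Qed.
Lemma dmulZr k a b : dmul a (k *: b) = k *: dmul a b.
Proof. by apply: dqP; rewrite !qE; ring. Qed.
Lemma dconjM a b : dconj (dmul a b) = dmul (dconj b) (dconj a).
Proof. by apply: dqP; rewrite !qE; ring. Qed.
Lemma dconjK a : dconj (dconj a) = a.
Proof. by apply: dqP; rewrite !qE ?opprK. Qed.

Lemma qdot_adj a b c : qdot (dmul a b) c = qdot b (dmul (dconj a) c).
Proof. by rewrite /qdot !qE; ring. Qed.
Lemma bform_adj a b c : bform (dmul a b) c = bform b (dmul (dconj a) c).
Proof. by rewrite !bformE qdot_adj. Qed.
Lemma qdot_mull a b c : qdot (dmul a b) (dmul a c) = qdot a a * qdot b c.
Proof. by rewrite /qdot !qE; ring. Qed.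

End Coordinates.

Section Dq4.
Variable R : realType.
Local Notation D := (dnum R).

Definition row3 (x y z : R) : 'rV[R]_3 :=
  \row_j if j == o0 then x else if j == o1 then y else z.
Lemma row3_0 x y z : row3 x y z 0 o0 = x. Proof. by rewrite mxE. Qed.
Lemma row3_1 x y z : row3 x y z 0 o1 = y. Proof. by rewrite mxE. Qed.
Lemma row3_2 x y z : row3 x y z 0 o2 = z. Proof. by rewrite mxE. Qed.

Definition dq4 (x0 x1 x2 x3 : D) : dquat R :=
  mkdq (mkquat x0.1 (row3 x1.1 x2.1 x3.1)) (mkquat x0.2 (row3 x1.2 x2.2 x3.2)).
Lemma q0_dq4 x0 x1 x2 x3 : q0 (dq4 x0 x1 x2 x3) = x0.
Proof. by rewrite /q0 primal_mk dual_mk !mkquat0 -surjective_pairing. Qed.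
Lemma q1_dq4 x0 x1 x2 x3 : q1 (dq4 x0 x1 x2 x3) = x1.
Proof. by rewrite /q1 /qv primal_mk dual_mk !mkquatv !row3_0 -surjective_pairing. Qed.
Lemma q2_dq4 x0 x1 x2 x3 : q2 (dq4 x0 x1 x2 x3) = x2.
Proof. by rewrite /q2 /qv primal_mk dual_mk !mkquatv !row3_1 -surjective_pairing. Qed.
Lemma q3_dq4 x0 x1 x2 x3 : q3 (dq4 x0 x1 x2 x3) = x3.
Proof. by rewrite /q3 /qv primal_mk dual_mk !mkquatv !row3_2 -surjective_pairing. Qed.
Definition dq4E := (q0_dq4, q1_dq4, q2_dq4, q3_dq4).

Definition dq1 : dquat R := dq4 1 0 0 0.
Lemma dmul1l a : dmul dq1 a = a.
Proof. by apply: dqP; rewrite !qE !dq4E; ring. Qed.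
Lemma dmul1r a : dmul a dq1 = a.
Proof. by apply: dqP; rewrite !qE !dq4E; ring. Qed.
Lemma dconj_mull a : dmul (dconj a) a = dq4 (qdot a a) 0 0 0.
Proof. by apply: dqP; rewrite !qE !dq4E /qdot; ring. Qed.
Lemma dconj_mulr a : dmul a (dconj a) = dq4 (qdot a a) 0 0 0.
Proof. by apply: dqP; rewrite !qE !dq4E /qdot; ring. Qed.

End Dq4.

(** * Orthogonal frames over the dual numbers *)

Section Frame.
Variables (R : realType) (V1 V2 : dquat R).
Local Notation D := (dnum R).
Hypotheses (V10 : q0 V1 = 0) (V20 : q0 V2 = 0) (orth : qdot V1 V2 = 0).

Let v1 : D := qdot V1 V1.
Let v2 : D := qdot V2 V2.
Let u1 : D := q2 V2 * q3 V1 - q3 V2 * q2 V1.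
Let u2 : D := q3 V2 * q1 V1 - q1 V2 * q3 V1.
Let u3 : D := q1 V2 * q2 V1 - q2 V2 * q1 V1.

(** The fourth frame vector, with components [u1], [u2], [u3], is the cross product V2 x V1 in this
    order; the sign is visible in [frame_mul]. *)
Definition frame (x0 x1 x2 x3 : D) := dq4 x0
  (x1 * q1 V1 + x2 * q1 V2 + x3 * u1) (x1 * q2 V1 + x2 * q2 V2 + x3 * u2)
  (x1 * q3 V1 + x2 * q3 V2 + x3 * u3).

Let hv1 : v1 = q1 V1 * q1 V1 + q2 V1 * q2 V1 + q3 V1 * q3 V1.
Proof. by rewrite /v1 /qdot V10; ring. Qed.
Let hv2 : v2 = q1 V2 * q1 V2 + q2 V2 * q2 V2 + q3 V2 * q3 V2.
Proof. by rewrite /v2 /qdot V20; ring. Qed.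

(* Identities are first proved for arbitrary V1, V2, where they hold up to a
   multiple of the inner product of V1 and V2. *)
Let q : D := q1 V1 * q1 V2 + q2 V1 * q2 V2 + q3 V1 * q3 V2.
Let add0 (x y z : D) : x = y + q * z -> x = y.
Proof.
suff -> : q = 0 by rewrite mul0r addr0.
by rewrite -orth /qdot V10 mul0r add0r.
Qed.

Lemma frame_mul x0 x1 x2 x3 y0 y1 y2 y3 :
  dmul (frame x0 x1 x2 x3) (frame y0 y1 y2 y3) =
  frame (x0 * y0 - v1 * x1 * y1 - v2 * x2 * y2 - v1 * v2 * x3 * y3)
    (x0 * y1 + x1 * y0 + v2 * (x3 * y2 - x2 * y3))
    (x0 * y2 + x2 * y0 + v1 * (x1 * y3 - x3 * y1))
    (x0 * y3 + x3 * y0 + x2 * y1 - x1 * y2).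
Proof.
rewrite /frame /u1 /u2 /u3; apply: dqP; rewrite !qE !dq4E.
- apply: (@add0 _ _ (q * x3 * y3 - (x1 * y2 + x2 * y1))).
  by rewrite hv1 hv2 /q; ring.
- apply: (@add0 _ _ ((x3 * y1 - x1 * y3) * q1 V1 - (x3 * y2 - x2 * y3) * q1 V2)).
  by rewrite hv1 hv2 /q; ring.
- apply: (@add0 _ _ ((x3 * y1 - x1 * y3) * q2 V1 - (x3 * y2 - x2 * y3) * q2 V2)).
  by rewrite hv1 hv2 /q; ring.
- apply: (@add0 _ _ ((x3 * y1 - x1 * y3) * q3 V1 - (x3 * y2 - x2 * y3) * q3 V2)).
  by rewrite hv1 hv2 /q; ring.
Qed.

Lemma frame_qdot x0 x1 x2 x3 : qdot (frame x0 x1 x2 x3) (frame x0 x1 x2 x3) =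
  x0 * x0 + v1 * x1 * x1 + v2 * x2 * x2 + v1 * v2 * x3 * x3.
Proof.
rewrite /frame /u1 /u2 /u3 /qdot !dq4E.
apply: (@add0 _ _ (2 * x1 * x2 - q * x3 * x3)); rewrite hv1 hv2 /q; ring.
Qed.

Definition triple (a : dquat R) : D := q1 a * u1 + q2 a * u2 + q3 a * u3.

Lemma frame_decomp (a : dquat R) i1 i2 : v1 * i1 = 1 -> v2 * i2 = 1 ->
  a = frame (q0 a) (qdot a V1 * i1) (qdot a V2 * i2) (triple a * i1 * i2).
Proof.
have d1 : qdot a V1 = q1 a * q1 V1 + q2 a * q2 V1 + q3 a * q3 V1.
  by rewrite /qdot V10; ring.
have d2 : qdot a V2 = q1 a * q1 V2 + q2 a * q2 V2 + q3 a * q3 V2.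
  by rewrite /qdot V20; ring.
move=> h1 h2; have key (x y : D) : v1 * v2 * x = v1 * v2 * y -> x = y.
  move=> h; have := congr1 ( *%R (i1 * i2)) h.
  have e : i1 * i2 * (v1 * v2) = 1 by rewrite mulrACA ![_ * v1]mulrC ![_ * v2]mulrC h1 h2 mulr1.
  by rewrite !mulrA -!(mulrA _ v1) e !mul1r.
have red (X Y Z p r u : D) : v1 * v2 * (X * i1 * p + Y * i2 * r + Z * i1 * i2 * u)
    = X * v2 * p + Y * v1 * r + Z * u.
  transitivity ((v1 * i1) * X * v2 * p + (v2 * i2) * Y * v1 * r + (v1 * i1) * (v2 * i2) * Z * u).
    by ring.
  by rewrite h1 h2; ring.
rewrite /frame; apply: dqP; rewrite !dq4E //; apply: key; rewrite red d1 d2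
  /triple /u1 /u2 /u3.
- apply: (@add0 _ _ (q * q1 a - (q1 a * q1 V1 + q2 a * q2 V1 + q3 a * q3 V1) * q1 V2
    - (q1 a * q1 V2 + q2 a * q2 V2 + q3 a * q3 V2) * q1 V1)).
  by rewrite hv1 hv2 /q; ring.
- apply: (@add0 _ _ (q * q2 a - (q1 a * q1 V1 + q2 a * q2 V1 + q3 a * q3 V1) * q2 V2
    - (q1 a * q1 V2 + q2 a * q2 V2 + q3 a * q3 V2) * q2 V1)).
  by rewrite hv1 hv2 /q; ring.
- apply: (@add0 _ _ (q * q3 a - (q1 a * q1 V1 + q2 a * q2 V1 + q3 a * q3 V1) * q3 V2
    - (q1 a * q1 V2 + q2 a * q2 V2 + q3 a * q3 V2) * q3 V1)).
  by rewrite hv1 hv2 /q; ring.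
Qed.

End Frame.

Section LaxCoef.
Variable R : realFieldType.
Implicit Types e x : lax R.

Definition prod_coef e x : seq R := [::
  lb e * lb x + lc e * lc x;
  ld e * lc x - lc e * ld x - ls e * lb x - lb e * ls x;
  ls e * ls x - la e * lb x - lb e * la x - lc e * lc x - ld e * ld x;
  la e * ls x + ls e * la x + lc e * ld x - ld e * lc x;
  la e * la x + ld e * ld x].
Definition prod_coef' e x : seq R := [::
  lc e * lb x - lb e * lc x;
  ls e * lc x - lb e * ld x + lc e * ls x + ld e * lb x;
  la e * lc x + ls e * ld x - lc e * la x + ld e * ls x;
  la e * ld x - ld e * la x].

Lemma lax_mulUL e x : (laxmx e *m laxmx x) 0 0 = Poly (prod_coef e x).
Proof.
rewrite mulmx2 !mxE /= flipUR /laxUL /laxUR !cons_poly_def.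
by rewrite !(rmorphD, rmorphB, rmorphN, rmorphM) /=; ring.
Qed.
Lemma lax_mulUR e x : (laxmx e *m laxmx x) 0 1 = Poly (prod_coef' e x).
Proof.
rewrite mulmx2 !mxE /= flipUL /laxUL /laxUR !cons_poly_def.
by rewrite !(rmorphD, rmorphB, rmorphN, rmorphM) /=; ring.
Qed.

Lemma lax_mul_coef e x f y : laxmx e *m laxmx x = laxmx f *m laxmx y ->
  prod_coef e x = prod_coef f y /\ prod_coef' e x = prod_coef' f y.
Proof.
move=> h; have h0 : (laxmx e *m laxmx x) 0 0 = (laxmx f *m laxmx y) 0 0 by rewrite h.
have h1 : (laxmx e *m laxmx x) 0 1 = (laxmx f *m laxmx y) 0 1 by rewrite h.
split; apply: (@eq_from_nth _ 0) => // i _.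
  have := congr1 (fun p : {poly R} => p`_i) h0.
  by rewrite /= !lax_mulUL !coef_Poly.
have := congr1 (fun p : {poly R} => p`_i) h1.
by rewrite /= !lax_mulUR !coef_Poly.
Qed.
End LaxCoef.

Section Eval.
Variables (R : realType) (V1 V2 : dquat R).
Local Notation D := (dnum R).
Hypotheses (V10 : q0 V1 = 0) (V20 : q0 V2 = 0) (orth : qdot V1 V2 = 0).
Let v1 : D := qdot V1 V1.
Let v2 : D := qdot V2 V2.
Hypotheses (v12 : v1 + v2 = 4) (v1_gt0 : 0 < v1.1) (v2_gt0 : 0 < v2.1)
  (v1_neq0 : v1.2 != 0).

Definition dnum_inv (x : D) : D := (x.1^-1, - x.2 / x.1 ^+ 2).
Lemma dnum_mulV (x : D) : x.1 != 0 -> x * dnum_inv x = 1.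
Proof. by move=> x0; congr pair; rewrite /= ?divff //; field. Qed.

Let i1 := dnum_inv v1.
Let i2 := dnum_inv v2.
Let vi1 : v1 * i1 = 1. Proof. by apply: dnum_mulV; rewrite gt_eqF. Qed.
Let vi2 : v2 * i2 = 1. Proof. by apply: dnum_mulV; rewrite gt_eqF. Qed.
(** This and the next two identities all come from [v1 + v2 = 4]. They reduce the products of norms
    and inverse norms in [lax_evM] to real combinations of 1, [i1], [i2]. *)
Let i12 : 4 * i1 * i2 = i1 + i2.
Proof.
transitivity ((v1 * i1) * i2 + (v2 * i2) * i1); first by rewrite -v12; ring.
by rewrite vi1 vi2; ring.
Qed.
Let v1i2 : v1 * i2 = 4 * i2 - 1.
Proof. by rewrite -v12 -vi2; ring. Qed.
Let v2i1 : v2 * i1 = 4 * i1 - 1.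
Proof. by rewrite -v12 -vi1; ring. Qed.

Local Notation rd := (@real_dnum R).
Lemma real_dnumD (x y : R) : rd (x + y) = rd x + rd y.
Proof. by congr pair; rewrite /= addr0. Qed.
Lemma real_dnumN (x : R) : rd (- x) = - rd x.
Proof. by congr pair; rewrite /= oppr0. Qed.
Lemma real_dnumM (x y : R) : rd (x * y) = rd x * rd y.
Proof. by congr pair; rewrite /= mulr0 mul0r addr0. Qed.
Definition rdE := (real_dnumD, real_dnumN, real_dnumM).

(** The pairings with V1 and V2 are the real numbers 2 c and - 2 d, and the triple product is a [v1]
    + b [v2]. Lying in W means that the first two and the scalar part are real, while [v1], [v2]
    form a real basis of the dual numbers; so these are exactly the elements of W. *)
Definition lax_ev (e : lax R) : dquat R :=
  frame V1 V2 (rd (ls e)) (2 * rd (lc e) * i1) (- 2 * rd (ld e) * i2)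
    (rd (la e) * i2 + rd (lb e) * i1).

Lemma lax_evM e x : dmul (lax_ev e) (lax_ev x) =
  let c i := rd (prod_coef e x)`_i in let d i := rd (prod_coef' e x)`_i in
  frame V1 V2 (c 2%N + c 4%N + c 0%N - 4 * i2 * c 4%N - 4 * i1 * c 0%N)
    (2 * i1 * d 1%N - 2 * i2 * d 3%N) (2 * i1 * d 0%N - 2 * i2 * d 2%N)
    (i2 * c 3%N - i1 * c 1%N).
Proof.
rewrite /lax_ev frame_mul // -/v1 -/v2 /=.
set s := rd (ls e); set A := rd (la e); set B := rd (lb e).
set C := rd (lc e); set E := rd (ld e).
set s' := rd (ls x); set A' := rd (la x); set B' := rd (lb x).
set C' := rd (lc x); set E' := rd (ld x).
rewrite !rdE -/s -/A -/B -/C -/E -/s' -/A' -/B' -/C' -/E'.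
congr (frame _ _ _ _ _ _).
- transitivity (s * s' - 4 * C * C' * (v1 * i1) * i1 - 4 * E * E' * (v2 * i2) * i2
    - (A * A' * (v1 * i2) * (v2 * i2) + B * B' * (v1 * i1) * (v2 * i1)
       + (A * B' + B * A') * (v1 * i1) * (v2 * i2))); first by ring.
  by rewrite vi1 vi2 v1i2 v2i1; ring.
- transitivity (2 * i1 * (s * C' + C * s') - 2 * (A * E' - E * A') * (v2 * i2) * i2
    - 2 * (B * E' - E * B') * (v2 * i2) * i1); first by ring.
  by rewrite vi2; ring.
- transitivity (- 2 * i2 * (s * E' + E * s') + 2 * (C * A' - A * C') * (v1 * i1) * i2
    + 2 * (C * B' - B * C') * (v1 * i1) * i1); first by ring.
  by rewrite vi1; ring.
- transitivity ((s * A' + s' * A) * i2 + (s * B' + s' * B) * i1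
    + (C * E' - E * C') * (4 * i1 * i2)); first by ring.
  by rewrite i12; ring.
Qed.

Lemma lax_ev_face e x f y : laxmx e *m laxmx x = laxmx f *m laxmx y ->
  dmul (lax_ev e) (lax_ev x) = dmul (lax_ev f) (lax_ev y).
Proof. by move=> /lax_mul_coef[h1 h2]; rewrite !lax_evM h1 h2. Qed.

Lemma lax_ev_conj e : lax_ev (laxconj e) = dconj (lax_ev e).
Proof.
by apply: dqP; rewrite !qE /lax_ev /frame !dq4E /= ?real_dnumN //; ring.
Qed.

(** For t = [v1 / v2], the factors [4 * i2 - 1] and [4 * i1 - 1] are t and 1 / t: this is [lnorm e]
    at z^2 = - t, divided by z^2. *)
Lemma lax_ev_norm e : qdot (lax_ev e) (lax_ev e) =
  rd (norm2 e) - (4 * i2 - 1) * rd (norm4 e) - (4 * i1 - 1) * rd (norm0 e).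
Proof.
rewrite /lax_ev frame_qdot // -/v1 -/v2 /norm2 /norm4 /norm0 !expr2.
rewrite -[2 * la e * lb e]mulrA [2 * (la e * lb e)]mulr_natl mulr2n !rdE.
set s := rd (ls e); set A := rd (la e); set B := rd (lb e).
set C := rd (lc e); set E := rd (ld e).
transitivity (s * s + 4 * C * C * (v1 * i1) * i1 + 4 * E * E * (v2 * i2) * i2
    + (A * A * (v1 * i2) * (v2 * i2) + B * B * (v1 * i1) * (v2 * i1)
       + 2 * A * B * (v1 * i1) * (v2 * i2))); first by ring.
by rewrite vi1 vi2 v1i2 v2i1; ring.
Qed.

End Eval.

Section DualNumberProjections.
Variable R : comNzRingType.
Implicit Types x y : dnum R.
Lemma dnumD1 x y : (x + y).1 = x.1 + y.1. Proof. by []. Qed.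
Lemma dnumD2 x y : (x + y).2 = x.2 + y.2. Proof. by []. Qed.
Lemma dnumN1 x : (- x).1 = - x.1. Proof. by []. Qed.
Lemma dnumN2 x : (- x).2 = - x.2. Proof. by []. Qed.
Lemma dnumM1 x y : (x * y).1 = x.1 * y.1. Proof. by []. Qed.
Lemma dnumM2 x y : (x * y).2 = x.1 * y.2 + x.2 * y.1. Proof. by []. Qed.
Lemma real_dnum1 (c : R) : (real_dnum c).1 = c. Proof. by []. Qed.
Lemma real_dnum2 (c : R) : (real_dnum c).2 = 0. Proof. by []. Qed.
Lemma dnum_nat1 n : (n%:R : dnum R).1 = n%:R.
Proof. by elim: n => // n ih; rewrite !mulrSr dnumD1 ih. Qed.
Lemma dnum_nat2 n : (n%:R : dnum R).2 = 0.
Proof. by elim: n => // n ih; rewrite !mulrSr dnumD2 ih addr0. Qed.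
Lemma dnum_eq x y : x.1 = y.1 -> x.2 = y.2 -> x = y.
Proof. by case: x y => [? ?] [? ?] /= -> ->. Qed.
Definition dnE := (dnumD1, dnumD2, dnumN1, dnumN2, dnumM1, dnumM2, real_dnum1, real_dnum2,
  dnum_nat1, dnum_nat2, (erefl : (1 : dnum R).1 = 1), (erefl : (1 : dnum R).2 = 0)).
End DualNumberProjections.

(** With t = x / y one has d = n2 - t n4 - n0 / t. The dual part of t is 4 [x.2 / y.1 ^+ 2], hence
    nonzero, and the vanishing of [d.2] forces n0 to be n4 times the squared real part of t. *)
Lemma norm_coef (R : realType) (x y : dnum R) (n4 n2 n0 : R)
    (d := real_dnum n2 - (4 * dnum_inv y - 1) * real_dnum n4
          - (4 * dnum_inv x - 1) * real_dnum n0) :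
  x + y = 4 -> 0 < x.1 -> 0 < y.1 -> x.2 != 0 -> d.2 = 0 ->
  n0 = (x.1 / y.1) ^+ 2 * n4 /\ d.1 = n2 - 2 * (x.1 / y.1) * n4.
Proof.
rewrite {}/d; case: x y => [a e] [b f] /= [h1 h2] a0 b0 e0.
have a0' : a != 0 by rewrite gt_eqF.
have b0' : b != 0 by rewrite gt_eqF.
have {h2} -> : f = - e by lra.
have hb : b = 4 - a by lra.
move=> h.
have hn : n0 = (a / b) ^+ 2 * n4.
  have e1 : e / a ^+ 2 * 4 != 0.
    by rewrite mulf_neq0 ?pnatr_eq0 // mulf_neq0 ?invr_neq0 ?expf_neq0.
  apply: (mulfI e1); apply/eqP; rewrite -subr_eq0 -[X in _ == X]h; apply/eqP.
  by field; rewrite a0' b0'.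
split=> //; rewrite hn; rewrite hb in b0' *; field.
by rewrite a0' b0'.
Qed.

(** Cramer's rule for x and y as a real basis of the dual numbers; the determinant is - 4 [x.2]. *)
Lemma span_coef (R : realType) (x y : dnum R) (a b : R)
    (t := real_dnum a * x + real_dnum b * y) : x + y = 4 -> x.2 != 0 ->
  (t.1 + y.1 * t.2 / x.2) / 4 = a /\ (t.1 - x.1 * t.2 / x.2) / 4 = b.
Proof.
rewrite {}/t; case: x y => [c e] [d f] /= [h1 h2] e0.
have {h2} -> : f = - e by lra.
have -> : d = 4 - c by lra.
by split; field.
Qed.

Lemma span_coefK (R : realType) (x y t : dnum R) : x + y = 4 -> x.2 != 0 ->
  t = real_dnum ((t.1 + y.1 * t.2 / x.2) / 4) * x
    + real_dnum ((t.1 - x.1 * t.2 / x.2) / 4) * y.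
Proof.
case: x y t => [c e] [d f] [u v] /= [h1 h2] e0.
have {h2} -> : f = - e by lra.
have -> : d = 4 - c by lra.
by congr pair => /=; field.
Qed.

Section FrameSpan.
Variables (R : realType) (V1 V2 : dquat R).
Hypotheses (V10 : q0 V1 = 0) (V20 : q0 V2 = 0) (orth : qdot V1 V2 = 0).
Lemma frame_dot1 x0 x1 x2 x3 : qdot (frame V1 V2 x0 x1 x2 x3) V1 = x1 * qdot V1 V1.
Proof.
transitivity (x1 * qdot V1 V1 + x2 * qdot V1 V2); last by rewrite orth mulr0 addr0.
by rewrite /frame /qdot !dq4E V10 V20; ring.
Qed.
Lemma frame_dot2 x0 x1 x2 x3 : qdot (frame V1 V2 x0 x1 x2 x3) V2 = x2 * qdot V2 V2.
Proof.
transitivity (x2 * qdot V2 V2 + x1 * qdot V1 V2); last by rewrite orth mulr0 addr0.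
by rewrite /frame /qdot !dq4E V10 V20; ring.
Qed.
Lemma frame_triple x0 x1 x2 x3 : triple V1 V2 (frame V1 V2 x0 x1 x2 x3) =
  x3 * (qdot V1 V1 * qdot V2 V2).
Proof.
transitivity (x3 * (qdot V1 V1 * qdot V2 V2) - x3 * qdot V1 V2 * qdot V1 V2).
  by rewrite /frame /triple /qdot !dq4E V10 V20; ring.
by rewrite orth mulr0 subr0.
Qed.
End FrameSpan.

Section Lift.
Variables (R : realType) (V1 V2 : dquat R).
Local Notation D := (dnum R).
Hypotheses (V10 : q0 V1 = 0) (V20 : q0 V2 = 0) (orth : qdot V1 V2 = 0).
Let v1 : D := qdot V1 V1.
Let v2 : D := qdot V2 V2.
Hypotheses (v12 : v1 + v2 = 4) (v1_gt0 : 0 < v1.1) (v2_gt0 : 0 < v2.1)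
  (v1_neq0 : v1.2 != 0).
Local Notation rd := (@real_dnum R).
Let i1 := dnum_inv v1.
Let i2 := dnum_inv v2.
Let vi1 : v1 * i1 = 1. Proof. by apply: dnum_mulV; rewrite gt_eqF. Qed.
Let vi2 : v2 * i2 = 1. Proof. by apply: dnum_mulV; rewrite gt_eqF. Qed.
Let a := v1.1.
Let b := v2.1.
Let e := v1.2.
Let ab : a + b = 4.
Proof. by have := congr1 fst v12; rewrite /= => ->; ring. Qed.
Let v2e : v2.2 = - e.
Proof.
have := congr1 snd v12; rewrite /= => h; apply/eqP; rewrite -addr_eq0 addrC.
by rewrite /e h; apply/eqP; ring.
Qed.

Let rd2 x : 2 * rd x = rd (2 * x).
Proof. by congr pair => /=; ring. Qed.

Definition inW (r : dquat R) :=
  [/\ (q0 r).2 = 0, (qdot r V1).2 = 0 & (qdot r V2).2 = 0].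

Definition lax_lift (r : dquat R) : lax R :=
  let x := triple V1 V2 r in
  Lax (q0 r).1 ((x.1 + b * x.2 / e) / 4) ((x.1 - a * x.2 / e) / 4)
      ((qdot r V1).1 / 2) (- (qdot r V2).1 / 2).

Lemma ev_q0 f : q0 (lax_ev V1 V2 f) = rd (ls f).
Proof. by rewrite /lax_ev /frame dq4E. Qed.
Lemma ev_dot1 f : qdot (lax_ev V1 V2 f) V1 = rd (2 * lc f).
Proof.
rewrite /lax_ev frame_dot1 // -/v1 -/i1.
transitivity (2 * rd (lc f) * (v1 * i1)); first by ring.
rewrite vi1 mulr1.
exact: rd2.
Qed.
Lemma ev_dot2 f : qdot (lax_ev V1 V2 f) V2 = rd (- (2 * ld f)).
Proof.
rewrite /lax_ev frame_dot2 // -/v2 -/i2.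
transitivity (- 2 * rd (ld f) * (v2 * i2)); first by ring.
rewrite vi2 mulr1.
by rewrite mulNr rd2 real_dnumN.
Qed.
Lemma ev_triple f : triple V1 V2 (lax_ev V1 V2 f) = rd (la f) * v1 + rd (lb f) * v2.
Proof.
rewrite /lax_ev frame_triple // -/v1 -/v2 -/i1 -/i2.
transitivity (rd (la f) * v1 * (v2 * i2) + rd (lb f) * v2 * (v1 * i1)).
  by ring.
by rewrite vi1 vi2 !mulr1.
Qed.

Lemma ev_inW f : inW (lax_ev V1 V2 f).
Proof. by split; rewrite ?ev_q0 ?ev_dot1 ?ev_dot2. Qed.

Lemma lax_liftK f : lax_lift (lax_ev V1 V2 f) = f.
Proof.
rewrite /lax_lift ev_q0 ev_dot1 ev_dot2 ev_triple; case: f => s A B C E.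
have [-> ->] := span_coef A B v12 v1_neq0.
by congr Lax => /=; field.
Qed.

Lemma lax_evK r : inW r -> lax_ev V1 V2 (lax_lift r) = r.
Proof.
move=> [h0 h1 h2]; rewrite [RHS](frame_decomp V10 V20 orth r vi1 vi2).
rewrite /lax_ev -/v1 -/v2 -/i1 -/i2.
have rdE (x : D) : x.2 = 0 -> x = rd x.1.
  by move=> hx; rewrite [LHS]surjective_pairing hx.
congr (frame _ _ _ _ _ _).
- by rewrite [RHS]rdE.
- rewrite [in RHS](rdE _ h1); congr (_ * _).
  by congr pair => /=; field.
- rewrite [in RHS](rdE _ h2); congr (_ * _).
  by congr pair => /=; field.
- have ht : triple V1 V2 r =
    rd (la (lax_lift r)) * v1 + rd (lb (lax_lift r)) * v2.
    exact: span_coefK v12 v1_neq0.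
  rewrite ht; move: (la _) (lb _) => A' B'.
  set A := rd _; set B := rd _.
  transitivity (A * i2 * (v1 * i1) + B * i1 * (v2 * i2)); last by ring.
  by rewrite vi1 vi2 !mulr1.
Qed.

Lemma ev_null f : (qdot (lax_ev V1 V2 f) (lax_ev V1 V2 f)).2 = 0 ->
  norm0 f = (a / b) ^+ 2 * norm4 f /\
  (qdot (lax_ev V1 V2 f) (lax_ev V1 V2 f)).1 = norm2 f - 2 * (a / b) * norm4 f.
Proof.
by rewrite lax_ev_norm //; apply: norm_coef.
Qed.

End Lift.

(** * Closing a cube of Lax matrices *)

Section Balanced.
Variables (R : realFieldType) (w : R).
Hypothesis w0 : w != 0.
Local Notation lax0 := (Lax 0 0 0 0 0 : lax R).
Implicit Types e f x y : lax R.

(** For w the real part of [v1 / v2], the first condition says that [lax_ev e] is null, and the last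
    that its real norm [norm2 - 2 * w * norm4] does not vanish, so that it is a displacement. The
    middle one makes the determinant a genuine quartic. *)
Definition balanced e :=
  [/\ norm0 e = w ^+ 2 * norm4 e, norm4 e != 0 & norm2 e != 2 * w * norm4 e].
(** For balanced e and f this is coprimality of their determinants. *)
Definition distinct e f := norm4 f * norm2 e != norm4 e * norm2 f.

Lemma lnorm_coefs e f (k : R) : lnorm e = k%:P * lnorm f ->
  [/\ norm4 e = k * norm4 f, norm2 e = k * norm2 f & norm0 e = k * norm0 f].
Proof.
move=> /polyP h; move: (h 4%N) (h 2%N) (h 0%N).
rewrite /lnorm !coefE /= => h4 h2 h0; move: h4 h2 h0.
by rewrite !(mulr0, mulr1, addr0, add0r).
Qed.

Lemma balanced_scale e f k : k != 0 -> lnorm e = k%:P * lnorm f ->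
  balanced f -> balanced e.
Proof.
move=> k0 /lnorm_coefs[h4 h2 h0] [f0 f4 f2]; split.
- by rewrite h0 h4 f0; ring.
- by rewrite h4 mulf_neq0.
- rewrite h4 h2; apply: contra_neq f2 => h; apply: (mulfI k0); rewrite h; ring.
Qed.

Lemma distinct_scale e f e' f' k k' : k != 0 -> k' != 0 ->
  lnorm e = k%:P * lnorm e' -> lnorm f = k'%:P * lnorm f' ->
  distinct e' f' -> distinct e f.
Proof.
move=> k0 k'0 /lnorm_coefs[e4 e2 _] /lnorm_coefs[f4 f2 _].
rewrite /distinct e4 e2 f4 f2 => h; apply: contra_neq h => h.
by apply: (mulfI (mulf_neq0 k0 k'0)); rewrite mulrACA mulrC -mulrACA mulrC; lra.
Qed.

Lemma balanced_neq0 e : balanced e -> e <> lax0.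
Proof.
by case=> _ h _ e0; move: h; rewrite e0 /norm4 /= expr0n /= addr0 oppr0 eqxx.
Qed.

Lemma lax_face_norm e f x y : balanced e -> balanced f -> distinct e f ->
  laxmx e *m laxmx x = laxmx f *m laxmx y -> x <> lax0 ->
  exists2 k, k != 0 & lnorm x = k%:P * lnorm f /\ lnorm y = k%:P * lnorm e.
Proof.
move=> [e0 _ _] [f0 _ _] hd hE x0.
have [k [hx hy]] := lax_transfer e0 f0 (expf_neq0 2 w0) hd hE.
exists k => //; apply: contra_neq (lnorm_neq0 x0) => k0.
by rewrite hx k0 mul0r.
Qed.

Lemma laxmx0 : laxmx lax0 = 0.
Proof.
apply: mx2P; rewrite !mxE /= ?flipUL ?flipUR /laxUL /laxUR /= ?polyC0; ring.
Qed.

Lemma lax_face_ex e f : balanced e -> balanced f -> distinct e f ->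
  exists x y, [/\ x <> lax0, y <> lax0 &
    laxmx e *m laxmx x = laxmx f *m laxmx y].
Proof.
move=> he hf hd; have [x [y [hxy hE]]] := lax_kernel e f.
have z0 g z : balanced g -> laxmx g *m laxmx z = 0 -> z = lax0.
  move=> hg h; apply: laxmx_inj; apply: (lax_canl (balanced_neq0 hg)).
  by rewrite h laxmx0 mulmx0.
exists x, y; split=> // h0; apply: hxy; split=> //.
  by apply: (z0 f) => //; rewrite -hE h0 laxmx0 mulmx0.
by apply: (z0 e) => //; rewrite hE h0 laxmx0 mulmx0.
Qed.

(** By the faces through e1, the paths e2 y u and e3 y' u' have the same product. Division by the
    face of e2 and e3 then splits z off from y u. *)
Lemma lax_cube e1 e2 e3 x y x' y' z z' u u' :
  balanced e1 -> balanced e2 -> balanced e3 ->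
  distinct e1 e2 -> distinct e1 e3 -> distinct e2 e3 ->
  laxmx e1 *m laxmx x = laxmx e2 *m laxmx y ->
  laxmx e1 *m laxmx x' = laxmx e3 *m laxmx y' ->
  laxmx e2 *m laxmx z = laxmx e3 *m laxmx z' -> z <> lax0 ->
  laxmx x *m laxmx u = laxmx x' *m laxmx u' ->
  exists v, laxmx y *m laxmx u = laxmx z *m laxmx v.
Proof.
move=> h1 h2 h3 d12 d13 d23 f12 f13 f23 z0 fu.
have [hb2 _ _] := h2; have [hb3 h34 _] := h3.
have hE : laxmx e2 *m (laxmx y *m laxmx u) = laxmx e3 *m (laxmx y' *m laxmx u').
  by rewrite !mulmxA -f12 -f13 -!mulmxA fu.
have hw : weight 2 (laxmx y *m laxmx u).
  by apply: weightM (weight_lax _) => //; apply: twisted_lax.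
have [v [hv _]] := lax_division hb2 hb3 (expf_neq0 2 w0) h34 d23 f23 z0
  (twisted_lax2 _ _) hw
  (twisted_lax2 _ _) hE.
by exists v.
Qed.
End Balanced.

Section Core.
Variables (R : realType) (V1 V2 : dquat R).
Local Notation D := (dnum R).
Hypotheses (V10 : q0 V1 = 0) (V20 : q0 V2 = 0) (orth : qdot V1 V2 = 0).
Let v1 : D := qdot V1 V1.
Let v2 : D := qdot V2 V2.
Hypotheses (v12 : v1 + v2 = 4) (v1_gt0 : 0 < v1.1) (v2_gt0 : 0 < v2.1)
  (v1_neq0 : v1.2 != 0).
Let w : R := v1.1 / v2.1.
Let w0 : w != 0. Proof. by rewrite mulf_neq0 ?invr_eq0 ?gt_eqF. Qed.
Local Notation lax0 := (Lax 0 0 0 0 0 : lax R).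
Local Notation ev := (lax_ev V1 V2).
Local Notation inW := (inW V1 V2).
Local Notation lift := (lax_lift V1 V2).
Local Notation one := (dq1 R).

Definition sqn (a : dquat R) : R := (qdot a a).1.
Definition nullq (a : dquat R) : Prop := (qdot a a).2 = 0.

Lemma ev_norm_null e : norm0 e = w ^+ 2 * norm4 e -> nullq (ev e).
Proof.
rewrite /nullq lax_ev_norm // -/v1 -/v2 => ->.
move: v12 v1_gt0 v2_gt0; rewrite /w; case: v1 v2 => [a t] [b s] /= [h1 h2] a0 b0.
have -> : s = - t by lra.
field; by rewrite !gt_eqF.
Qed.

Lemma ev_scale k e : ev (lax_scale k e) = k *: ev e.
Proof. by apply: dqP; rewrite !qE /lax_ev /frame !dq4E /= ?real_dnumM; ring. Qed.

Lemma ev_inj e f : ev e = ev f -> e = f.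
Proof. by move=> h; rewrite -[e](lax_liftK V10 V20 orth v12) // h lax_liftK. Qed.

Lemma null_mul_conj a : nullq a -> dmul (dconj a) a = sqn a *: one.
Proof.
rewrite /nullq /sqn dconj_mull => h.
by apply: dqP; rewrite !qE !dq4E ?mulr0 // mulr1 [LHS]surjective_pairing h.
Qed.
Lemma null_conj_mul a : nullq a -> dmul a (dconj a) = sqn a *: one.
Proof.
rewrite /nullq /sqn dconj_mulr => h.
by apply: dqP; rewrite !qE !dq4E ?mulr0 // mulr1 [LHS]surjective_pairing h.
Qed.

Lemma ev_sqn e : norm0 e = w ^+ 2 * norm4 e -> sqn (ev e) = norm2 e - 2 * w * norm4 e.
Proof.
move=> h; have hn := ev_norm_null h.
by have [_] := ev_null V10 V20 orth v12 v1_gt0 v2_gt0 v1_neq0 hn.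
Qed.

(** If the product were a real number, x and y would be real multiples of the conjugates of e and f.
    Comparing leading coefficients of the two matrix products would then make the ratios of [norm4]
    to [norm2] equal. *)
Lemma face_not_one e f x y k : balanced w e -> balanced w f -> distinct e f ->
  laxmx e *m laxmx x = laxmx f *m laxmx y -> x <> lax0 ->
  dmul (ev e) (ev x) = k *: one -> False.
Proof.
move=> he hf hd hE x0 h1; have h2 := h1.
rewrite (lax_ev_face V10 V20 orth v12 v1_gt0 v2_gt0 hE) in h2.
have hB g z : balanced w g -> dmul (ev g) (ev z) = k *: one ->
    sqn (ev g) != 0 /\ lax_scale (sqn (ev g)) z = lax_scale k (laxconj g).
  move=> [g0 g4 g2] h; split; first by rewrite ev_sqn // subr_eq0.
  apply: ev_inj; rewrite !ev_scale lax_ev_conj.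
  have := congr1 (dmul (dconj (ev g))) h.
  rewrite dmulA null_mul_conj ?dmulZl ?dmul1l ?dmulZr ?dmul1r //.
  exact: ev_norm_null.
have [Ne hx] := hB _ _ he h1; have [Nf hy] := hB _ _ hf h2.
set p := sqn (ev e) in Ne hx; set q := sqn (ev f) in Nf hy.
have key (g z : lax R) c : lax_scale c z = lax_scale k (laxconj g) ->
    c%:P *: (laxmx g *m laxmx z) = (k%:P * lnorm g)%:M.
  move=> h; rewrite scalemxAr -laxmx_scale h laxmx_scale -scalemxAr lax_conjr.
  by rewrite scale_scalar_mx.
have hc : (p%:P * q%:P) *: (laxmx e *m laxmx x) = (p%:P * q%:P) *: (laxmx f *m laxmx y).
  by rewrite hE.
rewrite -[in RHS]scalerA key // mulrC -scalerA key // !scale_scalar_mx in hc.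
have h4 : (q * k) * norm4 e = (p * k) * norm4 f.
  have /matrixP/(_ 0 0) := hc; rewrite !mxE /= !mulr1n => /(congr1 (fun r : {poly R} => r`_4)).
  by rewrite !mulrA -!polyCM /lnorm !mulrDr !coefE /= !(mulr0, mulr1, addr0, add0r).
have [he0 he4 _] := he; have [hf0 _ _] := hf.
have k0 : k = 0.
  apply/eqP; apply: contraTT hd => k0; rewrite negbK; apply/eqP.
  move: h4; rewrite /p /q !ev_sqn // -!mulrA ![_ * (k * _)]mulrCA => /(mulfI k0) h.
  by lra.
apply: x0; apply: laxmx_inj; rewrite laxmx0.
apply: (scalemx_inj (c := p%:P)); first by rewrite polyC_eq0.
by rewrite -laxmx_scale hx k0 scaler0 laxmx_scale polyC0 scale0r.
Qed.

Lemma nullqM a b : nullq a -> nullq b -> nullq (dmul a b).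
Proof. by rewrite /nullq qdot_mull dnumM2 => -> ->; rewrite mulr0 mul0r addr0. Qed.
Lemma sqnM a b : sqn (dmul a b) = sqn a * sqn b.
Proof. by rewrite /sqn qdot_mull. Qed.

Lemma qdotZl (k : R) a b : qdot (k *: a) b = real_dnum k * qdot a b.
Proof. by rewrite /qdot !qE; ring. Qed.
Lemma inWZ k r : inW r -> inW (k *: r).
Proof.
by case=> h0 h1 h2; split; rewrite ?q0Z ?qdotZl dnumM2 ?(h0, h1, h2) mulr0 mul0r addr0.
Qed.

Lemma dconjZ (k : R) a : dconj (k *: a) = k *: dconj a.
Proof. by apply: dqP; rewrite !qE; ring. Qed.

Definition adj a b := inW (dmul (dconj a) b).
(** All that closing the cube uses about a fourth vertex d, whatever formula produces d. *)
Definition unique_fourth a b c d := forall z, nullq z -> adj b z -> adj c z ->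
  exists k, z = k *: a \/ z = k *: d.

Lemma unique_fourthZ a b c d (k l : R) : k != 0 -> l != 0 ->
  unique_fourth a b c d -> unique_fourth a (k *: b) (l *: c) d.
Proof.
have key (m : R) p z : m != 0 -> adj (m *: p) z -> adj p z.
  move=> m0 /(inWZ m^-1); rewrite dconjZ dmulZl scalerA.
  by rewrite mulVf; [rewrite scale1r | exact: m0].
by move=> k0 l0 h z hz hb hc; apply: h (hz) (key _ _ _ k0 hb) (key _ _ _ l0 hc).
Qed.

Lemma balanced_null e : balanced w e -> nullq (ev e).
Proof. by case=> h _ _; apply: ev_norm_null. Qed.
Lemma balanced_sqn e : balanced w e -> sqn (ev e) != 0.
Proof. by case=> h _ h2; rewrite ev_sqn // subr_eq0. Qed.

Lemma face_step P e f x y d : nullq P -> sqn P != 0 ->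
  balanced w e -> balanced w f -> distinct e f ->
  laxmx e *m laxmx x = laxmx f *m laxmx y -> x <> lax0 ->
  unique_fourth P (dmul P (ev e)) (dmul P (ev f)) d ->
  exists2 k, k != 0 & dmul (dmul P (ev e)) (ev x) = k *: d.
Proof.
move=> nP sP he hf hd hE x0 hu.
have [k k0 [hx hy]] := lax_face_norm w0 he hf hd hE x0.
have bx := balanced_scale k0 hx hf; have by_ := balanced_scale k0 hy he.
have fE := lax_ev_face V10 V20 orth v12 v1_gt0 v2_gt0 hE.
have adjP B g : nullq B -> adj B (dmul B (ev g)).
  move=> nB; rewrite /adj dmulA (null_mul_conj nB) dmulZl dmul1l.
  by apply: inWZ; apply: ev_inW V10 V20 orth v1_gt0 v2_gt0 _.
have nz := fun l => @face_not_one e f x y l he hf hd hE x0.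
have canP l z : dmul P z = l *: P -> z = l *: one.
  move=> /(congr1 (dmul (dconj P))); rewrite dmulA dmulZr !(null_mul_conj nP).
  by rewrite dmulZl dmul1l scalerA mulrC -scalerA => /(scalerI sP).
case: (hu (dmul (dmul P (ev e)) (ev x))).
- by apply: nullqM (balanced_null bx); apply: nullqM (balanced_null he).
- by apply: adjP; apply: nullqM (balanced_null he).
- rewrite -dmulA fE dmulA; apply: adjP; exact: nullqM (balanced_null hf).
move=> l [h|h].
  by case: (nz l); apply: canP; rewrite dmulA.
exists l; last exact: h.
apply/eqP => l0; apply: (nz 0); apply: canP.
by rewrite dmulA h l0 !scale0r.
Qed.

Lemma cube_closes P e1 e2 e3 d12 d13 d23 z z' : nullq P -> sqn P != 0 ->
  balanced w e1 -> balanced w e2 -> balanced w e3 ->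
  distinct e1 e2 -> distinct e1 e3 -> distinct e2 e3 ->
  let B e := dmul P (ev e) in
  unique_fourth P (B e1) (B e2) d12 -> unique_fourth P (B e1) (B e3) d13 ->
  unique_fourth P (B e2) (B e3) d23 ->
  unique_fourth (B e1) d12 d13 z -> unique_fourth (B e2) d12 d23 z' ->
  exists2 k, k != 0 & z' = k *: z.
Proof.
move=> nP sP b1 b2 b3 D12 D13 D23 B u12 u13 u23 uz uz'.
have [x [y [x0 y0 f12]]] := lax_face_ex b1 b2 D12.
have [x' [y' [x'0 y'0 f13]]] := lax_face_ex b1 b3 D13.
have [t [t' [t0 t'0 f23]]] := lax_face_ex b2 b3 D23.
have [k12 k12n h12] := face_step nP sP b1 b2 D12 f12 x0 u12.
have [k13 k13n h13] := face_step nP sP b1 b3 D13 f13 x'0 u13.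
have [k23 k23n h23] := face_step nP sP b2 b3 D23 f23 t0 u23.
have [n12 n12n [nx ny]] := lax_face_norm w0 b1 b2 D12 f12 x0.
have [n13 n13n [nx' ny']] := lax_face_norm w0 b1 b3 D13 f13 x'0.
have [n23 n23n [nt nt']] := lax_face_norm w0 b2 b3 D23 f23 t0.
have bx := balanced_scale n12n nx b2; have bx' := balanced_scale n13n nx' b3.
have by_ := balanced_scale n12n ny b1; have bt := balanced_scale n23n nt b3.
have Dx := distinct_scale n12n n13n nx nx' D23.
have Dy := distinct_scale n12n n23n ny nt D13.
have [u [u' [u0 u'0 fu]]] := lax_face_ex bx bx' Dx.
have [v fv] := lax_cube w0 b1 b2 b3 D12 D13 D23 f12 f13 f23 t0 fu.
have nB e : balanced w e -> nullq (B e).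
  by move=> /balanced_null; apply: nullqM.
have sB e : balanced w e -> sqn (B e) != 0.
  by move=> /balanced_sqn h; rewrite sqnM mulf_neq0.
have g12 : dmul (B e2) (ev y) = k12 *: d12.
  rewrite -h12 /B -[LHS]dmulA -[RHS]dmulA.
  by rewrite (lax_ev_face V10 V20 orth v12 v1_gt0 v2_gt0 f12).
have [k kn hz] := face_step (nB _ b1) (sB _ b1) bx bx' Dx fu u0
  (eq_ind_r (fun c => unique_fourth (B e1) c _ z)
    (eq_ind_r (fun c => unique_fourth (B e1) _ c z) (unique_fourthZ k12n k13n uz) h13) h12).
have [k' k'n hz'] := face_step (nB _ b2) (sB _ b2) by_ bt Dy fv u0
  (eq_ind_r (fun c => unique_fourth (B e2) c _ z')
    (eq_ind_r (fun c => unique_fourth (B e2) _ c z') (unique_fourthZ k12n k23n uz') h23) g12).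
exists (k'^-1 * k); first by rewrite mulf_neq0 ?invr_eq0.
(* Both sides are the scaled vertex d12 multiplied by [ev u]. *)
have e : k *: z = k' *: z'.
  exact: etrans (esym hz) (etrans (congr1 (fun p => dmul p (ev u))
    (etrans h12 (esym g12))) hz').
by rewrite -scalerA e scalerA (mulVf k'n) scale1r.
Qed.

End Core.

(** * The fourth vertex of a face *)

Section Fourth.
Variable R : realType.
Implicit Types (a b c d z : dquat R) (M N : line R).

Definition line_dq M : dquat R :=
  mkdq (mkquat 0 (direction M)) (mkquat 0 (- moment M)).
Definition eps_mul a : dquat R := mkdq 0 (primal a).

Definition linked M N a b := [/\ bform a b = 0,
  bform (dmul a (line_dq M)) b = 0 & bform (dmul a (line_dq N)) b = 0].

(* Vanishing against the first six vectors means being linked to b and c; the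
   last two fix the component along a. *)
Definition test_vectors M N a b c : seq (dquat R) :=
  [:: b; dmul b (line_dq M); dmul b (line_dq N);
      c; dmul c (line_dq M); dmul c (line_dq N); eps_mul a; a].

Definition test_mx M N a b c : 'M[R]_((1 + 3) + (1 + 3)) :=
  \matrix_(i, j) (row_mx (dual (test_vectors M N a b c)`_i)
                         (primal (test_vectors M N a b c)`_i) : dquat R) 0 j.

Definition test_det M N a b c := \det (test_mx M N a b c).

(** The last column of the adjugate: it is orthogonal to the first seven test vectors, and its
    pairing with a is [test_det]. *)
Definition fourth_dir M N a b c : dquat R :=
  \row_j cofactor (test_mx M N a b c) ord_max j.

(* The reflection of a in the hyperplane orthogonal to fourth_dir. *)
Definition fourth M N a b c : dquat R :=
  let s := fourth_dir M N a b c in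
  (- bform s s) *: a + (2 * test_det M N a b c) *: s.

Lemma bform_sum a d :
  bform a d = \sum_j (row_mx (dual a) (primal a) : dquat R) 0 j * d 0 j.
Proof.
rewrite big_split_ord /bform /dot addrC; congr (_ + _); apply: eq_bigr => j _.
  by rewrite (row_mxEl (dual a)); congr (_ * _); rewrite mxE.
by rewrite (row_mxEr (dual a)); congr (_ * _); rewrite mxE.
Qed.

Lemma test_mxE M N a b c d i :
  (test_mx M N a b c *m d^T) i 0 = bform (test_vectors M N a b c)`_i d.
Proof. by rewrite mxE bform_sum; apply: eq_bigr => j _; rewrite !mxE. Qed.

Lemma test_inj M N a b c d : test_det M N a b c != 0 ->
  (forall i, (i < 8)%N -> bform (test_vectors M N a b c)`_i d = 0) -> d = 0.
Proof.
move=> G0 h; have u : test_mx M N a b c \in unitmx by rewrite unitmxE unitfE.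
have h0 : test_mx M N a b c *m d^T = 0.
  by apply/colP => i; rewrite test_mxE h ?mxE //; case: i.
by apply: trmx_inj; rewrite -(mulKmx u d^T) h0 mulmx0 trmx0.
Qed.

Lemma fourth_dirE M N a b c i : (i < 8)%N ->
  bform (test_vectors M N a b c)`_i (fourth_dir M N a b c) =
  if i == 7 then test_det M N a b c else 0.
Proof.
move=> hi; rewrite -[i in LHS]/(nat_of_ord (Ordinal hi)) -test_mxE.
have -> : (fourth_dir M N a b c)^T = col ord_max (\adj (test_mx M N a b c)).
  by apply/colP => j; rewrite !mxE.
rewrite colE mulmxA mul_mx_adj -colE !mxE -val_eqE /=.
by case: eqP.
Qed.

Lemma bformC a b : bform a b = bform b a.
Proof. by rewrite !bformE (_ : qdot a b = qdot b a) // /qdot; ring. Qed.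
Lemma bformDl a b c : bform (a + b) c = bform a c + bform b c.
Proof.
rewrite !bformE -dnumD2 (_ : qdot _ c = qdot a c + qdot b c) //.
by rewrite /qdot !qE; ring.
Qed.
Lemma bformZl k a b : bform (k *: a) b = k * bform a b.
Proof.
by rewrite !bformE qdotZl dnumM2 /= mul0r addr0.
Qed.
Lemma bformDr a b c : bform a (b + c) = bform a b + bform a c.
Proof. by rewrite bformC bformDl !(bformC a). Qed.
Lemma bformZr k a b : bform a (k *: b) = k * bform a b.
Proof. by rewrite bformC bformZl (bformC a). Qed.

Lemma linked_row M N a b c d : linked M N b d -> linked M N c d ->
  forall i, (i < 6)%N -> bform (test_vectors M N a b c)`_i d = 0.
Proof.
move=> [h0 h1 h2] [h3 h4 h5]; case=> [_|]; first exact: h0.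
case=> [_|]; first exact: h1. case=> [_|]; first exact: h2.
case=> [_|]; first exact: h3. case=> [_|]; first exact: h4.
by case=> [_|//]; exact: h5.
Qed.

Section FourthVertex.
Variables (M N : line R) (a b c : dquat R).
Hypothesis G0 : test_det M N a b c != 0.
Hypothesis a_null : bform a a = 0.
Let s := fourth_dir M N a b c.
Let G := test_det M N a b c.
Hypotheses (ba : linked M N b a) (ca : linked M N c a).

Lemma linked_fourth_dir : linked M N b s /\ linked M N c s.
Proof.
by do 2!split; [ exact: (@fourth_dirE M N a b c 0) | exact: (@fourth_dirE M N a b c 1)
 | exact: (@fourth_dirE M N a b c 2) | exact: (@fourth_dirE M N a b c 3)
 | exact: (@fourth_dirE M N a b c 4) | exact: (@fourth_dirE M N a b c 5)].
Qed.

Lemma bform_fourth_dir : bform a s = G.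
Proof. exact: (@fourth_dirE M N a b c 7). Qed.

Lemma linkedD p q z : linked M N p q -> linked M N p z -> linked M N p (q + z).
Proof.
case=> h1 h2 h3 [k1 k2 k3]; split;
[by rewrite bformDr h1 k1 addr0 | by rewrite bformDr h2 k2 addr0 | by rewrite bformDr h3 k3 addr0].
Qed.
Lemma linkedZ k p q : linked M N p q -> linked M N p (k *: q).
Proof.
case=> h1 h2 h3; split;
[by rewrite bformZr h1 mulr0 | by rewrite bformZr h2 mulr0 | by rewrite bformZr h3 mulr0].
Qed.

Lemma linked_fourth : linked M N b (fourth M N a b c) /\ linked M N c (fourth M N a b c).
Proof.
have [h1 h2] := linked_fourth_dir.
by split; apply: linkedD; apply: linkedZ.
Qed.

Lemma bform_fourth : bform a (fourth M N a b c) = 2 * G ^+ 2.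
Proof. by rewrite /fourth bformDr !bformZr a_null -/s bform_fourth_dir -/G; ring. Qed.

Lemma fourth_null : bform (fourth M N a b c) (fourth M N a b c) = 0.
Proof.
rewrite {1}/fourth bformDl !bformZl bform_fourth -/s -/G.
by rewrite /fourth bformDr !bformZr (bformC s a) -/s bform_fourth_dir -/G; ring.
Qed.

(** The test vectors show that z lies in the plane of a and s. On this plane the form is y times a
    linear form, because a is null, so there are just two null directions. *)
Lemma fourth_unique z : primal a != 0 -> bform z z = 0 -> linked M N b z ->
  linked M N c z -> exists k, z = k *: a \/ z = k *: fourth M N a b c.
Proof.
move=> pa zz bz cz.
(* This pairing is the squared norm of the primal part; it lets the seventh test read off the
   component along a, which the null vector a itself cannot see. *)
have N0 : bform (eps_mul a) a != 0.
  rewrite /bform /eps_mul primal_mk dual_mk {1}/dot big1 ?add0r; last first.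
    by move=> i _; rewrite mxE mul0r.
  exact: lt0r_neq0 (dot_gt0 pa).
pose y := bform a z / G; pose x := bform (eps_mul a) z / bform (eps_mul a) a.
have [hb hc] := linked_fourth_dir.
have e : z = x *: a + y *: s.
  have e6 : bform (eps_mul a) s = 0 by exact: (@fourth_dirE M N a b c 6).
  have exp d : bform d (z - (x *: a + y *: s)) =
      bform d z - (x * bform d a + y * bform d s).
    by rewrite -scaleN1r bformDr bformZr bformDr !bformZr mulN1r.
  have g6 : bform (eps_mul a) (z - (x *: a + y *: s)) = 0.
    by rewrite exp e6 mulr0 addr0 /x divfK // subrr.
  have g7 : bform a (z - (x *: a + y *: s)) = 0.
    by rewrite exp a_null mulr0 add0r bform_fourth_dir /y divfK // subrr.
  apply: subr0_eq; apply: (test_inj G0) => i; case: (ltnP i 6) => h6 hi.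
    by rewrite exp !linked_row // !mulr0 addr0 subr0.
  case: i hi h6 => [|[|[|[|[|[|i]]]]]] // hi _.
  by case: i hi => [_|[_|//]]; [exact: g6 | exact: g7].
move: zz; rewrite e bformDl !bformDr !bformZl !bformZr a_null (bformC s a).
rewrite bform_fourth_dir -/G => h.
have [y0|y0] := eqVneq y 0; first by exists x; left; rewrite y0 scale0r addr0.
have hx : x = - (y / (2 * G)) * bform s s.
  have h2 : y * (2 * x * G + y * bform s s) = 0 by rewrite -h; ring.
  have h3 : 2 * x * G + y * bform s s = 0.
    by apply: (mulfI y0); rewrite h2 mulr0.
  have G2 : 2 * G != 0 by rewrite mulf_neq0 ?pnatr_eq0.
  apply: (mulfI G2); have -> : 2 * G * x = - (y * bform s s) by lra.
  by field.
exists (y / (2 * G)); right; rewrite /fourth -/s -/G scalerDr !scalerA hx.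
by congr (_ *: _ + _ *: _); field.
Qed.
End FourthVertex.

End Fourth.

(** * The ratio of norms as a polynomial in an edge *)

Section Tilt.
Variable R : realType.
Implicit Types (a b c d z : dquat R) (M N : line R).

Definition axis_dir a b : 'rV[R]_3 := qvec (primal (dmul (dconj a) b)).
Definition volume M N a b : R :=
  dot (axis_dir a b) (cross (direction M) (direction N)).
Definition sqprimal a : R := dot (primal a) (primal a).

(* For an edge a, b whose axis meets M and N, tilt / volume ^ 2 is, up to a
   constant, the product of the squared distances of the direction of the axis
   from those of M and N; tilt / (volume ^ 2 * sqprimal b) is preserved along
   opposite edges. *)
Definition tilt M N a b : R :=
  let g := axis_dir a b in
  let u := direction M in let v := direction N in
  (dot u u * volume M N a b ^+ 2 + (dot u u * dot g v - dot u v * dot g u) ^+ 2)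
  * (dot v v * volume M N a b ^+ 2 + (dot v v * dot g u - dot u v * dot g v) ^+ 2).

(** The difference, cleared of denominators, of the quantity preserved along opposite edges, taken
    on the edges ab and ac. Its being nonzero is what gives [distinct] for their Lax coordinates. *)
Definition tilt_gap M N a b c : R :=
  tilt M N a b * volume M N a c ^+ 2 * sqprimal c
  - tilt M N a c * volume M N a b ^+ 2 * sqprimal b.

Definition unique4 M N a b c d := forall z, bform z z = 0 ->
  linked M N b z -> linked M N c z -> exists k, z = k *: a \/ z = k *: d.

(** The reciprocal product of Pluecker coordinates, which vanishes for coplanar lines. *)
Definition reciprocal M N : R :=
  dot (direction M) (moment N) + dot (moment M) (direction N).

Lemma qdotDl a b c : qdot (a + b) c = qdot a c + qdot b c.
Proof. by rewrite /qdot !qE; ring. Qed.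
Lemma qdotC a b : qdot a b = qdot b a.
Proof. by rewrite /qdot; ring. Qed.
Lemma qdotDr a b c : qdot c (a + b) = qdot c a + qdot c b.
Proof. by rewrite qdotC qdotDl !(qdotC c). Qed.
Lemma qdotZr k a b : qdot a (k *: b) = real_dnum k * qdot a b.
Proof. by rewrite qdotC qdotZl (qdotC a). Qed.

Lemma dotC m (x y : 'rV[R]_m) : dot x y = dot y x.
Proof. by apply: eq_bigr => i _; rewrite mulrC. Qed.

Lemma line_dq0 M : q0 (line_dq M) = 0.
Proof. by rewrite /q0 primal_mk dual_mk !mkquat0. Qed.
Lemma line_dqv M j : qv j (line_dq M) = (direction M 0 j, - moment M 0 j).
Proof. by rewrite /qv primal_mk dual_mk !mkquatv; congr pair; rewrite [LHS]mxE. Qed.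

Lemma line_qdot M N : qdot (line_dq M) (line_dq N) =
  (dot (direction M) (direction N), - reciprocal M N).
Proof.
rewrite /qdot line_dq0 /q1 /q2 /q3 !line_dqv /reciprocal !dotE3.
by apply: dnum_eq; rewrite !dnE /=; ring.
Qed.

Lemma qdot_line M r : (qdot r (line_dq M)).1 =
  dot (qvec (primal r)) (direction M).
Proof.
by rewrite /qdot line_dq0 /q1 /q2 /q3 !line_dqv !dnE dotE3 !qvecE /=; ring.
Qed.

Lemma sqprimalE a : sqprimal a = sqn a.
Proof. by rewrite /sqprimal /sqn /qdot dotE4 !dnE. Qed.

Lemma sqprimal_gt0 a : primal a != 0 -> 0 < sqprimal a.
Proof. exact: dot_gt0. Qed.
End Tilt.

Lemma lincomb1 (R : comNzRingType) (k l : R) (x y : dnum R) :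
  (real_dnum k * x + real_dnum l * y).1 = k * x.1 + l * y.1.
Proof. by []. Qed.
Lemma lincomb2 (R : comNzRingType) (k l : R) (x y : dnum R) :
  (real_dnum k * x + real_dnum l * y).2 = k * x.2 + l * y.2.
Proof. by rewrite /= !mul0r !addr0. Qed.

(** Writing (a A, a E) and (b B, b C) as vectors of the same length r with angles alpha and beta,
    both sides become 4 r^4 (cos alpha + cos beta)^2, by cos alpha + cos beta = 2 cos((alpha + beta)
    / 2) cos((alpha - beta) / 2). *)
Lemma tilt_identity (R : realFieldType) (a b A B C E S : R) : S = a * A + b * B ->
  b ^+ 2 * (B ^+ 2 + C ^+ 2) = a ^+ 2 * (A ^+ 2 + E ^+ 2) ->
  4 * S ^+ 2 * (a ^+ 2 * (A ^+ 2 + E ^+ 2)) =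
  (S ^+ 2 + (b * C + a * E) ^+ 2) * (S ^+ 2 + (b * C - a * E) ^+ 2).
Proof.
move=> -> h; have hC : (b * C) ^+ 2 = a ^+ 2 * (A ^+ 2 + E ^+ 2) - (b * B) ^+ 2.
  by rewrite -h; ring.
rewrite [RHS](_ : _ = ((a * A + b * B) ^+ 2) ^+ 2
  + 2 * (a * A + b * B) ^+ 2 * ((b * C) ^+ 2 + (a * E) ^+ 2)
  + ((b * C) ^+ 2 - (a * E) ^+ 2) ^+ 2); last by ring.
by rewrite hC; ring.
Qed.

(** [tilt_identity] in the original data: p and q are the lengths of the directions of M and N, c
    the cosine of their angle, x and y the products of the axis direction with them, and t the
    volume. *)
Lemma tilt_real (R : realFieldType) (p q c x y t A B a b : R)
    (C := (p^-1 * x + q^-1 * y) / 2) (E := - (p^-1 * x + - q^-1 * y) / 2) :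
  p != 0 -> q != 0 -> a = 2 + 2 * c -> b = 2 - 2 * c -> b != 0 ->
  a * A + b * B = 2 * t / (p * q) ->
  - (B ^+ 2 + C ^+ 2) = (a / b) ^+ 2 * - (A ^+ 2 + E ^+ 2) ->
  (p ^+ 2 * t ^+ 2 + (p ^+ 2 * y - p * q * c * x) ^+ 2)
  * (q ^+ 2 * t ^+ 2 + (q ^+ 2 * x - p * q * c * y) ^+ 2) =
  - (p ^+ 2 * q ^+ 2 * a) ^+ 2 * - (A ^+ 2 + E ^+ 2) * t ^+ 2.
Proof.
move=> p0 q0 ha hb b0 hS h.
have h1 : b ^+ 2 * (B ^+ 2 + C ^+ 2) = a ^+ 2 * (A ^+ 2 + E ^+ 2).
  by rewrite -[B ^+ 2 + _]opprK h; field.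
have := tilt_identity (erefl (a * A + b * B)) h1; rewrite hS => hid.
have e1 : p ^+ 2 * t ^+ 2 + (p ^+ 2 * y - p * q * c * x) ^+ 2 =
    p ^+ 4 * q ^+ 2 / 4 * ((2 * t / (p * q)) ^+ 2 + (b * C + a * E) ^+ 2).
  by rewrite ha hb /C /E; field; rewrite p0 q0.
have e2 : q ^+ 2 * t ^+ 2 + (q ^+ 2 * x - p * q * c * y) ^+ 2 =
    p ^+ 2 * q ^+ 4 / 4 * ((2 * t / (p * q)) ^+ 2 + (b * C - a * E) ^+ 2).
  by rewrite ha hb /C /E; field; rewrite p0 q0.
rewrite e1 e2 mulrACA -hid; field; by rewrite p0 q0.
Qed.

Lemma triple1 (R : realType) (V W r : dquat R) : (triple V W r).1 =
  (q1 r).1 * ((q2 W).1 * (q3 V).1 - (q3 W).1 * (q2 V).1)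
  + (q2 r).1 * ((q3 W).1 * (q1 V).1 - (q1 W).1 * (q3 V).1)
  + (q3 r).1 * ((q1 W).1 * (q2 V).1 - (q2 W).1 * (q1 V).1).
Proof. by []. Qed.

Lemma linked3 (R : realFieldType) (p q x y t : R) : p != 0 -> q != 0 ->
  [/\ x = 0, y = 0 & t = 0] <->
  [/\ x = 0, p^-1 * y + q^-1 * t = 0 & p^-1 * y + - q^-1 * t = 0].
Proof.
move=> p0 q0; split=> [[-> -> ->]|[-> h1 h2]].
  by rewrite !mulr0 addr0.
have hy : p^-1 * y = 0 by lra.
have ht : q^-1 * t = 0 by lra.
move: hy ht => /eqP; rewrite mulf_eq0 invr_eq0 (negbTE p0) => /eqP ->.
by move=> /eqP; rewrite mulf_eq0 invr_eq0 (negbTE q0) => /eqP ->.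
Qed.

Lemma gap_eq0 (R : realFieldType) (sa x y s t k l m w : R) : sa != 0 ->
  y * (sa * k + 2 * w * x) = x * (sa * l + 2 * w * y) ->
  - m * x * s ^+ 2 * t ^+ 2 * l - - m * y * t ^+ 2 * s ^+ 2 * k = 0.
Proof.
move=> sa0 h; have e : x * l = y * k by apply: (mulfI sa0); lra.
rewrite [LHS](_ : _ = - m * s ^+ 2 * t ^+ 2 * (x * l - y * k)); last by ring.
by rewrite e subrr mulr0.
Qed.

(** * From linked displacements to Lax matrices *)

Section Bridge.
Variables (R : realType) (M N : line R).
Implicit Types (a b c d z : dquat R).
Hypotheses (lM : is_line M) (lN : is_line N).
Hypotheses (hcross : cross (direction M) (direction N) != 0)
  (hrec : reciprocal M N != 0).
Local Notation D := (dnum R).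
Local Notation u := (direction M).
Local Notation v := (direction N).

Let p : R := Num.sqrt (dot u u).
Let q : R := Num.sqrt (dot v v).
Let p0 : 0 < p. Proof. by rewrite sqrtr_gt0 dot_gt0 //; case: lM. Qed.
Let q0' : 0 < q. Proof. by rewrite sqrtr_gt0 dot_gt0 //; case: lN. Qed.
Let p2 : p ^+ 2 = dot u u. Proof. by rewrite sqr_sqrtr // ltW // dot_gt0 //; case: lM. Qed.
Let q2' : q ^+ 2 = dot v v. Proof. by rewrite sqr_sqrtr // ltW // dot_gt0 //; case: lN. Qed.

Let V1 := p^-1 *: line_dq M + q^-1 *: line_dq N.
Let V2 := p^-1 *: line_dq M + (- q^-1) *: line_dq N.
Let c := dot u v / (p * q).

Let V10 : q0 V1 = 0. Proof. by rewrite /V1 q0D !q0Z !line_dq0 !mulr0 addr0. Qed.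
Let V20 : q0 V2 = 0. Proof. by rewrite /V2 q0D !q0Z !line_dq0 !mulr0 addr0. Qed.

(** Taking k and l among [q^-1] and [- q^-1] covers both norms and the orthogonality at once. *)
Let VV k l : qdot (p^-1 *: line_dq M + k *: line_dq N) (p^-1 *: line_dq M + l *: line_dq N)
  = (1 + (k + l) * (dot u v / p) + k * l * q ^+ 2, - (k + l) * (reciprocal M N / p)).
Proof.
have rMM : reciprocal M M = 0.
  by case: lM => _ h; rewrite /reciprocal (dotC (moment M)) h addr0.
have rNN : reciprocal N N = 0.
  by case: lN => _ h; rewrite /reciprocal (dotC (moment N)) h addr0.
rewrite !qdotDl !qdotDr !qdotZl !qdotZr (qdotC (line_dq N) (line_dq M)) !line_qdot.
rewrite rMM rNN -p2 -q2'; apply: dnum_eq; rewrite !dnE /=; field; by rewrite gt_eqF.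
Qed.

Let orth : qdot V1 V2 = 0.
Proof.
rewrite VV subrr mul0r addr0 oppr0 mul0r.
by congr pair; field; rewrite gt_eqF.
Qed.
Let v1E : qdot V1 V1 = (2 + 2 * c, - 2 * reciprocal M N / (p * q)).
Proof. by rewrite VV /c; congr pair; field; rewrite !gt_eqF. Qed.
Let v2E : qdot V2 V2 = (2 - 2 * c, 2 * reciprocal M N / (p * q)).
Proof. by rewrite VV /c; congr pair; field; rewrite !gt_eqF. Qed.
Let v12 : qdot V1 V1 + qdot V2 V2 = 4.
Proof. by rewrite v1E v2E; apply: dnum_eq; rewrite !dnE /=; field; rewrite ?gt_eqF. Qed.
Let lagrange (w t : 'rV[R]_3) :
  dot w w * dot t t - dot w t ^+ 2 = dot (cross w t) (cross w t).
Proof. by rewrite !dotE3 !crossE; ring. Qed.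
(** The strict Cauchy-Schwarz inequality for non-parallel directions; it makes the real parts 2 + 2
    c and 2 - 2 c of the two norms positive. *)
Let c2 : c ^+ 2 < 1.
Proof.
have h : 0 < p ^+ 2 * q ^+ 2 - dot u v ^+ 2.
  by rewrite p2 q2' lagrange; apply: dot_gt0.
rewrite /c expr_div_n exprMn ltr_pdivrMr; last by rewrite mulr_gt0 // exprn_gt0.
by rewrite mul1r -subr_gt0.
Qed.
Let v1_gt0 : 0 < (qdot V1 V1).1. Proof. by rewrite v1E; move: c2; set k := c; rewrite /= => hk; nra. Qed.
Let v2_gt0 : 0 < (qdot V2 V2).1. Proof. by rewrite v2E; move: c2; set k := c; rewrite /= => hk; nra. Qed.
Let v1_neq0 : (qdot V1 V1).2 != 0.
Proof.
rewrite v1E; apply: mulf_neq0; last first.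
  by rewrite invr_eq0 mulf_neq0 // gt_eqF.
by rewrite mulf_neq0 // oppr_eq0 pnatr_eq0.
Qed.

Lemma linked_inW a b : linked M N a b <-> inW V1 V2 (dmul (dconj a) b).
Proof.
have e0 : (q0 (dmul (dconj a) b)).2 = bform a b.
  by rewrite bformE (_ : q0 _ = qdot a b) // /qdot !qE; ring.
have eL L : (qdot (dmul (dconj a) b) (line_dq L)).2 = bform (dmul a (line_dq L)) b.
  by rewrite qdotC -bformE -bform_adj.
have pp := lt0r_neq0 p0; have qq := lt0r_neq0 q0'.
rewrite /inW e0 /V1 /V2 !qdotDr !qdotZr !lincomb2 !eL.
exact: (linked3 _ _ _ pp qq).
Qed.

Let w : R := (qdot V1 V1).1 / (qdot V2 V2).1.

Let edge_lift a b := lax_lift V1 V2 (dmul (dconj a) b).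

Lemma edge_liftK a b : linked M N a b ->
  lax_ev V1 V2 (edge_lift a b) = dmul (dconj a) b.
Proof. by move=> /linked_inW; apply: lax_evK. Qed.

Lemma edge_norm4 a b : linked M N a b -> nullq a -> nullq b ->
  [/\ norm0 (edge_lift a b) = w ^+ 2 * norm4 (edge_lift a b),
      norm2 (edge_lift a b) =
        sqprimal a * sqprimal b + 2 * w * norm4 (edge_lift a b) &
      tilt M N a b = - (p ^+ 2 * q ^+ 2 * (qdot V1 V1).1) ^+ 2
         * norm4 (edge_lift a b) * volume M N a b ^+ 2].
Proof.
move=> lab na nb.
have nab : nullq (dmul (dconj a) b).
  apply: nullqM => //; move: na; rewrite /nullq (_ : qdot (dconj a) _ = qdot a a) //.
  by rewrite /qdot !qE; ring.
have eK := edge_liftK lab.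
have := nab; rewrite /nullq -{1 2}eK => he.
have [h0 h1] := ev_null V10 V20 orth v12 v1_gt0 v2_gt0 v1_neq0 he.
split; first exact: h0.
  rewrite !sqprimalE -(_ : sqn (dmul (dconj a) b) = sqn a * sqn b).
    by rewrite /sqn -{1 2}eK h1 -/w; ring.
  rewrite sqnM; congr (_ * _); rewrite /sqn (_ : qdot (dconj a) _ = qdot a a) //.
  by rewrite /qdot !qE; ring.
set e := edge_lift a b in eK h0 *.
have [p_n q_n] : p != 0 /\ q != 0 by rewrite !gt_eqF.
have comp k j : (qv j (p^-1 *: line_dq M + k *: line_dq N)).1 = p^-1 * u 0 j + k * v 0 j.
  by rewrite qvD !qvZ lincomb1 !line_dqv.
have hcE : lc e = (p^-1 * dot (axis_dir a b) u + q^-1 * dot (axis_dir a b) v) / 2.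
  transitivity ((qdot (dmul (dconj a) b) V1).1 / 2); first by [].
  by rewrite /V1 qdotDr !qdotZr lincomb1 !qdot_line.
have hdE : ld e = - (p^-1 * dot (axis_dir a b) u + - q^-1 * dot (axis_dir a b) v) / 2.
  transitivity (- (qdot (dmul (dconj a) b) V2).1 / 2); first by [].
  by rewrite /V2 qdotDr !qdotZr lincomb1 !qdot_line.
(* The triple product is evaluated in two ways: through the basis [v1], [v2], and as a determinant,
   where V2 x V1 has real part 2 / (p q) times the cross product of the directions of M and N. *)
have hS : (qdot V1 V1).1 * la e + (qdot V2 V2).1 * lb e = 2 * volume M N a b / (p * q).
  transitivity (triple V1 V2 (dmul (dconj a) b)).1.
    have h4 : (qdot V1 V1).1 + (qdot V2 V2).1 = 4 by rewrite v1E v2E /=; ring.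
    pose x := triple V1 V2 (dmul (dconj a) b).
    have -> : la e = (x.1 + (qdot V2 V2).1 * x.2 / (qdot V1 V1).2) / 4 by [].
    have -> : lb e = (x.1 - (qdot V1 V1).1 * x.2 / (qdot V1 V1).2) / 4 by [].
    move: h4 v1_neq0; rewrite -/x.
    move: x.1 x.2 (qdot V1 V1).1 (qdot V2 V2).1 (qdot V1 V1).2.
    move=> y z k l m hkl m0; have -> : l = 4 - k by lra.
    by field.
  rewrite triple1 /q1 /q2 /q3 !comp /volume dotE3 !crossE /axis_dir !qvecE /=.
  by field; rewrite p_n q_n.
rewrite /tilt -/u -/v -p2 -q2' /norm4.
have hk : dot u v = p * q * c by rewrite /c; field; rewrite p_n q_n.
rewrite hk hdE; rewrite /norm0 /norm4 hcE hdE /w in h0.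
apply: tilt_real hS h0 => //.
- by rewrite v1E.
- by rewrite v2E.
- by rewrite gt_eqF.
Qed.

(** A nonzero volume makes both factors of [tilt] positive, which forces [norm4] to be nonzero; the
    real norm is the product of the two squared primal norms. *)
Lemma edge_balanced a b : linked M N a b -> nullq a -> nullq b ->
  primal a != 0 -> primal b != 0 -> volume M N a b != 0 ->
  balanced w (edge_lift a b).
Proof.
move=> lab na nb pa pb dab; have [h0 h2 ht] := edge_norm4 lab na nb; split=> //.
  apply: contraTneq (isT : true) => h4; move: ht; rewrite h4 mulr0 mul0r => ht.
  have : 0 < tilt M N a b; last by rewrite ht ltxx.
  have uu : 0 < dot u u by apply: dot_gt0; case: lM.
  have vv : 0 < dot v v by apply: dot_gt0; case: lN.
  by apply: mulr_gt0; apply: ltr_wpDr; rewrite ?sqr_ge0 // mulr_gt0 // exprn_even_gt0.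
rewrite h2 -subr_eq0 addrK mulf_neq0 // gt_eqF // sqprimal_gt0 //.
Qed.

Lemma edge_distinct a b d : linked M N a b -> linked M N a d -> nullq a ->
  nullq b -> nullq d -> primal a != 0 -> tilt_gap M N a b d != 0 ->
  distinct (edge_lift a b) (edge_lift a d).
Proof.
move=> lab lad na nb nd pa; apply: contra_neq => hd.
have [_ hb2 hb] := edge_norm4 lab na nb; have [_ hd2 hd'] := edge_norm4 lad na nd.
rewrite /tilt_gap hb hd'; rewrite hb2 hd2 in hd.
have sa : sqprimal a != 0 by rewrite gt_eqF // sqprimal_gt0.
exact: gap_eq0 sa hd.
Qed.

Theorem cube_consistency a b1 b2 b3 d12 d13 d23 z z' :
  bform a a = 0 -> primal a != 0 ->
  (forall b, b \in [:: b1; b2; b3] ->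
     [/\ bform b b = 0, primal b != 0, linked M N a b & volume M N a b != 0]) ->
  tilt_gap M N a b1 b2 != 0 -> tilt_gap M N a b1 b3 != 0 ->
  tilt_gap M N a b2 b3 != 0 ->
  unique4 M N a b1 b2 d12 -> unique4 M N a b1 b3 d13 -> unique4 M N a b2 b3 d23 ->
  unique4 M N b1 d12 d13 z -> unique4 M N b2 d12 d23 z' ->
  exists2 k, k != 0 & z' = k *: z.
Proof.
move=> na pa hb g12 g13 g23 u12 u13 u23 uz uz'.
have nullE x : bform x x = 0 <-> nullq x by rewrite bformE.
have {}na : nullq a by apply/nullE.
have sa : sqn a != 0 by rewrite -sqprimalE gt_eqF // sqprimal_gt0.
have [n1 p1 l1 w1] := hb b1 (mem_head _ _).
have [n2 p2' l2 w2] : [/\ bform b2 b2 = 0, primal b2 != 0, linked M N a b2 & volume M N a b2 != 0].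
  by apply: hb; rewrite !inE eqxx orbT.
have [n3 p3 l3 w3] : [/\ bform b3 b3 = 0, primal b3 != 0, linked M N a b3 & volume M N a b3 != 0].
  by apply: hb; rewrite !inE eqxx !orbT.
have {}n1 : nullq b1 by apply/nullE. have {}n2 : nullq b2 by apply/nullE.
have {}n3 : nullq b3 by apply/nullE.
(* [cube_closes] speaks of the products of a with edge elements; these are the given neighbours up
   to the factor [sqn a]. *)
have BE b : linked M N a b -> dmul a (lax_ev V1 V2 (edge_lift a b)) = sqn a *: b.
  by move=> l; rewrite edge_liftK // dmulA null_conj_mul // dmulZl dmul1l.
have uE x y t d : unique4 M N x y t d -> unique_fourth V1 V2 x y t d.
  move=> h s /nullE hs /linked_inW hy /linked_inW ht; exact: h.
have uB x y d : linked M N a x -> linked M N a y -> unique4 M N a x y d ->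
    unique_fourth V1 V2 a (dmul a (lax_ev V1 V2 (edge_lift a x)))
      (dmul a (lax_ev V1 V2 (edge_lift a y))) d.
  move=> lx ly /uE h.
  exact: (eq_ind_r (fun s => unique_fourth V1 V2 a s _ d)
    (eq_ind_r (fun s => unique_fourth V1 V2 a _ s d) (unique_fourthZ sa sa h)
      (BE _ ly)) (BE _ lx)).
have uA x y t d : linked M N a x -> unique4 M N x y t d ->
    unique_fourth V1 V2 (dmul a (lax_ev V1 V2 (edge_lift a x))) y t d.
  move=> lx h s /nullE hs /linked_inW hy /linked_inW ht; rewrite (BE _ lx).
  have [k [->|->]] := h s hs hy ht; last by exists k; right.
  by exists (k / sqn a); left; rewrite scalerA divfK.
have bal b : linked M N a b -> nullq b -> primal b != 0 -> volume M N a b != 0 ->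
    balanced w (edge_lift a b).
  by move=> *; apply: edge_balanced.
apply: (cube_closes V10 V20 orth v12 v1_gt0 v2_gt0 v1_neq0 na sa
  (bal _ l1 n1 p1 w1) (bal _ l2 n2 p2' w2) (bal _ l3 n3 p3 w3)
  (edge_distinct l1 l2 na n1 n2 pa g12) (edge_distinct l1 l3 na n1 n3 pa g13)
  (edge_distinct l2 l3 na n2 n3 pa g23)
  (uB _ _ _ l1 l2 u12) (uB _ _ _ l1 l3 u13) (uB _ _ _ l2 l3 u23)
  (uA _ _ _ _ l1 uz) (uA _ _ _ _ l2 uz')).
Qed.

End Bridge.

(** * Displacements and revolute axes *)

Section Vec3.
Variable R : realType.
Implicit Types (g h u v w x y m n : 'rV[R]_3).

Lemma vec3P u v : u 0 o0 = v 0 o0 -> u 0 o1 = v 0 o1 -> u 0 o2 = v 0 o2 -> u = v.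
Proof. by move=> *; apply/rowP; apply: ord3. Qed.

Lemma addv_o u v i : (u + v) 0 i = u 0 i + v 0 i. Proof. by rewrite mxE. Qed.
Lemma oppv_o u i : (- u) 0 i = - u 0 i. Proof. by rewrite mxE. Qed.
Lemma scalev_o (k : R) u i : (k *: u) 0 i = k * u 0 i. Proof. by rewrite mxE. Qed.

Lemma crossC g u : cross g u = - cross u g.
Proof. by apply: vec3P; rewrite oppv_o !crossE; ring. Qed.

Lemma cross_perp g u k : dot k g = 0 -> dot k u = 0 ->
  dot (cross g u) (cross g u) *: k = dot k (cross g u) *: cross g u.
Proof.
move=> hg hu.
have e : dot (cross g u) (cross g u) *: k = dot k (cross g u) *: cross g u
  + (dot u u * dot k g - dot g u * dot k u) *: g
  + (dot g g * dot k u - dot g u * dot k g) *: u.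
  by apply: vec3P; rewrite !(addv_o, scalev_o, crossE, dotE3); ring.
by rewrite e hg hu !mulr0 subrr !scale0r !addr0.
Qed.

Lemma cross_parallel g w n : cross g w = 0 -> dot g n *: w = dot w n *: g.
Proof.
move=> h; have e : dot g n *: w = dot w n *: g - cross n (cross g w).
  by apply: vec3P; rewrite !(addv_o, oppv_o, scalev_o, crossE, dotE3); ring.
have z : cross n 0 = 0 by apply: vec3P; rewrite crossE !mxE; ring.
by rewrite e h z subr0.
Qed.

Lemma coplanar_meet g h u m : cross g u != 0 -> u != 0 -> dot g h = 0 ->
  dot u m = 0 -> dot u h = dot g m -> exists y, cross g y = h /\ cross y u = m.
Proof.
move=> gu u0 gh um uh; set n := cross g u in gu.
have uu := lt0r_neq0 (dot_gt0 u0); have nn := lt0r_neq0 (dot_gt0 gu).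
(* The foot of the perpendicular from the origin to the line (u, m). The error of the first equation
   at [y0] is orthogonal to g and u, hence parallel to their cross product, and moving along u
   removes it. *)
pose y0 := (dot u u)^-1 *: cross u m.
have y0u : cross y0 u = m.
  have e : dot u u *: m = cross (cross u m) u + dot u m *: u.
    by apply: vec3P; rewrite !(addv_o, scalev_o, crossE, dotE3); ring.
  apply: (scalerI uu); rewrite e um scale0r addr0 /y0.
  by apply: vec3P; rewrite !(scalev_o, crossE); field.
pose k := h - cross g y0.
have kg : dot k g = 0.
  have e : dot k g = dot g h by rewrite /k !dotE3 !(addv_o, oppv_o, crossE); ring.
  by rewrite e gh.
have ku : dot k u = 0.
  have e : dot k u = dot u h - dot g (cross y0 u) by rewrite /k !dotE3 !(addv_o, oppv_o, crossE); ring.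
  by rewrite e uh y0u subrr.
have := cross_perp kg ku; rewrite -/n => hk.
exists (y0 + (dot k n / dot n n) *: u); split.
  have -> : cross g (y0 + (dot k n / dot n n) *: u) = cross g y0 + (dot k n / dot n n) *: n.
    by apply: vec3P; rewrite /n !(addv_o, scalev_o, crossE); ring.
  have -> : (dot k n / dot n n) *: n = k.
    by apply: (scalerI nn); rewrite hk scalerA mulrCA divff // mulr1.
  by rewrite /k addrC subrK.
rewrite -y0u; apply: vec3P; rewrite !(addv_o, scalev_o, crossE); ring.
Qed.

End Vec3.

Section Skew.
Variable R : realType.
Implicit Types M N : line R.

Lemma skew_cross M N : is_line M -> Defs.skew M N ->
  cross (direction M) (direction N) != 0.
Proof.
move=> [u0 _] [hp _]; apply/eqP => h; apply: hp.
have uu := lt0r_neq0 (dot_gt0 u0).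
exists (dot (direction M) (direction N) / dot (direction M) (direction M)).
apply: (scalerI uu); rewrite scalerA mulrCA divff // mulr1.
by rewrite (cross_parallel _ h) dotC.
Qed.

Lemma skew_reciprocal M N : is_line M -> is_line N -> Defs.skew M N -> reciprocal M N != 0.
Proof.
move=> lM lN sk; have hc := skew_cross lM sk; case: lM lN sk => u0 um [v0 vm] [_ hm].
apply/eqP => h; apply: hm.
have hc' : cross (direction N) (direction M) != 0.
  by apply: contra_neq hc => e; rewrite crossC e oppr0.
have dN (x y : 'rV[R]_3) : dot x (- y) = - dot x y.
  by rewrite !dotE3 !oppv_o; ring.
have [||y [h1 h2]] := coplanar_meet (h := - moment N) hc' u0 _ um.
- by rewrite dN vm oppr0.
- by rewrite dN; move: h; rewrite /reciprocal (dotC (moment M)) => h; lra.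
exists y; split; first exact: h2.
rewrite /on_line -[RHS]opprK -h1; apply: vec3P; rewrite oppv_o !crossE; ring.
Qed.

Lemma meet_reciprocal M N x y : on_line M x -> on_line N y ->
  reciprocal M N = dot (x - y) (cross (direction M) (direction N)).
Proof.
rewrite /on_line /reciprocal => <- <-; rewrite !dotE3 !(addv_o, oppv_o, crossE); ring.
Qed.

Lemma skewP M N : cross (direction M) (direction N) != 0 -> reciprocal M N != 0 ->
  Defs.skew M N.
Proof.
move=> hc hr; split.
  move=> [c h]; case/eqP: hc; rewrite h.
  by apply: vec3P; rewrite crossE !scalev_o [RHS]mxE; ring.
move=> [x [hM hN]]; case/eqP: hr; rewrite (meet_reciprocal hM hN) subrr.
by rewrite dotE3 !mxE; ring.
Qed.
End Skew.

Section Displace.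
Variable R : realType.
Implicit Types (a b c r : dquat R) (x y : 'rV[R]_3).

Definition affine_pt x : dquat R := mkdq (mkquat 1 0) (mkquat 0 x).

Lemma affine_pt0 x : q0 (affine_pt x) = 1.
Proof. by rewrite /q0 primal_mk dual_mk !mkquat0. Qed.
Lemma affine_ptv x j : qv j (affine_pt x) = (0, x 0 j).
Proof. by rewrite /qv primal_mk dual_mk !mkquatv; congr pair; rewrite [LHS]mxE. Qed.

Definition dbar (z : dnum R) : dnum R := (z.1, - z.2).
Lemma deps0 a : q0 (deps a) = dbar (q0 a).
Proof. by rewrite /q0 primal_mk dual_mk; congr pair; rewrite [LHS]mxE. Qed.
Lemma depsv j a : qv j (deps a) = dbar (qv j a).
Proof. by rewrite /qv primal_mk dual_mk; congr pair; rewrite [LHS]mxE. Qed.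
Lemma dbarM (x y : dnum R) : dbar (x * y) = dbar x * dbar y.
Proof. by apply: dnum_eq; rewrite /dbar /=; ring. Qed.
Lemma dbarD (x y : dnum R) : dbar (x + y) = dbar x + dbar y.
Proof. by apply: dnum_eq; rewrite /dbar /=; ring. Qed.
Lemma dbarN (x : dnum R) : dbar (- x) = - dbar x.
Proof. by apply: dnum_eq; rewrite /dbar /=; ring. Qed.
Lemma dbar_real k : dbar (real_dnum k) = real_dnum k.
Proof. by apply: dnum_eq; rewrite /dbar /= ?oppr0. Qed.

Definition epsE := (deps0, affine_pt0,
  (fun a => depsv o0 a : q1 (deps a) = dbar (q1 a)),
  (fun a => depsv o1 a : q2 (deps a) = dbar (q2 a)),
  (fun a => depsv o2 a : q3 (deps a) = dbar (q3 a)),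
  (fun x => affine_ptv x o0 : q1 (affine_pt x) = (0, x 0 o0)),
  (fun x => affine_ptv x o1 : q2 (affine_pt x) = (0, x 0 o1)),
  (fun x => affine_ptv x o2 : q3 (affine_pt x) = (0, x 0 o2))).

Lemma depsM a b : deps (dmul a b) = dmul (deps a) (deps b).
Proof.
by apply: dqP; rewrite !qE !epsE !qE !(dbarD, dbarN, dbarM).
Qed.

Lemma depsZ k a : deps (k *: a) = k *: deps a.
Proof. by apply: dqP; rewrite !qE !epsE !qE dbarM dbar_real. Qed.

Lemma nullE a : bform a a = 0 <-> nullq a.
Proof. by rewrite bformE. Qed.

Lemma primal_neq0 a : (primal a != 0) = (sqn a != 0).
Proof.
apply/idP/idP => [h|]; first by rewrite -sqprimalE gt_eqF // sqprimal_gt0.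
apply: contra_neq => h; rewrite -sqprimalE /sqprimal h /dot big1 // => i _.
by rewrite mxE mul0r.
Qed.

Lemma displacementE a : is_displacement a <-> nullq a /\ sqn a != 0.
Proof. by rewrite /is_displacement /on_study primal_neq0; split=> -[/nullE ? ?]. Qed.

Lemma sqnZ k a : sqn (k *: a) = k ^+ 2 * sqn a.
Proof. by rewrite /sqn /qdot !qE !dnE; ring. Qed.

Lemma displacementM a b : is_displacement a -> is_displacement b ->
  is_displacement (dmul a b).
Proof.
move=> /displacementE [na sa] /displacementE [nb sb]; apply/displacementE.
by split; [exact: nullqM | rewrite sqnM mulf_neq0].
Qed.

Lemma qdot_conj a b : qdot (dconj a) (dconj b) = qdot a b.
Proof. by rewrite /qdot !qE; ring. Qed.

Lemma displacement_conj a : is_displacement a -> is_displacement (dconj a).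
Proof. by move=> /displacementE [na sa]; apply/displacementE; rewrite /nullq /sqn qdot_conj. Qed.

Lemma nullqZ k a : nullq a -> nullq (k *: a).
Proof. by rewrite /nullq => h; rewrite -bformE bformZl bformZr bformE h !mulr0. Qed.

Lemma displacementZ k a : k != 0 -> is_displacement a -> is_displacement (k *: a).
Proof.
move=> k0 /displacementE [na sa]; apply/displacementE; split; first exact: nullqZ.
by rewrite sqnZ mulf_neq0 ?expf_neq0.
Qed.

Lemma rowZE m k (v : 'rV[R]_m) i : (k *: v) 0 i = k * v 0 i.
Proof. by rewrite mxE. Qed.
Lemma rowNE m (v : 'rV[R]_m) i : (- v) 0 i = - v 0 i.
Proof. by rewrite mxE. Qed.

Lemma quatP (p q : quat R) : p 0 0 = q 0 0 ->
  p 0 (rshift 1 o0) = q 0 (rshift 1 o0) -> p 0 (rshift 1 o1) = q 0 (rshift 1 o1) ->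
  p 0 (rshift 1 o2) = q 0 (rshift 1 o2) -> p = q.
Proof. by move=> *; apply/rowP; apply: ord4 => //; apply: ord3. Qed.

Definition qconj (p : quat R) : quat R := mkquat (qscal p) (- qvec p).
Lemma qconj0 p : qconj p 0 0 = p 0 0. Proof. by rewrite mkquat0. Qed.
Lemma qconjv p j : qconj p 0 (rshift 1 j) = - p 0 (rshift 1 j).
Proof. by rewrite mkquatv rowNE qvecE. Qed.
Definition qmE := (qmul0, qmul1, qmul2, qmul3, rowZE, rowNE, qconj0, qconjv).

Lemma qmulZl k (p q : quat R) : qmul (k *: p) q = k *: qmul p q.
Proof. by apply: quatP; rewrite !qmE; ring. Qed.
Lemma qmulZr k (p q : quat R) : qmul p (k *: q) = k *: qmul p q.
Proof. by apply: quatP; rewrite !qmE; ring. Qed.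

Lemma qconj_sandwich (p d : quat R) : dot p d = 0 ->
  qmul (qmul (qconj p) d) (qconj p) = - (dot p p *: qconj d).
Proof.
move=> h; have e : qmul (qmul (qconj p) d) (qconj p) =
  - (dot p p *: qconj d) + (2 * dot p d) *: qconj p.
  by apply: quatP; rewrite [RHS]mxE !qmE !dotE4; ring.
by rewrite e h mulr0 scale0r addr0.
Qed.

Lemma mkdqZ k (p d : quat R) : k *: mkdq p d = mkdq (k *: p) (k *: d).
Proof. exact: scale_row_mx. Qed.

Lemma dinvE a : is_displacement a -> dinv a = (sqn a)^-1 *: dconj a.
Proof.
move=> /displacementE [na sa].
have Np : dot (primal a) (primal a) = sqn a by rewrite -sqprimalE.
have pd : dot (primal a) (dual a) = 0.
  by move/nullE: na; rewrite /bform (dotC (dual a)) => h; lra.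
rewrite /dinv /qinv Np -/(qconj _) qmulZl qmulZl qmulZr qconj_sandwich // Np.
rewrite !scalerN opprK !scalerA -mulrA mulVf // mulr1 /dconj mkdqZ.
by [].
Qed.

Lemma affine_displace a y : is_displacement a ->
  dmul (dmul (deps a) (affine_pt y)) (dconj a) = sqn a *: affine_pt (displace a y).
Proof.
move=> da; have /displacementE [na sa] := da.
have e j : displace a y 0 j =
    (sqn a)^-1 * (qv j (dmul (dmul (deps a) (affine_pt y)) (dconj a))).2.
  rewrite /displace dinvE // dmulZr qvecE.
  by rewrite -[LHS]/((qv j _).2) qvZ dnumM2 /= mul0r addr0.
have {}e j : sqn a * displace a y 0 j =
    (qv j (dmul (dmul (deps a) (affine_pt y)) (dconj a))).2.
  by rewrite e mulrA divff // mul1r.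
have e2 j : (qv j (sqn a *: affine_pt (displace a y))).2 =
    (qv j (dmul (dmul (deps a) (affine_pt y)) (dconj a))).2.
  by rewrite qvZ affine_ptv dnumM2 real_dnum1 real_dnum2 mul0r addr0; exact: e.
have sE : sqn a = (q0 a).1 ^+ 2 + (q1 a).1 ^+ 2 + (q2 a).1 ^+ 2 + (q3 a).1 ^+ 2.
  by rewrite /sqn /qdot !dnE; ring.
have d1 z : (dbar z).1 = z.1 by [].
have d2 z : (dbar z).2 = - z.2 by [].
apply: dqP; apply: dnum_eq; rewrite -?e2 // !qE !epsE !dnE ?d1 ?d2 ?sE /=; ring.
Qed.

Lemma affine_pt_inj x y : affine_pt x = affine_pt y -> x = y.
Proof.
move=> h; apply/rowP => j; have := congr1 (fun z => (qv j z).2) h.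
by rewrite !affine_ptv.
Qed.

Lemma displace_eq a x y : is_displacement a ->
  dmul (dmul (deps a) (affine_pt y)) (dconj a) = sqn a *: affine_pt x ->
  displace a y = x.
Proof.
move=> da; have /displacementE [_ sa] := da.
by rewrite affine_displace // => /(scalerI sa) /affine_pt_inj.
Qed.

Lemma displaceM a b y : is_displacement a -> is_displacement b ->
  displace (dmul a b) y = displace a (displace b y).
Proof.
move=> da db; apply: displace_eq; first exact: displacementM.
rewrite depsM dconjM.
have assoc A B Y C D : dmul (dmul (dmul A B) Y) (dmul C D) =
    dmul (dmul A (dmul (dmul B Y) C)) D :> dquat R by rewrite !dmulA.
by rewrite assoc affine_displace // dmulZr dmulZl affine_displace // scalerA sqnM mulrC.
Qed.

Lemma displaceZ k a y : k != 0 -> is_displacement a ->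
  displace (k *: a) y = displace a y.
Proof.
move=> k0 da; apply: displace_eq; first exact: displacementZ.
by rewrite depsZ dconjZ !dmulZl dmulZr affine_displace // !scalerA sqnZ.
Qed.

Lemma dq1_displacement : is_displacement (dq1 R).
Proof.
apply/displacementE; rewrite /nullq /sqn /qdot !dq4E !dnE; split; first by ring.
by rewrite !(mul0r, addr0, mulr1) oner_eq0.
Qed.

Lemma displace1 y : displace (dq1 R) y = y.
Proof.
apply: displace_eq; first exact: dq1_displacement.
apply: dqP; apply: dnum_eq; rewrite !(qE, epsE, dq4E) /sqn /qdot /dbar !dq4E !dnE /=; ring.
Qed.

Lemma displaceK a y : is_displacement a -> displace (dconj a) (displace a y) = y.
Proof.
move=> da; have /displacementE [na sa] := da.
rewrite -displaceM //; last exact: displacement_conj.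
by rewrite null_mul_conj // displaceZ ?displace1 //; exact: dq1_displacement.
Qed.

Lemma displaceVK a y : is_displacement a -> displace a (displace (dconj a) y) = y.
Proof. by move=> da; have := displaceK y (displacement_conj da); rewrite dconjK. Qed.

(** Multiplying by r on the right turns the fixed point equation into [deps r] (1 + eps y) = (1 +
    eps y) r, which is linear in y. *)
Lemma fixed_pointP r y : is_displacement r -> displace r y = y <->
  (q0 r).2 = 0 /\ cross (qvec (primal r)) y = qvec (dual r).
Proof.
move=> dr; have /displacementE [nr sr] := dr.
have e : displace r y = y <->
    dmul (deps r) (affine_pt y) = dmul (affine_pt y) r.
  have hE : dmul (dmul (affine_pt y) r) (dconj r) = sqn r *: affine_pt y.
    by rewrite -dmulA null_conj_mul // dmulZr dmul1r.
  split=> h; last by apply: (displace_eq dr); rewrite h; exact: hE.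
  have red X : dmul (dmul X (dconj r)) r = sqn r *: X.
    by rewrite -dmulA (null_mul_conj nr) dmulZr dmul1r.
  by apply: (scalerI sr); rewrite -!red (affine_displace y dr) h hE.
rewrite e; split=> [h|[h1 h2]].
  have h0 := congr1 (fun z => (q0 z).2) h.
  have hh1 := congr1 (fun z => (q1 z).2) h.
  have hh2 := congr1 (fun z => (q2 z).2) h.
  have hh3 := congr1 (fun z => (q3 z).2) h.
  cbv beta in h0, hh1, hh2, hh3.
  move: h0 hh1 hh2 hh3; rewrite !qE !epsE !dnE /dbar /= => h0 hh1 hh2 hh3.
  split; first by rewrite /q0 /=; lra.
  by apply: vec3P; rewrite crossE !qvecE; lra.
have k1 := congr1 (fun z : 'rV_3 => z 0 o0) h2.
have k2 := congr1 (fun z : 'rV_3 => z 0 o1) h2.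
have k3 := congr1 (fun z : 'rV_3 => z 0 o2) h2.
move: h1 k1 k2 k3; rewrite !crossE !qvecE /q0 /= => h1 k1 k2 k3.
apply: dqP; apply: dnum_eq; rewrite !qE !epsE !dnE /dbar /=; lra.
Qed.

(** Carrying the axis of b a^-1 into the moving space conjugates the rotation by a, and a^-1 (b
    a^-1) a = a^-1 b. *)
Lemma relative_axisP a b y : is_displacement a -> is_displacement b ->
  relative_revolute_axis a b y <-> displace (dmul (dconj a) b) y = y.
Proof.
move=> da db; have /displacementE [_ sa] := da; have dca := displacement_conj da.
have dV x : displace (dinv a) x = displace (dconj a) x.
  by rewrite (dinvE da); apply: (displaceZ _ _ dca); rewrite invr_neq0.
have dia : is_displacement (dinv a).
  by rewrite (dinvE da); apply: (displacementZ _ dca); rewrite invr_neq0.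
have dF x : displace (relative_displacement a b) x = displace b (displace (dconj a) x).
  by rewrite /relative_displacement (displaceM _ db dia) dV.
rewrite (displaceM _ dca db); split=> [[x []]|h].
  by rewrite /fixed_axis dF dV => h ->; rewrite h.
exists (displace a y); rewrite /fixed_axis dF dV !(displaceK _ da); split; last by [].
by rewrite -{2}h (displaceVK _ da).
Qed.
End Displace.

Section Revolute.
Variable R : realType.
Implicit Types (a b c r : dquat R) (M N L : line R) (x y g h u w : 'rV[R]_3).

Lemma conj_mul_null a b : bform a b = (q0 (dmul (dconj a) b)).2.
Proof. by rewrite bformE (_ : qdot a b = q0 (dmul (dconj a) b)) // /qdot !qE; ring. Qed.

Lemma linkedP M N a b : let r := dmul (dconj a) b in
  let g := qvec (primal r) in let h := qvec (dual r) in
  linked M N a b <-> [/\ (q0 r).2 = 0, dot (direction M) h = dot g (moment M) &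
    dot (direction N) h = dot g (moment N)].
Proof.
move=> r g h; rewrite /linked conj_mul_null -/r.
have e L : bform (dmul a (line_dq L)) b = dot (direction L) h - dot g (moment L).
  rewrite bform_adj bformE -/r /qdot line_dq0 /q1 /q2 /q3 !line_dqv.
  by rewrite !dnE !dotE3 /g /h !qvecE /=; ring.
rewrite (e M) (e N); split=> -[h0 h1 h2]; split;
  [exact: h0 | exact: subr0_eq h1 | exact: subr0_eq h2
  | exact: h0 | by rewrite h1 subrr | by rewrite h2 subrr].
Qed.

Lemma cross_diff g y w : cross g y = cross g w -> cross g (y - w) = 0.
Proof.
move=> h; have -> : cross g (y - w) = cross g y - cross g w.
  by apply: vec3P; rewrite !(addv_o, oppv_o, crossE); ring.
by rewrite h subrr.
Qed.

Lemma cross0g y : cross 0 y = 0 :> 'rV[R]_3.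
Proof. by apply: vec3P; rewrite crossE !mxE; ring. Qed.

Lemma cross_row3 u : (forall x, cross x u = 0) -> u = 0.
Proof.
move=> h; have e1 := h (row3 1 0 0); have e2 := h (row3 0 1 0).
have k1 := congr1 (fun z : 'rV_3 => z 0 o1) e1.
have k2 := congr1 (fun z : 'rV_3 => z 0 o2) e1.
have k3 := congr1 (fun z : 'rV_3 => z 0 o2) e2.
cbv beta in k1, k2, k3; move: k1 k2 k3; rewrite !crossE !row3_0 !row3_1 !row3_2 => k1 k2 k3.
have z i : (0 : 'rV[R]_3) 0 i = 0 by rewrite mxE.
by move: k1 k2 k3; rewrite !z => k1 k2 k3; apply: vec3P; rewrite z; lra.
Qed.

Lemma line_dir g h : direction (row_mx g h : line R) = g.
Proof. exact: row_mxKl. Qed.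
Lemma line_mom g h : moment (row_mx g h : line R) = h.
Proof. exact: row_mxKr. Qed.

(** The fixed points of b conj(a) form a line once its vector part g is nonzero. As b conj(a) and
    conj(a) b have the same norm and scalar part, g is as long as [axis_dir a b]. *)
Lemma rel_rotationP a b : is_displacement a -> is_displacement b -> bform a b = 0 ->
  axis_dir a b != 0 -> is_rotation (relative_displacement a b).
Proof.
move=> da db hab g0; have /displacementE [na sa] := da; have /displacementE [nb sb] := db.
have dca := displacement_conj da; have sa' : (sqn a)^-1 != 0 by rewrite invr_neq0.
have dp := displacementM db dca.
have dr : is_displacement (relative_displacement a b).
  by rewrite /relative_displacement (dinvE da) dmulZr; apply: displacementZ.
split; first exact: dr.
set p := dmul b (dconj a) in dp.
have fixE x : displace (relative_displacement a b) x = x <-> displace p x = x.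
  by rewrite /relative_displacement (dinvE da) dmulZr (displaceZ _ sa' dp).
have p00 : (q0 p).2 = 0.
  by rewrite -hab bformE (_ : q0 p = qdot a b) // /p /qdot !qE; ring.
have /displacementE [np _] := dp.
set g := qvec (primal p); set h := qvec (dual p).
have gg : dot g g = dot (axis_dir a b) (axis_dir a b).
  have e z : dot (qvec (primal z)) (qvec (primal z)) = sqn z - (q0 z).1 ^+ 2.
    by rewrite dotE3 !qvecE /sqn /qdot !dnE /q1 /q2 /q3 /=; ring.
  have p01 : q0 p = q0 (dmul (dconj a) b) by rewrite /p !qE; ring.
  by rewrite /axis_dir /g !e p01 /p !sqnM mulrC.
have g0' : g != 0.
  apply: contraTneq (dot_gt0 g0) => e; rewrite -gg e.
  by rewrite (_ : dot _ _ = 0) ?ltxx // dotE3 !mxE; ring.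
have gh : dot g h = 0.
  move: np; rewrite /nullq /qdot !dnE p00 dotE3 !qvecE /q1 /q2 /q3 /= => e; lra.
exists (row_mx g (- h)); split.
  rewrite /is_line line_dir line_mom; split; first exact: g0'.
  have e : dot g (- h) = - dot g h by rewrite !dotE3 !oppv_o; ring.
  by rewrite e gh oppr0.
move=> x; rewrite fixE (fixed_pointP x dp) -/g -/h /on_line line_dir line_mom crossC.
by split=> [[_ <-]|->]; rewrite opprK.
Qed.

(** Backwards, [coplanar_meet] supplies the common points. Forwards, let the axis meet M and N in y1
    and y2. If the volume vanished, [cross_parallel] applied to y1 - y2 and the nonzero reciprocal
    product would force the direction to be zero; then every point would be fixed, which no rotation
    allows. *)
Lemma revoluteP M N a b : is_line M -> is_line N -> Defs.skew M N ->
  is_displacement a -> is_displacement b ->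
  revolute_meeting M N a b <-> linked M N a b /\ volume M N a b != 0.
Proof.
move=> lM lN sk da db; have dca := displacement_conj da.
have dr := displacementM dca db; have dp := displacementM db dca.
have /displacementE [na sa] := da; have sa' : (sqn a)^-1 != 0 by rewrite invr_neq0.
set r := dmul (dconj a) b in dr; set g := qvec (primal r); set h := qvec (dual r).
have axisE y : relative_revolute_axis a b y <-> (q0 r).2 = 0 /\ cross g y = h.
  by rewrite (relative_axisP y da db); exact: fixed_pointP.
have hrec := skew_reciprocal lM lN sk; have hcr := skew_cross lM sk.
split=> [[hrot [y1 [/axisE [r0 hy1] on1]] [y2 [/axisE [_ hy2] on2]]]|[]].
  split.
    apply/linkedP; rewrite -/r -/g -/h; split; first exact: r0.
      by rewrite -hy1 -on1 !dotE3 !crossE; ring.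
    by rewrite -hy2 -on2 !dotE3 !crossE; ring.
  have hw : cross g (y1 - y2) = 0 by apply: cross_diff; rewrite hy1 hy2.
  apply/eqP => v0; rewrite /volume -/(axis_dir a b) in v0.
  have := cross_parallel (cross (direction M) (direction N)) hw.
  rewrite -[dot g _]/(volume M N a b) /volume v0 scale0r -meet_reciprocal // => e.
  have g0 : g = 0.
    by apply/eqP; move/eqP: e; rewrite eq_sym scaler_eq0 (negbTE hrec).
  have h0 : h = 0 by rewrite -hy1 g0 cross0g.
  case: hrot => _ [L [[dL _] hL]].
  have all x : on_line L x.
    apply/hL; have := (relative_axisP (displace (dconj a) x) da db).2.
    case.
      by apply/(fixed_pointP _ dr); rewrite -/g -/h g0 h0 cross0g.
    move=> z [hz hz']; suff -> : x = z by [].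
    rewrite -(displaceVK x da) hz' (dinvE da) (displaceZ _ sa' dca).
    exact: displaceVK.
  case/eqP: dL; apply: cross_row3 => x.
  have h1 := all x; have h2 := all 0; rewrite /on_line cross0g in h2.
  by rewrite h1 -h2.
move=> /linkedP; rewrite -/r -/g -/h => -[r0 hM hN] vol.
have gne : axis_dir a b != 0.
  apply: contra_neq vol; rewrite /volume => ->; rewrite dotE3 !mxE; ring.
have gh : dot g h = 0.
  have /displacementE [nr _] := dr.
  move: nr; rewrite /nullq /qdot !dnE r0 dotE3 !qvecE /q1 /q2 /q3 /= => e; lra.
have bab : bform a b = 0 by rewrite conj_mul_null.
split; first exact: rel_rotationP.
- have [|y [h1 h2]] := coplanar_meet (g := g) (h := h) _ (proj1 lM) gh (proj2 lM) hM.
    apply: contra_neq vol => e; rewrite /volume -/g.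
    rewrite (_ : dot _ _ = dot (cross g (direction M)) (direction N)); last first.
      by rewrite !dotE3 !crossE; ring.
    by rewrite e dotE3 !mxE; ring.
  by exists y; split; [apply/axisE|].
- have [|y [h1 h2]] := coplanar_meet (g := g) (h := h) _ (proj1 lN) gh (proj2 lN) hN.
    apply: contra_neq vol => e; rewrite /volume -/g.
    rewrite (_ : dot _ _ = - dot (cross g (direction N)) (direction M)); last first.
      by rewrite !dotE3 !crossE; ring.
    by rewrite e dotE3 !mxE; ring.
  by exists y; split; [apply/axisE|].
Qed.

Lemma joining_line_of_null a b : bform a a = 0 -> bform b b = 0 -> bform a b = 0 ->
  joining_line_on_study a b.
Proof.
move=> ha hb hab s t; rewrite /on_study bformDl !bformDr !bformZl !bformZr.
by rewrite ha hb (bformC b) hab !mulr0 !addr0.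
Qed.
Lemma linked_sym M N a b : linked M N a b -> linked M N b a.
Proof.
move=> [h0 h1 h2]; have e L : bform (dmul b (line_dq L)) a = - bform (dmul a (line_dq L)) b.
  have qN : qdot (line_dq L) (dmul (dconj b) a) = - qdot (line_dq L) (dmul (dconj a) b).
    by rewrite /qdot !qE line_dq0; ring.
  by rewrite !bform_adj !bformE qN.
by split; [rewrite bformC | rewrite e h1 oppr0 | rewrite e h2 oppr0].
Qed.

Lemma volume_sym M N a b : volume M N b a = - volume M N a b.
Proof.
have e j : axis_dir b a 0 j = - axis_dir a b 0 j.
  have := qvconj j (dmul (dconj a) b); rewrite dconjM dconjK => /(congr1 fst).
  by rewrite /axis_dir !qvecE.
by rewrite /volume !dotE3 (e o0) (e o1) (e o2); ring.
Qed.

End Revolute.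

(** * Stars of the vertices of the cube *)

Section Scale.
Variable R : realType.
Implicit Types (a b c : dquat R) (M N : line R).

Lemma directionZ k M : direction (k *: M) = k *: direction M.
Proof. by apply/rowP => i; rewrite !mxE. Qed.

Lemma line_dqZ k M : line_dq (k *: M) = k *: line_dq M.
Proof.
have e v : mkquat 0 (k *: v) = k *: mkquat 0 v :> quat R.
  by apply: quatP; rewrite rowZE ?mkquat0 ?mkquatv ?mulr0 // rowZE.
have m : moment (k *: M) = k *: moment M by apply/rowP => i; rewrite !mxE.
by rewrite /line_dq m directionZ -scalerN !e mkdqZ.
Qed.

Lemma axis_dirZ k l a b : axis_dir (k *: a) (l *: b) = (k * l) *: axis_dir a b.
Proof.
rewrite /axis_dir dconjZ dmulZl dmulZr scalerA; apply/rowP => i; rewrite rowZE !qvecE.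
by rewrite -[LHS]/((qv i _).1) qvZ dnumM1.
Qed.

Lemma dot_scale m k l (u v : 'rV[R]_m) : dot (k *: u) (l *: v) = k * l * dot u v.
Proof. by rewrite /dot big_distrr; apply: eq_bigr => i _; rewrite !mxE /=; ring. Qed.
Lemma cross_scale k l (u v : 'rV[R]_3) : cross (k *: u) (l *: v) = (k * l) *: cross u v.
Proof. by apply: vec3P; rewrite scalev_o !crossE !scalev_o; ring. Qed.

Lemma volumeZ m n k l M N a b :
  volume (m *: M) (n *: N) (k *: a) (l *: b) = m * n * k * l * volume M N a b.
Proof.
by rewrite /volume axis_dirZ !directionZ cross_scale dot_scale; ring.
Qed.

Lemma sqprimalZ k a : sqprimal (k *: a) = k ^+ 2 * sqprimal a.
Proof. by rewrite !sqprimalE sqnZ. Qed.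

Lemma tiltZ m n k l M N a b :
  tilt (m *: M) (n *: N) (k *: a) (l *: b) =
  m ^+ 6 * n ^+ 6 * k ^+ 4 * l ^+ 4 * tilt M N a b.
Proof.
by rewrite /tilt volumeZ axis_dirZ !directionZ !dot_scale; ring.
Qed.

Lemma tilt_gapZ m n k l j M N a b c :
  tilt_gap (m *: M) (n *: N) (k *: a) (l *: b) (j *: c) =
  m ^+ 8 * n ^+ 8 * k ^+ 6 * l ^+ 4 * j ^+ 4 * tilt_gap M N a b c.
Proof.
rewrite /tilt_gap (tiltZ m n k l) (tiltZ m n k j) (volumeZ m n k l) (volumeZ m n k j).
by rewrite (sqprimalZ l) (sqprimalZ j); ring.
Qed.

Definition row_scale (m n k l j : R) : 'rV[R]_((1 + 3) + (1 + 3)) :=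
  \row_i [:: l; l * m; l * n; j; j * m; j * n; k; k]`_i.

Lemma test_mxZ m n k l j M N a b c :
  test_mx (m *: M) (n *: N) (k *: a) (l *: b) (j *: c) =
  diag_mx (row_scale m n k l j) *m test_mx M N a b c.
Proof.
have D (x : R) u : (row_mx (dual (x *: u)) (primal (x *: u)) : dquat R) =
    x *: (row_mx (dual u) (primal u) : dquat R).
  by rewrite scale_row_mx; congr row_mx; apply/rowP => i; rewrite !mxE.
have E (x : R) u : eps_mul (x *: u) = x *: eps_mul u.
  by rewrite /eps_mul mkdqZ scaler0; congr mkdq; apply/rowP => i; rewrite !mxE.
have T (x y : R) u L : dmul (x *: u) (line_dq (y *: L)) = (x * y) *: dmul u (line_dq L).
  by rewrite line_dqZ dmulZl dmulZr scalerA.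
have K (i : 'I_8) : (test_vectors (m *: M) (n *: N) (k *: a) (l *: b) (j *: c))`_i =
    [:: l; l * m; l * n; j; j * m; j * n; k; k]`_i *: (test_vectors M N a b c)`_i.
  case: i => -[|[|[|[|[|[|[|[|//]]]]]]]] hi;
    [exact: erefl | exact: T | exact: T | exact: erefl | exact: T | exact: T
    | exact: E | exact: erefl].
rewrite mul_diag_mx; apply/matrixP => i t; rewrite ![in RHS]mxE [LHS]mxE.
by rewrite (K i) D rowZE; congr (_ * _); rewrite [LHS]mxE.
Qed.

Lemma test_detZ m n k l j M N a b c :
  test_det (m *: M) (n *: N) (k *: a) (l *: b) (j *: c) =
  m ^+ 2 * n ^+ 2 * k ^+ 2 * l ^+ 3 * j ^+ 3 * test_det M N a b c.
Proof.
rewrite /test_det test_mxZ det_mulmx det_diag; congr (_ * _).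
by rewrite !big_ord_recl big_ord0 !mxE /=; ring.
Qed.

Lemma cofactor_diag m (d : 'rV[R]_m) (A : 'M[R]_m) i j :
  cofactor (diag_mx d *m A) i j = (\prod_(t < m.-1) d 0 (lift i t)) * cofactor A i j.
Proof.
rewrite /cofactor [RHS]mulrCA; congr (_ * _).
have -> : row' i (col' j (diag_mx d *m A)) =
    diag_mx (\row_t d 0 (lift i t)) *m row' i (col' j A).
  by rewrite !mul_diag_mx; apply/matrixP => s t; rewrite !mxE.
by rewrite det_mulmx det_diag; congr (_ * _); apply: eq_bigr => t _; rewrite mxE.
Qed.

(** The cofactors of the last row omit one of the two rows scaled by k, so [fourth_dir] has degree 1
    in a where [test_det] has degree 2. *)
Lemma fourthZ m n k l j M N a b c :
  fourth (m *: M) (n *: N) (k *: a) (l *: b) (j *: c) =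
  (m ^+ 4 * n ^+ 4 * k ^+ 3 * l ^+ 6 * j ^+ 6) *: fourth M N a b c.
Proof.
have hs : fourth_dir (m *: M) (n *: N) (k *: a) (l *: b) (j *: c) =
    (m ^+ 2 * n ^+ 2 * k * l ^+ 3 * j ^+ 3) *: fourth_dir M N a b c.
  apply/rowP => i; rewrite [LHS]mxE test_mxZ cofactor_diag rowZE [X in _ = _ * X]mxE.
  by congr (_ * _); rewrite !big_ord_recl big_ord0 !mxE /=; ring.
rewrite /fourth hs test_detZ bformZl bformZr scalerDr !scalerA.
by congr (_ *: _ + _ *: _); ring.
Qed.
End Scale.

Section Edge.
Variable R : realType.
Implicit Types (a b c d z : dquat R) (M N : line R).

Lemma same_pointxx a : same_point a a.
Proof. by exists 1; rewrite oner_eq0 scale1r. Qed.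
Lemma same_point_sym a b : same_point a b -> same_point b a.
Proof.
move=> [k [k0 ->]]; exists k^-1; rewrite invr_eq0; split; first exact: k0.
by rewrite scalerA mulVf // scale1r.
Qed.
Lemma same_point_trans b a c : same_point a b -> same_point b c -> same_point a c.
Proof.
move=> [k [k0 ->]] [l [l0 ->]]; exists (l * k); rewrite mulf_neq0 //; split=> //.
by rewrite scalerA.
Qed.

Definition edge M N a b := linked M N a b /\ volume M N a b != 0.

Lemma edge_sym M N a b : edge M N a b -> edge M N b a.
Proof. by move=> [h1 h2]; split; [exact: linked_sym | rewrite volume_sym oppr_eq0]. Qed.

Lemma edge_same M N a b c d : same_point a c -> same_point b d -> edge M N a b ->
  edge M N c d.
Proof.
move=> [k [k0 ->]] [l [l0 ->]] [h v]; split.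
  by apply: linkedZ; apply: linked_sym; apply: linkedZ; apply: linked_sym.
by have := volumeZ 1 1 k l M N a b; rewrite !scale1r => ->; rewrite !mulf_neq0 ?oner_eq0.
Qed.

Lemma volume_refl M N a k : volume M N a (k *: a) = 0.
Proof.
have g j : axis_dir a (k *: a) 0 j = 0.
  rewrite /axis_dir dmulZr dconj_mull qvecE -[LHS]/((qv j _).1) qvZ dnumM1.
  by move: j; apply: ord3; [rewrite -/(q1 _) q1_dq4 | rewrite -/(q2 _) q2_dq4 | rewrite -/(q3 _) q3_dq4];
    rewrite mulr0.
by rewrite /volume dotE3 !g; ring.
Qed.

Lemma edge_distinct_points M N a b : edge M N a b -> ~ same_point a b.
Proof. by move=> [_ /eqP v] [k [_ e]]; apply: v; rewrite e volume_refl. Qed.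

Lemma volume_displacement M N a b : bform b b = 0 -> volume M N a b != 0 ->
  is_displacement b.
Proof.
move=> nb v0; split; first exact: nb.
apply: contra_neq v0 => e; have g j : axis_dir a b 0 j = 0.
  rewrite /axis_dir qvecE -[LHS]/((qv j _).1).
  have z : forall i, primal b 0 i = 0 by move=> i; rewrite e mxE.
  by move: j; apply: ord3; [rewrite -/(q1 _) q1M | rewrite -/(q2 _) q2M | rewrite -/(q3 _) q3M];
    rewrite /q0 /q1 /q2 /q3 /qv !dnE /= !z; ring.
by rewrite /volume dotE3 !g; ring.
Qed.

Lemma unique4_same M N a b c d a' b' c' d' : same_point a a' -> same_point b b' ->
  same_point c c' -> same_point d d' -> unique4 M N a b c d -> unique4 M N a' b' c' d'.
Proof.
have L x y z : same_point x y -> linked M N y z -> linked M N x z.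
  move=> /same_point_sym [k [_ ->]] h.
  by apply: linked_sym; apply: linkedZ; exact: linked_sym.
move=> [k [k0 ->]] hb hc [l [l0 ->]] u z nz lb lc.
have [j [->|->]] := u z nz (L _ _ _ hb lb) (L _ _ _ hc lc).
  by exists (j / k); left; rewrite scalerA divfK.
by exists (j / l); right; rewrite scalerA divfK.
Qed.

Lemma unique4_sym M N a b c d : unique4 M N a b c d -> unique4 M N a c b d.
Proof. by move=> u z nz lb lc; exact: u. Qed.

Lemma unique4_fourth M N a b c : test_det M N a b c != 0 -> is_displacement a ->
  linked M N a b -> linked M N a c -> unique4 M N a b c (fourth M N a b c).
Proof.
move=> G0 [na pa] lb lc z nz zb zc.
by apply: (fourth_unique G0 na) => //; exact: linked_sym.
Qed.

Lemma tilt_gap_refl M N a b k : tilt_gap M N a b (k *: b) = 0.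
Proof.
have tE : tilt M N a (k *: b) = k ^+ 4 * tilt M N a b.
  by have := tiltZ 1 1 1 k M N a b; rewrite !scale1r => ->; ring.
have vE : volume M N a (k *: b) = k * volume M N a b.
  by have := volumeZ 1 1 1 k M N a b; rewrite !scale1r => ->; ring.
by rewrite /tilt_gap tE vE sqprimalZ; ring.
Qed.

Lemma bform_fourth_neq0 M N a b c : test_det M N a b c != 0 -> bform a a = 0 ->
  bform a (fourth M N a b c) != 0.
Proof.
move=> G0 na; rewrite /fourth bformDr !bformZr na mulr0 add0r.
by rewrite bform_fourth_dir mulf_neq0 // mulf_neq0 ?pnatr_eq0.
Qed.

End Edge.

Section Star.
Variables (R : realType) (n : nat).
Implicit Types (D E : input R n) (i j l : 'I_n).

Definition ray D i : dquat R := row i (in_e D).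
Definition corner D i j := fourth (in_M D) (in_N D) (in_0 D) (ray D i) (ray D j).

(* The star of the vertex e_j in the cube spanned by the star D. *)
Definition step j D : input R n :=
  Input (in_M D) (in_N D) (ray D j)
    (\matrix_i (if i == j then in_0 D else corner D i j)).

Lemma ray_step D i j : ray (step j D) i = if i == j then in_0 D else corner D i j.
Proof. exact: rowK. Qed.

Lemma step_M j D : in_M (step j D) = in_M D. Proof. by []. Qed.
Lemma step_N j D : in_N (step j D) = in_N D. Proof. by []. Qed.
Lemma step_0 j D : in_0 (step j D) = ray D j. Proof. by []. Qed.

(** The factors ensure in turn that the fourth vertex is unique, that the two edges have distinct
    Lax coordinates and different endpoints, that the new edge at [ray D j] is a rotation meeting
    both lines, and that the face seen from [ray D j] determines its fourth vertex again. *)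
Definition gate D i j : R :=
  test_det (in_M D) (in_N D) (in_0 D) (ray D i) (ray D j)
  * tilt_gap (in_M D) (in_N D) (in_0 D) (ray D i) (ray D j)
  * volume (in_M D) (in_N D) (ray D j) (corner D i j)
  * test_det (in_M D) (in_N D) (ray D j) (corner D i j) (in_0 D).

(* Where it does not vanish, step is involutive and preserves good stars; steps
   commute if it also does not vanish after each of them. *)
Definition star_gate D : R :=
  (\prod_i volume (in_M D) (in_N D) (in_0 D) (ray D i)) *
  \prod_(p : 'I_n * 'I_n | p.1 != p.2) gate D p.1 p.2.

Definition good D := [/\ is_line (in_M D), is_line (in_N D),
  Defs.skew (in_M D) (in_N D), is_displacement (in_0 D) &
  forall i, is_displacement (ray D i) /\ edge (in_M D) (in_N D) (in_0 D) (ray D i)].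

Lemma admissibleP D : admissible D <-> good D.
Proof.
split=> -[lM lN sk d0 h]; split=> // i; have [h1 h2] := h i; split=> //.
  by apply/revoluteP.
by apply/revoluteP.
Qed.

Lemma gate_neq0 D i j : star_gate D != 0 -> i != j -> gate D i j != 0.
Proof.
rewrite mulf_eq0 negb_or => /andP [_ /prodf_neq0 h] ij.
exact: (h (i, j)).
Qed.

Section Gates.
Variables (D : input R n) (i j : 'I_n).
Hypotheses (gD : good D) (sD : star_gate D != 0) (ij : i != j).
Local Notation M := (in_M D).
Local Notation N := (in_N D).
Local Notation a := (in_0 D).

Let gates : [/\ test_det M N a (ray D i) (ray D j) != 0,
  tilt_gap M N a (ray D i) (ray D j) != 0,
  volume M N (ray D j) (corner D i j) != 0 &
  test_det M N (ray D j) (corner D i j) a != 0].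
Proof.
have := gate_neq0 sD ij; rewrite /gate !mulf_eq0 !negb_or.
by move=> /andP [/andP [/andP [? ?] ?] ?]; split.
Qed.

Let lk t : linked M N a (ray D t). Proof. by case: gD => _ _ _ _ /(_ t) [_ []]. Qed.
Let a_null : bform a a = 0. Proof. by case: gD => _ _ _ []. Qed.
Let da : is_displacement a. Proof. by case: gD. Qed.

Lemma corner_unique : unique4 M N a (ray D i) (ray D j) (corner D i j).
Proof. by case: gates => G _ _ _; exact: unique4_fourth. Qed.

Lemma corner_linked : linked M N (ray D i) (corner D i j) /\
  linked M N (ray D j) (corner D i j).
Proof. by case: gates => G _ _ _; apply: linked_fourth => //; exact: linked_sym. Qed.

Lemma corner_null : bform (corner D i j) (corner D i j) = 0.
Proof. by case: gates => G _ _ _; apply: fourth_null. Qed.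

Lemma corner_far : ~ same_point a (corner D i j).
Proof.
case: gates => G _ _ _ [k [_ e]].
have := bform_fourth_neq0 G a_null.
by rewrite -/(corner D i j) e bformZr a_null mulr0 eqxx.
Qed.

Lemma corner_edge : edge M N (ray D j) (corner D i j).
Proof. by case: gates => _ _ v _; split; case: corner_linked. Qed.

Lemma corner_displacement : is_displacement (corner D i j).
Proof. by case: corner_edge => _; apply: volume_displacement; exact: corner_null. Qed.

Lemma rays_distinct : ~ same_point (ray D i) (ray D j).
Proof.
by case: gates => _ /eqP t _ _ [k [_ e]]; apply: t; rewrite e tilt_gap_refl.
Qed.

End Gates.

Lemma good_step D j : good D -> star_gate D != 0 -> good (step j D).
Proof.
move=> gD sD; have [lM lN sk d0 h] := gD; split; [exact: lM | exact: lN | exact: sk | by case: (h j) |].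
move=> i; rewrite ray_step; have [_ ej] := h j; case: eqVneq => [_|ij].
  by split; [exact: d0 | exact: edge_sym].
by split; [exact: corner_displacement | exact: corner_edge].
Qed.

Definition same_star D E := [/\ in_M E = in_M D, in_N E = in_N D,
  same_point (in_0 D) (in_0 E) & forall i, same_point (ray D i) (ray E i)].

Lemma same_star_refl D : same_star D D.
Proof. by split=> //; move=> *; exact: same_pointxx. Qed.
Lemma same_star_sym D E : same_star D E -> same_star E D.
Proof. by case=> hM hN h1 h2; split; rewrite ?hM ?hN // => *; exact: same_point_sym. Qed.
Lemma same_star_trans E D F : same_star D E -> same_star E F -> same_star D F.
Proof.
case=> hM hN h1 h2 [kM kN h3 h4]; split; rewrite ?kM ?kN //.
  exact: same_point_trans h3.
by move=> i; exact: same_point_trans (h4 i).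
Qed.

Lemma fourth_same M N (a b c a' b' c' : dquat R) : same_point a a' -> same_point b b' ->
  same_point c c' -> same_point (fourth M N a b c) (fourth M N a' b' c').
Proof.
move=> [k [k0 ->]] [l [l0 ->]] [m [m0 ->]].
have := fourthZ 1 1 k l m M N a b c; rewrite !scale1r => ->.
by eexists; split; last reflexivity; rewrite !mulf_neq0 ?expf_neq0 ?oner_eq0.
Qed.

Lemma step_same D E j : same_star D E -> same_star (step j D) (step j E).
Proof.
case=> hM hN h0 h; split=> //; first exact: (h j).
move=> i; rewrite !ray_step; case: eqP => _ //.
by rewrite /corner hM hN; exact: fourth_same.
Qed.

Lemma not_scale_same (a b c : dquat R) k : ~ same_point a c -> c != 0 -> 
  c = k *: a \/ c = k *: b -> same_point b c.
Proof.
move=> ac c0 [e|e].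
  by case: ac; exists k; split=> //; apply: contra_neq c0 => k0; rewrite e k0 scale0r.
by exists k; split=> //; apply: contra_neq c0 => k0; rewrite e k0 scale0r.
Qed.

Lemma displacement_neq0 (a : dquat R) : is_displacement a -> a != 0.
Proof.
by case=> _; apply: contra_neq => ->; apply/rowP => i; rewrite !mxE.
Qed.

Lemma unique4_same_point M N (a b c d z : dquat R) : unique4 M N a b c d -> is_displacement z ->
  linked M N b z -> linked M N c z -> ~ same_point a z -> same_point d z.
Proof.
move=> u dz lb lc az; have [k hk] := u z (proj1 dz) lb lc.
exact: not_scale_same az (displacement_neq0 dz) hk.
Qed.

(** Seen from e_j, the face of i and j has e_i as an admissible fourth vertex, and the last factor
    of [gate] leaves no other. *)
Lemma step_step D j : good D -> star_gate D != 0 -> same_star (step j (step j D)) D.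
Proof.
move=> gD sD; have [lM lN sk d0 h] := gD; split=> //.
  by rewrite /= ray_step eqxx; exact: same_pointxx.
move=> i; rewrite ray_step; case: eqVneq => [->|ij]; first exact: same_pointxx.
have [_ _ _ G] : [/\ True, True, True &
    test_det (in_M D) (in_N D) (ray D j) (corner D i j) (in_0 D) != 0].
  by have := gate_neq0 sD ij; rewrite /gate !mulf_eq0 !negb_or => /andP [].
have [dj [lj _]] := h j; have [di [li _]] := h i.
have [k1 k2] := corner_linked gD sD ij.
rewrite /corner !ray_step eqxx (negbTE ij) /=.
apply: (unique4_same_point (unique4_fourth G dj k2 (linked_sym lj)) di).
- exact: linked_sym.
- exact: li.
- by move=> /same_point_sym; exact: rays_distinct.
Qed.

Lemma corner_sym D i j : good D -> star_gate D != 0 -> i != j ->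
  same_point (corner D i j) (corner D j i).
Proof.
move=> gD sD ij; have ji : j != i by rewrite eq_sym.
have [l1 l2] := corner_linked gD sD ji.
apply: (unique4_same_point (corner_unique gD sD ij)) => //.
- exact: corner_displacement.
- exact: corner_far.
Qed.

Lemma corner_back D i j : good D -> star_gate D != 0 -> i != j ->
  star_gate (step j D) != 0 -> same_point (corner (step j D) j i) (ray D i).
Proof.
move=> gD sD ij sj; have ji : j != i by rewrite eq_sym.
have [_ _ _ _ h] := gD; have [di [li _]] := h i.
have [_ l2] := corner_linked gD sD ij; have [l1 _] := corner_linked gD sD ij.
have u := corner_unique (good_step j gD sD) sj ji.
rewrite !ray_step eqxx (negbTE ij) in u.
apply: (unique4_same_point u di) => //; first exact: linked_sym.
by move=> /same_point_sym; exact: rays_distinct.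
Qed.

(** Both sides are the vertex e_i + e_j + e_l, reached by stepping first to e_i or first to e_j;
    this is where 3D-consistency enters. *)
Lemma corner_cube D i j l : good D -> star_gate D != 0 ->
  i != j -> l != i -> l != j ->
  star_gate (step i D) != 0 -> star_gate (step j D) != 0 ->
  same_point (corner (step i D) l j) (corner (step j D) l i).
Proof.
move=> gD sD ij li lj si sj; have ji : j != i by rewrite eq_sym.
have [lM lN sk d0 h] := gD; have [n0 p0] := d0.
have gi := good_step i gD sD; have gj := good_step j gD sD.
have tg s t : s != t -> tilt_gap (in_M D) (in_N D) (in_0 D) (ray D s) (ray D t) != 0.
  by move=> /(gate_neq0 sD); rewrite /gate !mulf_eq0 !negb_or => /andP [/andP [/andP []]].
have ui := corner_unique gi si lj; have uj := corner_unique gj sj li.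
rewrite !ray_step (negbTE li) (negbTE ji) in ui.
rewrite !ray_step (negbTE lj) (negbTE ij) in uj.
have il : i != l by rewrite eq_sym. have jl : j != l by rewrite eq_sym.
(* The vertex e_i + e_j appears as [corner D j i] in one star and as [corner D i j] in the other;
   they must be identified first. *)
have ui' := unique4_same (same_pointxx _) (same_point_sym (corner_sym gD sD ij)) (same_pointxx _) (same_pointxx _) (unique4_sym ui).
have [|k k0 e] := @cube_consistency R (in_M D) (in_N D) lM lN (skew_cross lM sk)
   (skew_reciprocal lM lN sk) (in_0 D) (ray D i) (ray D j) (ray D l)
   (corner D i j) (corner D l i) (corner D l j) (corner (step i D) l j)
   (corner (step j D) l i) n0 p0 _ (tg _ _ ij) (tg _ _ il) (tg _ _ jl)
   (corner_unique gD sD ij) (unique4_sym (corner_unique gD sD li))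
   (unique4_sym (corner_unique gD sD lj)) ui' (unique4_sym uj).
  have hb t : [/\ bform (ray D t) (ray D t) = 0, primal (ray D t) != 0,
     linked (in_M D) (in_N D) (in_0 D) (ray D t) &
     volume (in_M D) (in_N D) (in_0 D) (ray D t) != 0].
    by have [[? ?] [? ?]] := h t; split.
  by move=> b; rewrite !inE => /or3P [] /eqP ->; exact: hb.
by exists k; split; [exact: k0 | exact: e].
Qed.

Lemma same_point_cong (a b c d : dquat R) : a = c -> b = d -> same_point c d -> same_point a b.
Proof. by move=> -> ->. Qed.

(** The new centre and the rays i and j concern a single face; the remaining rays need
    [corner_cube]. *)
Lemma step_comm D i j : good D -> star_gate D != 0 -> i != j ->
  star_gate (step i D) != 0 -> star_gate (step j D) != 0 ->
  same_star (step j (step i D)) (step i (step j D)).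
Proof.
move=> gD sD ij si sj; have ji : j != i by rewrite eq_sym.
have eM s t : in_M (step s (step t D)) = in_M D := eq_trans (step_M s _) (step_M t D).
have eN s t : in_N (step s (step t D)) = in_N D := eq_trans (step_N s _) (step_N t D).
have e0 s t : s != t -> in_0 (step s (step t D)) = corner D s t.
  by move=> st; rewrite step_0 ray_step (negbTE st).
split; [exact: eq_trans (eM i j) (esym (eM j i)) | exact: eq_trans (eN i j) (esym (eN j i)) | |].
  exact: same_point_cong (e0 _ _ ji) (e0 _ _ ij) (corner_sym gD sD ji).
move=> l; apply: same_point_cong (ray_step (step i D) l j) (ray_step (step j D) l i) _.
case: (eqVneq l j) => [->|lj].
  by rewrite (negbTE ji); apply: same_point_sym; exact: corner_back.
case: (eqVneq l i) => [->|li]; last exact: corner_cube.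
exact: corner_back.
Qed.

End Star.

(** * Filling the cube along sequences of steps *)

Section Walk.
Variables (R : realType) (n : nat).
Implicit Types (D E : input R n) (i j k l : 'I_n) (s t : seq 'I_n) (I : {set 'I_n}).

Definition walk D s := foldl (fun E j => step j E) D s.

Lemma walk_rcons D s j : walk D (rcons s j) = step j (walk D s).
Proof. exact: foldl_rcons. Qed.

Definition regular m D := forall s, (size s <= m)%N -> star_gate (walk D s) != 0.

Lemma regular_step m D j : regular m.+1 D -> regular m (step j D).
Proof. by move=> h s hs; exact: (h (j :: s)). Qed.

Lemma regular_gate m D : regular m D -> star_gate D != 0.
Proof. by move=> h; exact: (h [::]). Qed.

Lemma walk_good m D s : good D -> regular m D -> (size s <= m.+1)%N ->
  good (walk D s).
Proof.
move=> gD rD; elim/last_ind: s => [//|s j ih]; rewrite size_rcons ltnS => hs.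
rewrite walk_rcons.
by apply: good_step; [apply: ih; exact: leqW | exact: rD].
Qed.

Lemma walk_same D E s : same_star D E -> same_star (walk D s) (walk E s).
Proof.
elim: s D E => [//|j s ih] D E h; apply: ih; exact: step_same.
Qed.

(** The first occurrence of j is moved to the front by exchanging it with one preceding step at a
    time; regularity keeps [step_comm] applicable on the way. *)
Lemma walk_rem m D s j : good D -> regular m D -> (size s <= m)%N -> j \in s ->
  same_star (walk D s) (walk (step j D) (rem j s)).
Proof.
elim: s m D => [//|i s ih] [//|m] D gD rD hs; rewrite inE /= eq_sym.
case: eqVneq => [-> _|ij /= js]; first exact: same_star_refl.
have sD := regular_gate rD.
have [gi ri] := (good_step i gD sD, regular_step i rD).
have s1 := ih m (step i D) gi ri hs js.
apply: same_star_trans s1 _; apply: (walk_same (D := step j (step i D))).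
apply: step_comm => //; first exact: regular_gate ri.
exact: regular_gate (regular_step j rD).
Qed.

Lemma walk_perm m D s t : good D -> regular m D -> (size s <= m)%N ->
  perm_eq s t -> same_star (walk D s) (walk D t).
Proof.
elim: s m D t => [|j s ih] m D t gD rD hs pst.
  by have -> : t = [::] by [apply/nilP; rewrite /nilp -(perm_size pst)]; exact: same_star_refl.
have jt : j \in t by rewrite -(perm_mem pst) mem_head.
case: m rD hs => [//|m] rD hs.
have h := walk_rem gD rD _ jt; rewrite -(perm_size pst) in h.
apply: same_star_trans (same_star_sym (h hs)).
apply: (ih m (step j D) _ (good_step j gD (regular_gate rD)) (regular_step j rD) hs).
by rewrite -(perm_cons j); apply: perm_trans pst _; exact: perm_to_rem.
Qed.

Section Cube.
Variable D : input R n.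
Hypotheses (gD : good D) (rD : regular n D).
Local Notation M := (in_M D).
Local Notation N := (in_N D).

Definition cube I := walk D (enum I).
Definition vertex I := in_0 (cube I).

Let size_enum I : (size (enum I) <= n)%N.
Proof. by rewrite -cardE -[leqRHS]card_ord max_card. Qed.

Lemma cube_regular I : star_gate (cube I) != 0.
Proof. by apply: rD. Qed.

Lemma cube_good I : good (cube I).
Proof. by apply: walk_good rD _; rewrite // leqW. Qed.

Lemma cube_add I j : j \notin I -> same_star (cube (j |: I)) (step j (cube I)).
Proof.
move=> jI; rewrite /cube -walk_rcons.
apply: walk_perm rD _ _ => //; apply: uniq_perm.
- exact: enum_uniq.
- by rewrite rcons_uniq enum_uniq mem_enum jI.
- by move=> k; rewrite mem_rcons !inE !mem_enum !inE.
Qed.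

Lemma walk_lines s : in_M (walk D s) = M /\ in_N (walk D s) = N.
Proof. by elim: s D => [//|j s ih] E; have [-> ->] := ih (step j E). Qed.

Lemma vertex_add I j : j \notin I -> same_point (ray (cube I) j) (vertex (j |: I)).
Proof. by move=> /cube_add /same_star_sym [_ _ h _]. Qed.

Lemma vertex_add2 I j k : j \notin I -> k \notin I -> j != k ->
  same_point (corner (cube I) k j) (vertex (k |: (j |: I))).
Proof.
move=> jI kI jk; have kj : k != j by rewrite eq_sym.
have kjI : k \notin j |: I by rewrite !inE negb_or kj.
have [_ _ _ h] := same_star_sym (cube_add jI).
apply: same_point_trans (vertex_add kjI).
by have := h k; rewrite ray_step (negbTE kj).
Qed.

Lemma vertex_displacement I : is_displacement (vertex I).
Proof. by case: (cube_good I). Qed.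

Lemma vertex_edge I j : j \notin I -> edge M N (vertex I) (vertex (j |: I)).
Proof.
move=> jI; have [_ _ _ _ /(_ j) [_]] := cube_good I.
have [-> ->] := walk_lines (enum I).
exact: edge_same (same_pointxx _) (vertex_add jI).
Qed.

Lemma edge_revolute a b : is_displacement a -> is_displacement b -> edge M N a b ->
  joining_line_on_study a b /\ revolute_meeting M N a b.
Proof.
move=> da db e; have [lM lN sk _ _] := gD; split; last exact/revoluteP.
by apply: joining_line_of_null; [exact: (proj1 da) | exact: (proj1 db) | case: e => -[]].
Qed.

Lemma vertex_unique I j k z : j \notin I -> k \notin I -> j != k ->
  is_displacement z -> linked M N (vertex (j |: I)) z -> linked M N (vertex (k |: I)) z ->
  ~ same_point (vertex I) z -> same_point (vertex (k |: (j |: I))) z.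
Proof.
move=> jI kI jk dz lj lk; have kj : k != j by rewrite eq_sym.
have u := corner_unique (cube_good I) (cube_regular I) kj.
have [eM eN] := walk_lines (enum I); rewrite -/(cube I) in eM eN; rewrite eM eN in u.
have u' := unique4_same (same_pointxx _) (vertex_add kI) (vertex_add jI) (vertex_add2 jI kI jk) u.
exact: (unique4_same_point u' dz lk lj).
Qed.

Lemma vertex_rotation I j k : j \notin I -> k \notin I -> j != k ->
  rotation_quadrilateral (face vertex I j k) /\
  quadrilateral_axes_meet M N (face vertex I j k).
Proof.
move=> jI kI jk; have kj : k != j by rewrite eq_sym.
have kjI : k \notin j |: I by rewrite !inE negb_or kj.
have jkI : j \notin k |: I by rewrite !inE negb_or jk.
have e1 := vertex_edge jI; have e4 := edge_sym (vertex_edge kI).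
have e2 := vertex_edge kjI; have e3 := edge_sym (vertex_edge jkI).
have ekj : j |: (k |: I) = k |: (j |: I) by rewrite setUCA.
rewrite ekj in e3.
have d := vertex_displacement.
have l1 := edge_revolute (d _) (d _) e1; have l2 := edge_revolute (d _) (d _) e2.
have l3 := edge_revolute (d _) (d _) e3; have l4 := edge_revolute (d _) (d _) e4.
have diag1 : ~ same_point (vertex I) (vertex (k |: (j |: I))).
  move=> h; have := corner_far (cube_good I) (cube_regular I) kj; apply.
  exact: same_point_trans h (same_point_sym (vertex_add2 jI kI jk)).
have diag2 : ~ same_point (vertex (j |: I)) (vertex (k |: I)).
  move=> h; have := rays_distinct (cube_regular I) jk; apply.
  apply: same_point_trans (vertex_add jI) _; apply: same_point_trans h _.
  exact: same_point_sym (vertex_add kI).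
have dist p q : (p < q)%N -> (q < 4)%N -> 
    ~ same_point (nth (vertex I) (face vertex I j k) p) (nth (vertex I) (face vertex I j k) q).
  case: p => [|[|[|p]]]; case: q => [|[|[|[|q]]]] //= _ _.
  - exact: edge_distinct_points e1.
  - by move/same_point_sym; exact: edge_distinct_points e4.
  - exact: edge_distinct_points e2.
  - exact: edge_distinct_points e3.
split; [split|].
- by case=> -[|[|[|[|//]]]] hi; rewrite (tnth_nth (vertex I)) /=; exact: d.
- case=> -[|[|[|[|//]]]] hi; rewrite !(tnth_nth (vertex I)) /=;
  [exact: (proj1 l1) | exact: (proj1 l2) | exact: (proj1 l3) | exact: (proj1 l4)].
- move=> p q; rewrite !(tnth_nth (vertex I)) neq_ltn => /orP [h|h].
    exact: dist.
  by move/same_point_sym; exact: dist.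
case=> -[|[|[|[|//]]]] hi; rewrite !(tnth_nth (vertex I)) /=;
  [exact: (proj2 l1) | exact: (proj2 l2) | exact: (proj2 l3) | exact: (proj2 l4)].
Qed.

Lemma vertex_extends : extends_to_cube D vertex.
Proof.
split=> [|||I j k jk jI kI].
- exact: vertex_displacement.
- by rewrite /vertex /cube enum_set0; exact: same_pointxx.
- move=> j; have := @vertex_add set0 j; rewrite setU0 inE => /(_ isT).
  by rewrite /cube enum_set0.
exact: vertex_rotation.
Qed.

(** Induction on the size of I. Removing j and k from I leaves J; then [b I] is linked to two
    vertices already determined and differs from the opposite vertex [b J], since faces are
    non-degenerate. The face therefore determines it. *)
Lemma extension_unique b : extends_to_cube D b -> forall I, same_point (vertex I) (b I).
Proof.
move=> [db b0 b1 bf] I; have [m] := ubnP #|I|; elim: m I => // m ih I hI.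
have [->|[j jI]] := set_0Vmem I.
  by rewrite /vertex /cube enum_set0.
have [e|[k kI]] := set_0Vmem (I :\ j).
  have -> : I = [set j] by rewrite -(setD1K jI) e setU0.
  apply: same_point_trans (b1 j); apply: same_point_sym.
  have := @vertex_add set0 j; rewrite setU0 inE => /(_ isT).
  by rewrite /cube enum_set0.
set J := (I :\ j) :\ k.
have kj : k != j by move: kI; rewrite !inE => /andP [].
have jk : j != k by rewrite eq_sym.
have jJ : j \notin J by rewrite !inE eqxx andbF.
have kJ : k \notin J by rewrite !inE eqxx.
have eJ : k |: J = I :\ j by rewrite setD1K.
have eI : k |: (j |: J) = I by rewrite setUCA eJ setD1K.
have cI : #|I| = #|J|.+2.
  by rewrite (cardsD1 j) jI (cardsD1 k (I :\ j)) kI.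
have cadd i : i \notin J -> (#|i |: J| < m)%N.
  by move=> iJ; rewrite cardsU1 iJ; move: hI; rewrite cI ltnS.
have hj := ih _ (cadd j jJ); have hk := ih _ (cadd k kJ).
have hJ : same_point (vertex J) (b J).
  by apply: ih; apply: leq_ltn_trans (cadd j jJ); rewrite subset_leq_card // subsetUr.
have [[_ _ hd] hm] := bf J j k jk jJ kJ.
have [lM lN sk _ _] := gD.
have meet (p q : dquat R) v : is_displacement p -> is_displacement q ->
    same_point v p -> revolute_meeting M N p q -> linked M N v q.
  move=> dp dq vp /(revoluteP lM lN sk dp dq) e.
  by case: (edge_same (same_point_sym vp) (same_pointxx q) e).
set B := b (k |: (j |: J)) in hd hm *.
have m1 : revolute_meeting M N (b (j |: J)) B.
  by have := hm (Ordinal (isT : (1 < 4)%N)); rewrite !(tnth_nth (b J)).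
have m2 : revolute_meeting M N B (b (k |: J)).
  by have := hm (Ordinal (isT : (2 < 4)%N)); rewrite !(tnth_nth (b J)).
have m2' : linked M N (vertex (k |: J)) B.
  have /(revoluteP lM lN sk (db _) (db _)) e := m2.
  by case: (edge_same (same_point_sym hk) (same_pointxx B) (edge_sym e)).
have far : ~ same_point (b J) B.
  have := hd (Ordinal (isT : (0 < 4)%N)) (Ordinal (isT : (2 < 4)%N)) isT.
  by rewrite !(tnth_nth (b J)).
rewrite -eI; apply: vertex_unique jJ kJ jk (db _) _ m2' _.
  exact: meet (db _) (db _) hj m1.
by move=> h; apply: far; exact: same_point_trans (same_point_sym hJ) h.
Qed.
End Cube.
End Walk.

(** * Polynomial dependence on the input *)

(** Closure under pointwise equality is demanded separately, as functions are not assumed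
    extensional. *)
Definition fun_algebra (R : realType) (X : Type) (A : (X -> R) -> Prop) :=
  [/\ forall k, A (fun=> k), forall f g, A f -> A g -> A (fun x => f x + g x),
      forall f g, A f -> A g -> A (fun x => f x * g x) &
      forall f g, f =1 g -> A f -> A g].

Section FunAlgebra.
Variables (R : realType) (X : Type) (A : (X -> R) -> Prop).
Hypothesis hA : fun_algebra A.

Lemma algC k : A (fun=> k). Proof. by case: hA => h _ _ _; exact: h. Qed.
Lemma algD f g : A f -> A g -> A (fun x => f x + g x).
Proof. by case: hA => _ h _ _; exact: h. Qed.
Lemma algM f g : A f -> A g -> A (fun x => f x * g x).
Proof. by case: hA => _ _ h _; exact: h. Qed.
Lemma alg_ext f g : f =1 g -> A f -> A g.
Proof. by case: hA => _ _ _ h; exact: h. Qed.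
Lemma algN f : A f -> A (fun x => - f x).
Proof. by move=> h; apply: alg_ext (algM (algC (-1)) h) => x; rewrite mulN1r. Qed.
Lemma algB f g : A f -> A g -> A (fun x => f x - g x).
Proof. by move=> hf hg; apply: algD hf (algN hg). Qed.
Lemma alg_sum (I : Type) (r : seq I) (P : pred I) (F : X -> I -> R) :
  (forall i, P i -> A (F ^~ i)) -> A (fun x => \sum_(i <- r | P i) F x i).
Proof.
move=> h; elim: r => [|i r ih].
  by apply: alg_ext (algC 0) => x; rewrite big_nil.
case Pi: (P i); last by apply: alg_ext ih => x; rewrite big_cons Pi.
by apply: alg_ext (algD (h i Pi) ih) => x; rewrite big_cons Pi.
Qed.
Lemma alg_prod (I : Type) (r : seq I) (P : pred I) (F : X -> I -> R) :
  (forall i, P i -> A (F ^~ i)) -> A (fun x => \prod_(i <- r | P i) F x i).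
Proof.
move=> h; elim: r => [|i r ih].
  by apply: alg_ext (algC 1) => x; rewrite big_nil.
case Pi: (P i); last by apply: alg_ext ih => x; rewrite big_cons Pi.
by apply: alg_ext (algM (h i Pi) ih) => x; rewrite big_cons Pi.
Qed.
Lemma algX f m : A f -> A (fun x => f x ^+ m).
Proof.
move=> h; elim: m => [|m ih]; first exact: algC.
by apply: alg_ext (algM h ih) => x; rewrite exprS.
Qed.

Definition valg m (F : X -> 'rV[R]_m) := forall i, A (fun x => F x 0 i).

Lemma valg_ext m (F G : X -> 'rV[R]_m) : F =1 G -> valg F -> valg G.
Proof. by move=> e h i; apply: alg_ext (h i) => x; rewrite e. Qed.
Lemma valgC m (v : 'rV[R]_m) : valg (fun=> v).
Proof. by move=> i; exact: algC. Qed.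
Lemma valgD m (F G : X -> 'rV[R]_m) : valg F -> valg G -> valg (fun x => F x + G x).
Proof. by move=> hF hG i; apply: alg_ext (algD (hF i) (hG i)) => x; rewrite mxE. Qed.
Lemma valgZ m f (F : X -> 'rV[R]_m) : A f -> valg F -> valg (fun x => f x *: F x).
Proof. by move=> hf hF i; apply: alg_ext (algM hf (hF i)) => x; rewrite mxE. Qed.
Lemma valgN m (F : X -> 'rV[R]_m) : valg F -> valg (fun x => - F x).
Proof. by move=> hF i; apply: alg_ext (algN (hF i)) => x; rewrite mxE. Qed.
Lemma valg_row_mx m1 m2 (F : X -> 'rV[R]_m1) (G : X -> 'rV[R]_m2) :
  valg F -> valg G -> valg (fun x => row_mx (F x) (G x)).
Proof.
move=> hF hG i; case: (split_ordP i) => j ->.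
  by apply: alg_ext (hF j) => x; rewrite row_mxEl.
by apply: alg_ext (hG j) => x; rewrite row_mxEr.
Qed.
Lemma valg_lsub m1 m2 (F : X -> 'rV[R]_(m1 + m2)) : valg F -> valg (fun x => lsubmx (F x)).
Proof. by move=> hF i; apply: alg_ext (hF (lshift m2 i)) => x; rewrite mxE. Qed.
Lemma valg_rsub m1 m2 (F : X -> 'rV[R]_(m1 + m2)) : valg F -> valg (fun x => rsubmx (F x)).
Proof. by move=> hF i; apply: alg_ext (hF (rshift m1 i)) => x; rewrite mxE. Qed.
Lemma alg_dot m (F G : X -> 'rV[R]_m) : valg F -> valg G -> A (fun x => dot (F x) (G x)).
Proof. by move=> hF hG; apply: alg_sum => i _; exact: algM. Qed.
Lemma valg_cross (F G : X -> 'rV[R]_3) : valg F -> valg G -> valg (fun x => cross (F x) (G x)).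
Proof.
move=> hF hG i; pose k := (i + 1 + 1); pose j := i + 1.
by apply: alg_ext (algB (algM (hF j) (hG k)) (algM (hF k) (hG j))) => x; rewrite mxE.
Qed.
Lemma alg_det m (F : X -> 'M[R]_m) : (forall i j, A (fun x => F x i j)) ->
  A (fun x => \det (F x)).
Proof.
move=> h; apply: alg_sum => s _; apply: algM; first exact: algC.
by apply: alg_prod => i _; exact: h.
Qed.
Lemma alg_cofactor m (F : X -> 'M[R]_m) i j : (forall i j, A (fun x => F x i j)) ->
  A (fun x => cofactor (F x) i j).
Proof.
move=> h; apply: algM; first exact: algC.
apply: alg_det => s t; apply: alg_ext (h (lift i s) (lift j t)) => x.
by rewrite !mxE.
Qed.

Lemma valg_mkquat f (F : X -> 'rV[R]_3) : A f -> valg F -> valg (fun x => mkquat (f x) (F x)).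
Proof.
move=> hf hF; apply: ord4 => [|j].
  by apply: alg_ext hf => x; rewrite mkquat0.
by apply: alg_ext (hF j) => x; rewrite mkquatv.
Qed.
Lemma valg_mkdq (F G : X -> quat R) : valg F -> valg G -> valg (fun x => mkdq (F x) (G x)).
Proof. exact: valg_row_mx. Qed.
Lemma valg_primal (F : X -> dquat R) : valg F -> valg (fun x => primal (F x)).
Proof. exact: valg_lsub. Qed.
Lemma valg_dual (F : X -> dquat R) : valg F -> valg (fun x => dual (F x)).
Proof. exact: valg_rsub. Qed.
Lemma valg_qvec (F : X -> quat R) : valg F -> valg (fun x => qvec (F x)).
Proof. exact: valg_rsub. Qed.
Lemma alg_qscal (F : X -> quat R) : valg F -> A (fun x => qscal (F x)).
Proof. by move=> h; exact: h. Qed.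
Lemma valg_qmul (F G : X -> quat R) : valg F -> valg G -> valg (fun x => qmul (F x) (G x)).
Proof.
move=> hF hG; apply: valg_mkquat.
  apply: algB; first by apply: algM; exact: alg_qscal.
  by apply: alg_dot; exact: valg_qvec.
apply: valgD; last by apply: valg_cross; exact: valg_qvec.
by apply: valgD; apply: valgZ; (exact: alg_qscal) || exact: valg_qvec.
Qed.
Lemma valg_dmul (F G : X -> dquat R) : valg F -> valg G -> valg (fun x => dmul (F x) (G x)).
Proof.
move=> hF hG; apply: valg_mkdq.
  by apply: valg_qmul; exact: valg_primal.
by apply: valgD; apply: valg_qmul; (exact: valg_primal) || exact: valg_dual.
Qed.
Lemma valg_dconj (F : X -> dquat R) : valg F -> valg (fun x => dconj (F x)).
Proof.
move=> h; apply: valg_mkdq; apply: valg_mkquat.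
- exact/alg_qscal/valg_primal.
- exact/valgN/valg_qvec/valg_primal.
- exact/alg_qscal/valg_dual.
- exact/valgN/valg_qvec/valg_dual.
Qed.
Lemma alg_bform (F G : X -> dquat R) : valg F -> valg G -> A (fun x => bform (F x) (G x)).
Proof.
by move=> hF hG; apply: algD; apply: alg_dot; (exact: valg_primal) || exact: valg_dual.
Qed.
Lemma valg_line_dq (F : X -> line R) : valg F -> valg (fun x => line_dq (F x)).
Proof.
move=> h; apply: valg_mkdq; apply: valg_mkquat; try exact: algC.
  exact: valg_lsub.
exact/valgN/valg_rsub.
Qed.

Section Fourth.
Variables (M N : X -> line R) (a b c : X -> dquat R).
Hypotheses (hM : valg M) (hN : valg N) (ha : valg a) (hb : valg b) (hc : valg c).

Lemma alg_test_mx i j : A (fun x => test_mx (M x) (N x) (a x) (b x) (c x) i j).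
Proof.
have hL F L : valg F -> valg L -> valg (fun x => dmul (F x) (line_dq (L x))).
  by move=> hF hL; apply: valg_dmul hF (valg_line_dq hL).
have h : valg (fun x => (test_vectors (M x) (N x) (a x) (b x) (c x))`_i).
  case: i => -[|[|[|[|[|[|[|[|//]]]]]]]] hi /=; try exact: hL; try by [].
  by apply: valg_mkdq; [exact: valgC | exact: valg_primal].
have h2 := valg_row_mx (valg_dual h) (valg_primal h).
by apply: alg_ext (h2 j) => x; rewrite [RHS]mxE.
Qed.

Lemma alg_test_det : A (fun x => test_det (M x) (N x) (a x) (b x) (c x)).
Proof. by apply: alg_det; exact: alg_test_mx. Qed.

Lemma valg_fourth : valg (fun x => fourth (M x) (N x) (a x) (b x) (c x)).
Proof.
have hs : valg (fun x => fourth_dir (M x) (N x) (a x) (b x) (c x)).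
  move=> i; have h := alg_cofactor ord_max i alg_test_mx.
  by apply: alg_ext h => x; rewrite [RHS]mxE.
apply: valgD; apply: valgZ => //; first by apply: algN; exact: alg_bform.
by apply: algM; [exact: algC | exact: alg_test_det].
Qed.

Lemma alg_volume : A (fun x => volume (M x) (N x) (a x) (b x)).
Proof.
apply: alg_dot; last by apply: valg_cross; exact: valg_lsub.
by apply/valg_qvec/valg_primal/valg_dmul => //; exact: valg_dconj.
Qed.
End Fourth.

Lemma alg_tilt (M N : X -> line R) (a b : X -> dquat R) :
  valg M -> valg N -> valg a -> valg b -> A (fun x => tilt (M x) (N x) (a x) (b x)).
Proof.
move=> hM hN ha hb; have hg : valg (fun x => axis_dir (a x) (b x)).
  by apply/valg_qvec/valg_primal/valg_dmul => //; exact: valg_dconj.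
have hv := alg_volume hM hN ha hb.
have hu : valg (fun x => direction (M x)) := valg_lsub hM.
have hw : valg (fun x => direction (N x)) := valg_lsub hN.
by apply: algM; apply: algD; try (apply: algM; [exact: alg_dot | exact: algX]);
  apply: algX; apply: algB; apply: algM; exact: alg_dot.
Qed.

Lemma alg_tilt_gap (M N : X -> line R) (a b c : X -> dquat R) :
  valg M -> valg N -> valg a -> valg b -> valg c ->
  A (fun x => tilt_gap (M x) (N x) (a x) (b x) (c x)).
Proof.
move=> hM hN ha hb hc.
have hs F : valg F -> A (fun x => sqprimal (F x)).
  by move=> h; apply: alg_dot; exact: valg_primal.
by apply: algB; (apply: algM; last exact: hs); (apply: algM; first exact: alg_tilt);
  apply: algX; exact: alg_volume.
Qed.

Variable n : nat.

Definition input_alg (F : X -> input R n) := [/\ valg (fun x => in_M (F x)),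
  valg (fun x => in_N (F x)), valg (fun x => in_0 (F x)) &
  forall i, valg (fun x => ray (F x) i)].

Lemma alg_corner F i j : input_alg F -> valg (fun x => corner (F x) i j).
Proof. by case=> hM hN h0 h; apply: valg_fourth. Qed.

Lemma input_alg_step F j : input_alg F -> input_alg (fun x => step j (F x)).
Proof.
move=> hF; have [hM hN h0 h] := hF; split=> //; first exact: h.
move=> i; case ij: (i == j).
  by apply: valg_ext h0 => x; rewrite ray_step ij.
by apply: valg_ext (alg_corner i j hF) => x; rewrite ray_step ij.
Qed.

Lemma alg_gate F i j : input_alg F -> A (fun x => gate (F x) i j).
Proof.
move=> hF; have [hM hN h0 h] := hF; have hc := alg_corner i j hF.
apply: algM; last by apply: alg_test_det.
apply: algM; last by apply: alg_volume.
by apply: algM; [exact: alg_test_det | exact: alg_tilt_gap].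
Qed.

Lemma alg_star_gate F : input_alg F -> A (fun x => star_gate (F x)).
Proof.
move=> hF; have [hM hN h0 h] := hF.
apply: algM; apply: alg_prod => i _; first exact: alg_volume.
exact: alg_gate.
Qed.

End FunAlgebra.

Section Homog.
Variables (R : realType) (n : nat).
Implicit Types (D E : input R n) (f g : input R n -> R) (i j : 'I_n).

(* Quantifying over all algebras of functions covers both polynomials in the
   coordinates of the input and restrictions to polynomial curves of inputs. *)
Definition algebraic f := forall X (A : (X -> R) -> Prop), fun_algebra A ->
  forall F, input_alg A F -> A (fun x => f (F x)).

Lemma algebraic_step f j : algebraic f -> algebraic (fun D => f (step j D)).
Proof. by move=> hf X A hA F hF; apply: (hf X A hA); exact: input_alg_step. Qed.
Lemma algebraic_star_gate : algebraic (@star_gate R n).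
Proof. by move=> X A hA F hF; exact: alg_star_gate. Qed.

Implicit Types mu nu : R -> R -> R -> 'rV[R]_n -> R.

Definition monomial mu := exists (dM dN d0 : nat) (d : 'I_n -> nat),
  forall cM cN c0 c, mu cM cN c0 c =
    cM ^+ dM * cN ^+ dN * c0 ^+ d0 * \prod_j c 0 j ^+ d j.

Lemma monomial1 : monomial (fun _ _ _ _ => 1).
Proof.
exists 0%N, 0%N, 0%N, (fun=> 0%N) => *; by rewrite !expr0 big1 ?mulr1.
Qed.
Lemma monomialM mu nu : monomial mu -> monomial nu ->
  monomial (fun cM cN c0 c => mu cM cN c0 c * nu cM cN c0 c).
Proof.
move=> [dM [dN [d0 [d h]]]] [eM [eN [e0 [e k]]]].
exists (dM + eM)%N, (dN + eN)%N, (d0 + e0)%N, (fun j => d j + e j)%N => cM cN c0 c.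
rewrite h k !exprD; under [in RHS]eq_bigr do rewrite exprD.
by rewrite big_split /=; ring.
Qed.
Lemma monomial_ext mu nu : (forall cM cN c0 c, mu cM cN c0 c = nu cM cN c0 c) ->
  monomial mu -> monomial nu.
Proof.
move=> e [dM [dN [d0 [d h]]]]; exists dM, dN, d0, d => cM cN c0 c.
by rewrite -e h.
Qed.
Lemma monomialX mu m : monomial mu -> monomial (fun cM cN c0 c => mu cM cN c0 c ^+ m).
Proof.
move=> h; elim: m => [|m ih]; first by apply: monomial_ext monomial1.
by apply: monomial_ext (monomialM h ih) => *; rewrite exprS.
Qed.
Lemma monomial_prod (I : Type) (r : seq I) (P : pred I) (mu : I -> R -> R -> R -> 'rV[R]_n -> R) :
  (forall t, monomial (mu t)) ->
  monomial (fun cM cN c0 c => \prod_(t <- r | P t) mu t cM cN c0 c).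
Proof.
move=> h; elim: r => [|i r ih].
  by apply: monomial_ext monomial1 => *; rewrite big_nil.
case Pi: (P i); last by apply: monomial_ext ih => *; rewrite big_cons Pi.
by apply: monomial_ext (monomialM (h i) ih) => *; rewrite big_cons Pi.
Qed.
Lemma monomial_M : monomial (fun cM _ _ _ => cM).
Proof.
exists 1%N, 0%N, 0%N, (fun=> 0%N) => *; by rewrite !expr0 big1 ?mulr1.
Qed.
Lemma monomial_N : monomial (fun _ cN _ _ => cN).
Proof.
exists 0%N, 1%N, 0%N, (fun=> 0%N) => *; by rewrite !expr0 big1 ?mulr1 ?mul1r.
Qed.
Lemma monomial_0 : monomial (fun _ _ c0 _ => c0).
Proof.
exists 0%N, 0%N, 1%N, (fun=> 0%N) => *; by rewrite !expr0 big1 ?mulr1 ?mul1r.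
Qed.
Lemma monomial_e i : monomial (fun _ _ _ c => c 0 i).
Proof.
exists 0%N, 0%N, 0%N, (fun j => (j == i)%N : nat) => *.
rewrite !expr0 !mul1r (bigD1 i) //= eqxx expr1 big1 ?mulr1 // => j /negbTE ->.
by rewrite expr0.
Qed.

Lemma monomial5 i j k0 k1 k2 k3 k4 : monomial (fun cM cN c0 c =>
  cM ^+ k0 * cN ^+ k1 * c0 ^+ k2 * c 0 i ^+ k3 * c 0 j ^+ k4).
Proof.
exact: (monomialM (monomialM (monomialM (monomialM (monomialX k0 monomial_M)
  (monomialX k1 monomial_N)) (monomialX k2 monomial_0)) (monomialX k3 (monomial_e i)))
  (monomialX k4 (monomial_e j))).
Qed.

Definition homogeneous f := exists mu, monomial mu /\
  forall cM cN c0 c D, f (rescale cM cN c0 c D) = mu cM cN c0 c * f D.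

Lemma homogeneousM f g : homogeneous f -> homogeneous g ->
  homogeneous (fun D => f D * g D).
Proof.
move=> [mu [hm hf]] [nu [hn hg]]; eexists; split; first exact: monomialM hm hn.
by move=> * /=; rewrite hf hg; ring.
Qed.

Lemma homogeneous_prod (I : Type) (r : seq I) (P : pred I) (f : I -> input R n -> R) :
  (forall t, P t -> homogeneous (f t)) ->
  homogeneous (fun D => \prod_(t <- r | P t) f t D).
Proof.
move=> h; elim: r => [|i r [mu [hm ih]]].
  by eexists; split=> [|* /=]; first exact: monomial1; rewrite !big_nil mulr1.
case Pi: (P i); last by exists mu; split=> // *; rewrite !big_cons Pi ih.
have [nu [hn hf]] := h i Pi.
eexists; split=> [|* /=]; first exact: monomialM hn hm.
by rewrite !big_cons Pi hf ih; ring.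
Qed.

Lemma algebraic_prod (I : Type) (r : seq I) (P : pred I) (f : I -> input R n -> R) :
  (forall t, P t -> algebraic (f t)) ->
  algebraic (fun D => \prod_(t <- r | P t) f t D).
Proof. by move=> h X A hA F hF; apply: (alg_prod hA) => i Pi; exact: h. Qed.

Lemma ray_rescale cM cN c0 c D i : ray (rescale cM cN c0 c D) i = c 0 i *: ray D i.
Proof. by rewrite /ray /= mul_diag_mx; apply/rowP => t; rewrite !mxE. Qed.

Lemma corner_rescale cM cN c0 c D i j : corner (rescale cM cN c0 c D) i j =
  (cM ^+ 4 * cN ^+ 4 * c0 ^+ 3 * c 0 i ^+ 6 * c 0 j ^+ 6) *: corner D i j.
Proof. by rewrite /corner !ray_rescale fourthZ. Qed.

(** A step of a rescaled star is a rescaling of the step, by factors that are monomials in the old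
    ones; so homogeneity survives composition with steps. *)
Lemma step_rescale cM cN c0 c D j : step j (rescale cM cN c0 c D) =
  rescale cM cN (c 0 j) (\row_i (if i == j then c0
    else cM ^+ 4 * cN ^+ 4 * c0 ^+ 3 * c 0 i ^+ 6 * c 0 j ^+ 6)) (step j D).
Proof.
set d : 'rV_n := \row_i _; rewrite {1}/step ray_rescale {1}/rescale; congr Input.
apply/row_matrixP => i; rewrite rowK.
have := ray_rescale cM cN (c 0 j) d (step j D) i; rewrite /ray /= => ->.
rewrite -/(ray (step j D) i) ray_step [d 0 i]mxE; case: eqP => // _.
exact: corner_rescale.
Qed.

Lemma homogeneous_step f j : homogeneous f -> homogeneous (fun D => f (step j D)).
Proof.
move=> [mu [[dM [dN [d0 [d hm]]]] hf]]; eexists; split; last first.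
  by move=> cM cN c0 c D; rewrite step_rescale hf; reflexivity.
pose nu i : R -> R -> R -> 'rV[R]_n -> R := fun cM cN c0 c =>
  if i == j then c0 else cM ^+ 4 * cN ^+ 4 * c0 ^+ 3 * c 0 i ^+ 6 * c 0 j ^+ 6.
have hnu i : monomial (nu i).
  rewrite /nu; case: eqP => _; first exact: monomial_0.
  exact: monomial5.
have h := monomialM (monomialM (monomialM (monomialX dM monomial_M)
  (monomialX dN monomial_N)) (monomialX d0 (monomial_e j)))
  (monomial_prod (index_enum 'I_n) predT (fun i => monomialX (d i) (hnu i))).
apply: monomial_ext h => cM cN c0 c; rewrite hm; congr (_ * _).
by apply: eq_bigr => i _; rewrite mxE.
Qed.

Lemma homogeneous_star_gate : homogeneous (@star_gate R n).
Proof.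
apply: homogeneousM; apply: homogeneous_prod.
  move=> i _; exists (fun cM cN c0 c => cM * cN * c0 * c 0 i); split.
    exact: (monomialM (monomialM (monomialM monomial_M monomial_N) monomial_0) (monomial_e i)).
  by move=> cM cN c0 c D; rewrite ray_rescale volumeZ.
move=> [i j] _ /=; apply: homogeneousM; [apply: homogeneousM; [apply: homogeneousM|]|].
- eexists; split=> [|cM cN c0 c D]; first exact: (monomial5 i j 2 2 2 3 3).
  by rewrite !ray_rescale test_detZ.
- eexists; split=> [|cM cN c0 c D]; first exact: (monomial5 i j 8 8 6 4 4).
  by rewrite !ray_rescale tilt_gapZ.
(* The corner has degrees 4, 4, 3, 6, 6. It enters the volume linearly and the last determinant with
   degree 3, which yields the exponents here and in the next case. *)
- eexists; split=> [|cM cN c0 c D]; first exact: (monomial5 i j 5 5 3 6 7).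
  by rewrite corner_rescale ray_rescale volumeZ /=; ring.
- eexists; split=> [|cM cN c0 c D]; first exact: (monomial5 i j 14 14 12 18 20).
  by rewrite corner_rescale ray_rescale test_detZ /=; ring.
Qed.

Lemma input_alg_id : input_alg (fun f => exists p, forall D, evalp p D = f D) (@id (input R n)).
Proof.
have h k (f : input R n -> R) : (forall D, coords D 0 k = f D) ->
    exists p : {mpoly R[ncoords n]}, forall D, evalp p D = f D.
  by move=> e; exists ('X_k) => D; rewrite /evalp mevalXU e.
split=> [i|i|i|i t].
- by apply: (h (lshift _ (lshift _ (lshift _ i)))) => D; rewrite !row_mxEl.
- by apply: (h (lshift _ (lshift _ (rshift _ i)))) => D; rewrite !row_mxEl row_mxEr.
- by apply: (h (lshift _ (rshift _ i))) => D; rewrite row_mxEl row_mxEr.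
by apply: (h (rshift _ (mxvec_index i t))) => D; rewrite row_mxEr mxvecE mxE.
Qed.

Lemma polynomial_algebra :
  fun_algebra (fun f : input R n -> R => exists p, forall D, evalp p D = f D).
Proof.
split=> [k|f g [p hp] [q hq]|f g [p hp] [q hq]|f g e [p hp]].
- by exists (k%:MP) => D; rewrite /evalp mevalC.
- by exists (p + q) => D; rewrite -hp -hq /evalp mevalD.
- by exists (p * q) => D; rewrite -hp -hq /evalp mevalM.
by exists p => D; rewrite hp e.
Qed.

Lemma algebraic_polynomial f : algebraic f -> exists p, forall D, evalp p D = f D.
Proof. by move=> hf; exact: (hf _ _ polynomial_algebra _ input_alg_id). Qed.

Lemma homogeneous_neq0 f D E : homogeneous f -> same_star D E -> f D != 0 -> f E != 0.
Proof.
move=> [mu [[dM [dN [d0 [d hm]]]] hf]] [hM hN [k [k0 h0]] h] fD.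
have [c hc] := fin_all_exists h.
have -> : E = rescale 1 1 k (\row_i c i) D.
  case: E hM hN h0 hc {h} => M N a e /= -> -> -> hc; rewrite /rescale !scale1r; congr Input.
  apply/row_matrixP => i; have := ray_rescale 1 1 k (\row_i c i) D i.
  by rewrite /ray /= => ->; rewrite mxE; case: (hc i) => _; rewrite /ray /= => ->.
rewrite hf hm !expr1n !mul1r !mulf_neq0 ?expf_neq0 //.
apply/prodf_neq0 => i _; rewrite mxE expf_neq0 //; by case: (hc i).
Qed.

End Homog.

(** * Generic input *)

Section Sample.
Variable R : realType.
Implicit Types (a b c x : dquat R).
Local Notation D := (dnum R).

(** The parallels to the first axis at height 1 ([M0]) and to the second axis at height -1
    ([N0]). *)
Definition M0 : line R := row_mx (row3 1 0 0) (row3 0 1 0).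
Definition N0 : line R := row_mx (row3 0 1 0) (row3 1 0 0).

Lemma line_dqM0 : line_dq M0 = dq4 (0, 0) (1, 0) (0, -1) (0, 0).
Proof.
apply: dqP; rewrite !dq4E ?line_dq0 // /q1 /q2 /q3 line_dqv line_dir line_mom
  ?row3_0 ?row3_1 ?row3_2 ?oppr0 //.
Qed.
Lemma line_dqN0 : line_dq N0 = dq4 (0, 0) (0, -1) (1, 0) (0, 0).
Proof.
apply: dqP; rewrite !dq4E ?line_dq0 // /q1 /q2 /q3 line_dqv line_dir line_mom
  ?row3_0 ?row3_1 ?row3_2 ?oppr0 //.
Qed.

Lemma is_line_M0 : is_line M0.
Proof.
rewrite /is_line line_dir line_mom; split; last by rewrite dotE3 !row3_0 !row3_1 !row3_2; ring.
by apply/eqP => /(congr1 (fun v : 'rV_3 => v 0 o0)); rewrite row3_0 mxE; apply/eqP/oner_neq0.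
Qed.
Lemma is_line_N0 : is_line N0.
Proof.
rewrite /is_line line_dir line_mom; split; last by rewrite dotE3 !row3_0 !row3_1 !row3_2; ring.
by apply/eqP => /(congr1 (fun v : 'rV_3 => v 0 o1)); rewrite row3_1 mxE; apply/eqP/oner_neq0.
Qed.
Lemma skew0 : Defs.skew M0 N0.
Proof.
apply: skewP.
  rewrite !line_dir; apply/eqP => /(congr1 (fun v : 'rV_3 => v 0 o2)).
  rewrite crossE !row3_0 !row3_1 mxE => /eqP; apply/negP.
  by rewrite !mulr0 !subr0 mulr1 oner_neq0.
rewrite /reciprocal !line_dir !line_mom !dotE3 !row3_0 !row3_1 !row3_2.
by rewrite (_ : _ + _ = 2) ?pnatr_eq0 //; ring.
Qed.

Lemma bform_dq4 (x0 x1 x2 x3 : D) x : bform (dq4 x0 x1 x2 x3) x =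
  x0.1 * (q0 x).2 + x0.2 * (q0 x).1 + (x1.1 * (q1 x).2 + x1.2 * (q1 x).1)
  + (x2.1 * (q2 x).2 + x2.2 * (q2 x).1) + (x3.1 * (q3 x).2 + x3.2 * (q3 x).1).
Proof. by rewrite bformE /qdot !dq4E. Qed.

Lemma dq4M (x0 x1 x2 x3 y0 y1 y2 y3 : D) : dmul (dq4 x0 x1 x2 x3) (dq4 y0 y1 y2 y3) =
  dq4 (x0 * y0 - x1 * y1 - x2 * y2 - x3 * y3) (x0 * y1 + x1 * y0 + x2 * y3 - x3 * y2)
    (x0 * y2 + x2 * y0 + x3 * y1 - x1 * y3) (x0 * y3 + x3 * y0 + x1 * y2 - x2 * y1).
Proof. by apply: dqP; rewrite !qE !dq4E. Qed.

Lemma dq_eq0 x : (q0 x).1 = 0 -> (q0 x).2 = 0 -> (q1 x).1 = 0 -> (q1 x).2 = 0 ->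
  (q2 x).1 = 0 -> (q2 x).2 = 0 -> (q3 x).1 = 0 -> (q3 x).2 = 0 -> x = 0.
Proof.
have z j : qv j (0 : dquat R) = 0 by rewrite /qv /primal /dual !mxE.
have z0 : q0 (0 : dquat R) = 0 by rewrite /q0 /primal /dual !mxE.
move=> h0 h1 h2 h3 h4 h5 h6 h7; apply: dqP.
- by rewrite z0; exact: dnum_eq.
- by apply: etrans (esym (z o0)); exact: dnum_eq.
- by apply: etrans (esym (z o1)); exact: dnum_eq.
- by apply: etrans (esym (z o2)); exact: dnum_eq.
Qed.

(** Trades an eight by eight determinant for a homogeneous linear system, which [lra] shows to have
    only the zero solution at the explicit stars. *)
Lemma test_det_neq0 M N a b c :
  (forall x, bform b x = 0 -> bform (dmul b (line_dq M)) x = 0 ->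
    bform (dmul b (line_dq N)) x = 0 -> bform c x = 0 ->
    bform (dmul c (line_dq M)) x = 0 -> bform (dmul c (line_dq N)) x = 0 ->
    bform (eps_mul a) x = 0 -> bform a x = 0 -> x = 0) ->
  test_det M N a b c != 0.
Proof.
move=> h; rewrite -[test_det _ _ _ _ _]det_tr; apply/negP => /det0P [v v0 hv].
have k i : (i < 8)%N -> bform (test_vectors M N a b c)`_i v = 0.
  move=> hi; have := test_mxE M N a b c v (Ordinal hi); rewrite [nat_of_ord _]/= => <-.
  by rewrite -[_ *m _]trmxK trmx_mul trmxK hv !mxE.
by case/eqP: v0; apply: h; [exact: (k 0%N) | exact: (k 1%N) | exact: (k 2%N)
  | exact: (k 3%N) | exact: (k 4%N) | exact: (k 5%N) | exact: (k 6%N) | exact: (k 7%N)].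
Qed.

(* rot12 completes the face spanned by rot1 and rot2 at the identity. *)
Definition rot1 : dquat R := dq4 (0, 0) (0, 0) (0, 0) (1, 0).
Definition rot2 : dquat R := dq4 (0, 0) (1, 1) (1, 1) (1, -2).
Definition rot12 : dquat R := dq4 (1, -2) (-1, -1) (1, 1) (0, 0).

Ltac dqring := rewrite ?line_dqM0 ?line_dqN0 dq4M; congr dq4; apply: dnum_eq;
  rewrite !dnE /=; ring.

Lemma rot1M : dmul rot1 (line_dq M0) = dq4 (0, 0) (0, 1) (1, 0) (0, 0).
Proof. by dqring. Qed.
Lemma rot1N : dmul rot1 (line_dq N0) = dq4 (0, 0) (-1, 0) (0, -1) (0, 0).
Proof. by dqring. Qed.
Lemma rot2M : dmul rot2 (line_dq M0) = dq4 (-1, 0) (0, 1) (1, -2) (-1, -2).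
Proof. by dqring. Qed.
Lemma rot2N : dmul rot2 (line_dq N0) = dq4 (-1, 0) (-1, 2) (0, -1) (1, 2).
Proof. by dqring. Qed.
Lemma rot12M : dmul rot12 (line_dq M0) = dq4 (1, 2) (1, -2) (0, -1) (-1, 0).
Proof. by dqring. Qed.
Lemma rot12N : dmul rot12 (line_dq N0) = dq4 (-1, -2) (0, -1) (1, -2) (-1, 0).
Proof. by dqring. Qed.

Lemma eps_mul_dq4 (x0 x1 x2 x3 : D) :
  eps_mul (dq4 x0 x1 x2 x3) = dq4 (0, x0.1) (0, x1.1) (0, x2.1) (0, x3.1).
Proof.
rewrite /eps_mul /dq4 primal_mk; congr mkdq.
by apply: quatP; rewrite mxE ?mkquat0 ?mkquatv ?row3_0 ?row3_1 ?row3_2.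
Qed.

Lemma test_det1 : test_det M0 N0 (dq1 R) rot1 rot2 != 0.
Proof.
apply: test_det_neq0 => x; rewrite rot1M rot1N rot2M rot2N eps_mul_dq4 !bform_dq4 /=.
by move=> *; apply: dq_eq0 => /=; lra.
Qed.

Lemma test_det2 : test_det M0 N0 rot2 rot12 (dq1 R) != 0.
Proof.
apply: test_det_neq0 => x; rewrite rot12M rot12N eps_mul_dq4 !dmul1l line_dqM0 line_dqN0.
rewrite !bform_dq4 /=.
by move=> *; apply: dq_eq0 => /=; lra.
Qed.

Lemma dconj_dq4 (x0 x1 x2 x3 : D) : dconj (dq4 x0 x1 x2 x3) = dq4 x0 (- x1) (- x2) (- x3).
Proof. by apply: dqP; rewrite !qE !dq4E. Qed.

Lemma volume0 a b : volume M0 N0 a b = (q3 (dmul (dconj a) b)).1.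
Proof.
rewrite /volume !line_dir dotE3 !crossE !row3_0 !row3_1 !row3_2 /axis_dir !qvecE.
by rewrite /q3 /=; ring.
Qed.

Lemma rot12_null : bform rot12 rot12 = 0.
Proof. by rewrite bform_dq4 !dq4E /=; ring. Qed.
Lemma rot12_linked : linked M0 N0 rot1 rot12 /\ linked M0 N0 rot2 rot12.
Proof.
rewrite /linked rot1M rot1N rot2M rot2N !bform_dq4 !dq4E /=.
by do 2!split; ring.
Qed.

Lemma tilt_gap1 : tilt_gap M0 N0 (dq1 R) rot1 rot2 != 0.
Proof.
rewrite /tilt_gap /tilt !volume0 /axis_dir !sqprimalE /sqn /qdot.
rewrite dconj_dq4 !dq4M !line_dir !dotE3 !row3_0 !row3_1 !row3_2 !qvecE.
rewrite -![primal _ 0 (rshift 1 _)]/((qv _ _).1) -!/(q1 _) -!/(q2 _) -!/(q3 _) !dq4E.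
rewrite !dnE /= (_ : _ - _ = - 1) ?oppr_eq0 ?oner_neq0 //; ring.
Qed.

Lemma volume_rot : volume M0 N0 rot2 rot12 != 0.
Proof.
rewrite volume0 dconj_dq4 dq4M dq4E !dnE /= (_ : _ - _ = - 3); last by ring.
by rewrite oppr_eq0 pnatr_eq0.
Qed.

End Sample.

Section Rotations.
Variable R : realType.
Implicit Types (a b c r : dquat R) (M N : line R).

(** Left multiplication changes only the fixed frame: conj(c a) (c b) is conj(a) b times the norm of
    c. *)
Lemma edge_mull M N c a b : is_displacement c -> edge M N a b ->
  edge M N (dmul c a) (dmul c b).
Proof.
move=> dc [lab vab]; have /displacementE [nc sc] := dc.
have e : dmul (dconj (dmul c a)) (dmul c b) = sqn c *: dmul (dconj a) b.
  rewrite dconjM -dmulA (dmulA (dconj c)) (null_mul_conj nc) dmulZl dmulZr.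
  by rewrite dmul1l.
split; last first.
  rewrite /volume /axis_dir e (_ : qvec _ = sqn c *: axis_dir a b); last first.
    by apply/rowP => i; rewrite rowZE !qvecE -[LHS]/((qv i _).1) qvZ dnumM1.
  rewrite (_ : dot _ _ = sqn c * volume M N a b) ?mulf_neq0 //.
  by rewrite /volume !dotE3 !scalev_o; ring.
apply/linkedP; rewrite e; have [] := (linkedP M N a b).1 lab.
set r := dmul (dconj a) b; move=> h0 hM hN.
have k0 : (q0 (sqn c *: r)).2 = sqn c * (q0 r).2.
  by rewrite q0Z dnumM2 real_dnum1 real_dnum2 mul0r addr0.
have kp : qvec (primal (sqn c *: r)) = sqn c *: qvec (primal r).
  by apply/rowP => i; rewrite rowZE !qvecE -[LHS]/((qv i _).1) qvZ dnumM1.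
have kd : qvec (dual (sqn c *: r)) = sqn c *: qvec (dual r).
  apply/rowP => i; rewrite rowZE !qvecE -[LHS]/((qv i _).2) qvZ dnumM2.
  by rewrite real_dnum1 real_dnum2 mul0r addr0.
have dl (u v : 'rV[R]_3) : dot (sqn c *: u) v = sqn c * dot u v.
  by rewrite !dotE3 !scalev_o; ring.
have dr (u v : 'rV[R]_3) : dot v (sqn c *: u) = sqn c * dot v u.
  by rewrite !dotE3 !scalev_o; ring.
by cbv zeta; rewrite k0 kp kd !dl !dr h0 hM hN mulr0.
Qed.

(* Up to scale, the rotations whose axes meet both M0 and N0. *)
Definition rot (l s x y : R) : dquat R :=
  l *: mkdq (mkquat s (row3 x y 1)) (mkquat 0 (row3 y x (- (2 * x * y)))).

Lemma rotE l s x y : rot l s x y = l *: dq4 (s, 0) (x, y) (y, x) (1, - (2 * x * y)).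
Proof. by []. Qed.

(** The axis has direction (x, y, 1) and meets [M0] in (2 x, 0, 1) and [N0] in (0, - 2 y, -1). *)
Lemma rot_edge l s x y : l != 0 ->
  is_displacement (rot l s x y) /\ edge (M0 R) (N0 R) (dq1 R) (rot l s x y).
Proof.
move=> l0; rewrite rotE; set r := dq4 _ _ _ _.
have v0 : volume (M0 R) (N0 R) (dq1 R) r = 1.
  by rewrite volume0 dconj_dq4 dq4M dq4E !dnE /=; ring.
have nr : bform r r = 0 by rewrite bform_dq4 !dq4E /=; ring.
have e : edge (M0 R) (N0 R) (dq1 R) r.
  split; last by rewrite v0 oner_neq0.
  rewrite /linked line_dqM0 line_dqN0 !dmul1l !bform_dq4 !dq4E /=.
  by split; ring.
split; last by apply: edge_same (same_pointxx _) _ e; exists l.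
apply: displacementZ => //; apply: (@volume_displacement R (M0 R) (N0 R) (dq1 R) r nr).
by rewrite v0 oner_neq0.
Qed.

(** For these lines the volume is the third component of the axis direction, so that component can
    be scaled to 1. Being linked fixes all of the dual part but one component, and that one follows
    from nullity. *)
Lemma edge_rot a b : is_displacement a -> is_displacement b ->
  edge (M0 R) (N0 R) a b -> exists l s x y, l != 0 /\ b = dmul a (rot l s x y).
Proof.
move=> da db [/linkedP/= hl hv]; have /displacementE [na sa] := da.
have /displacementE [nr _] := displacementM (displacement_conj da) db.
move: hl hv nr; rewrite volume0.
have : b = (sqn a)^-1 *: dmul a (dmul (dconj a) b).
  by rewrite dmulA (null_conj_mul na) dmulZl dmul1l scalerA mulVf // scale1r.
set r := dmul (dconj a) b => eb.
rewrite !line_dir !line_mom !dotE3 !row3_0 !row3_1 !row3_2 !qvecE.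
rewrite -![primal _ 0 (rshift 1 _)]/((qv _ _).1) -![dual _ 0 (rshift 1 _)]/((qv _ _).2).
rewrite -!/(q1 _) -!/(q2 _) -!/(q3 _) /nullq /qdot !dnE => -[h0 hM hN] g0 h.
exists ((sqn a)^-1 * (q3 r).1), ((q0 r).1 / (q3 r).1), ((q1 r).1 / (q3 r).1), ((q2 r).1 / (q3 r).1).
rewrite mulf_neq0 ?invr_eq0 //; split=> //.
rewrite {1}eb rotE dmulZr -scalerA; congr (_ *: _); rewrite -dmulZr; congr dmul.
clearbody r; have e0 : (q0 r).2 = 0 by exact: h0.
have e1 : (q1 r).2 = (q2 r).1 by lra.
have e2 : (q2 r).2 = (q1 r).1 by lra.
have e3 : (q3 r).2 = - (2 * (q1 r).1 * (q2 r).1) / (q3 r).1.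
  by apply: (mulfI g0); rewrite mulrCA divff // mulr1; rewrite e0 e1 e2 in h; lra.
apply: dqP; apply: dnum_eq; rewrite ?e0 ?e1 ?e2 ?e3 !qE !dq4E !dnE;
move: g0; move: (q0 r).1 (q1 r).1 (q2 r).1 (q3 r).1 => p0 p1 p2 p3 g0 /=; by field.
Qed.
End Rotations.

Section Family.
Variables (R : realType) (n : nat).
Implicit Types (D E : input R n) (p : quat R) (v : 'rV[R]_3) (l s x y : 'rV[R]_n).

(** Rotation p after translation by v, followed by one axis and angle per ray. The data are
    polynomial in the parameters, and all parameters with p and every l nonzero give admissible
    stars, so samples can be joined by polynomial curves. *)
Definition family p v l s x y : input R n :=
  let a := dmul (mkdq p 0) (affine_pt v) in
  Input (M0 R) (N0 R) a (\matrix_i dmul a (rot (l 0 i) (s 0 i) (x 0 i) (y 0 i))).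

Lemma ray_family p v l s x y i : ray (family p v l s x y) i =
  dmul (in_0 (family p v l s x y)) (rot (l 0 i) (s 0 i) (x 0 i) (y 0 i)).
Proof. exact: rowK. Qed.

Definition sample D := [/\ good D, in_M D = M0 R & in_N D = N0 R].

Lemma quat_displacement p : p != 0 -> is_displacement (mkdq p 0).
Proof.
move=> p0; split; rewrite ?primal_mk // /on_study /bform primal_mk dual_mk.
by rewrite dotC /dot big1 ?addr0 // => i _; rewrite mxE mul0r.
Qed.

Lemma affine_displacement v : is_displacement (affine_pt v).
Proof.
apply/displacementE; rewrite /nullq /sqn /qdot !epsE !dnE /=; split; first by ring.
by rewrite !(mulr0, mul0r, addr0, mulr1) oner_neq0.
Qed.

Lemma family_sample p v l s x y : p != 0 -> (forall i, l 0 i != 0) ->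
  sample (family p v l s x y).
Proof.
move=> p0 l0; have da := displacementM (quat_displacement p0) (affine_displacement v).
split=> //; split=> /=; [exact: is_line_M0 | exact: is_line_N0 | exact: skew0 | exact: da |].
move=> i; rewrite ray_family; have [dr er] := rot_edge (s 0 i) (x 0 i) (y 0 i) (l0 i).
split; first exact: displacementM da dr.
have := edge_mull da er; rewrite dmul1r; exact.
Qed.

Lemma study_param (a : dquat R) : is_displacement a ->
  exists v, a = dmul (mkdq (primal a) 0) (affine_pt v).
Proof.
move=> da; have [na p0] := da; have dp := quat_displacement p0.
set b := mkdq (primal a) 0 in dp *; set r := dmul (dconj b) a.
have /displacementE [nb sb] := dp.
have b2 j : (qv j b).2 = 0 by rewrite /qv dual_mk /= mxE.
have b02 : (q0 b).2 = 0 by rewrite /q0 dual_mk /= mxE.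
have b1 j : (qv j b).1 = (qv j a).1 by rewrite /qv primal_mk.
have b01 : (q0 b).1 = (q0 a).1 by rewrite /q0 primal_mk.
exists (\row_j ((qv j r).2 / sqn b)).
have rE : r = sqn b *: affine_pt (\row_j ((qv j r).2 / sqn b)).
  have sE : sqn b = (q0 a).1 ^+ 2 + (q1 a).1 ^+ 2 + (q2 a).1 ^+ 2 + (q3 a).1 ^+ 2.
    by rewrite /sqn /qdot !dnE /q1 /q2 /q3 !b1 b01; ring.
  have v2 j : (qv j (sqn b *: affine_pt (\row_j ((qv j r).2 / sqn b)))).2 = (qv j r).2.
    rewrite qvZ affine_ptv dnumM2 real_dnum1 real_dnum2 mul0r addr0 mxE.
    by rewrite mulrC divfK.
  have n2 : (q0 a).1 * (q0 a).2 + (q1 a).1 * (q1 a).2 + (q2 a).1 * (q2 a).2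
      + (q3 a).1 * (q3 a).2 = 0.
    by have /nullE := na; rewrite /nullq /qdot !dnE => h; lra.
  apply: dqP; apply: dnum_eq; rewrite -?v2 //.
  - rewrite q0Z affine_pt0 dnumM1 real_dnum1 mulr1 sE /r q0M !qE !dnE.
    by rewrite /q1 /q2 /q3 !b1 b01; ring.
  - rewrite q0Z affine_pt0 dnumM2 real_dnum1 real_dnum2 mulr0 mul0r addr0 /r !qE !dnE.
    by rewrite /q1 /q2 /q3 !b1 !b2 b01 b02 -/(q1 a) -/(q2 a) -/(q3 a); lra.
  - rewrite -[RHS]/((qv o0 (_ *: affine_pt _)).1) qvZ affine_ptv dnumM1 mulr0 /r !qE !dnE.
    by rewrite /q1 /q2 /q3 !b1 b01; ring.
  - rewrite -[RHS]/((qv o1 (_ *: affine_pt _)).1) qvZ affine_ptv dnumM1 mulr0 /r !qE !dnE.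
    by rewrite /q1 /q2 /q3 !b1 b01; ring.
  - rewrite -[RHS]/((qv o2 (_ *: affine_pt _)).1) qvZ affine_ptv dnumM1 mulr0 /r !qE !dnE.
    by rewrite /q1 /q2 /q3 !b1 b01; ring.
apply: (scalerI sb); rewrite -dmulZr -rE /r dmulA (null_conj_mul nb).
by rewrite dmulZl dmul1l.
Qed.

Lemma sample_family D : sample D -> exists p v l s x y,
  [/\ p != 0, forall i, l 0 i != 0 & D = family p v l s x y].
Proof.
move=> [[lM lN sk da h] eM eN]; have [v hv] := study_param da.
have hr i : exists q : R * R * R * R, q.1.1.1 != 0 /\
    ray D i = dmul (in_0 D) (rot q.1.1.1 q.1.1.2 q.1.2 q.2).
  have [di ei] := h i; rewrite eM eN in ei.
  by have [k [s [x [y [k0 e]]]]] := edge_rot da di ei; exists (k, s, x, y).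
have [q hq] := fin_all_exists hr.
exists (primal (in_0 D)), v, (\row_i (q i).1.1.1), (\row_i (q i).1.1.2),
  (\row_i (q i).1.2), (\row_i (q i).2); split.
- by case: da.
- by move=> i; rewrite mxE; case: (hq i).
move: eM eN hv hq; case: D {lM lN sk da h hr} => M N a e /= -> -> hv hq.
rewrite /family -hv; congr Input; apply/row_matrixP => i; rewrite rowK !mxE.
by case: (hq i).
Qed.

Lemma input_alg_family (X : Type) (A : (X -> R) -> Prop) (hA : fun_algebra A)
    (p : X -> quat R) (v : X -> 'rV[R]_3) (l s x y : X -> 'rV[R]_n) :
  valg A p -> valg A v -> valg A l -> valg A s -> valg A x -> valg A y ->
  input_alg A (fun t => family (p t) (v t) (l t) (s t) (x t) (y t)).
Proof.
move=> hp hv hl hs hx hy.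
have ha : valg A (fun t => in_0 (family (p t) (v t) (l t) (s t) (x t) (y t))).
  apply: (valg_dmul hA); apply: (valg_mkdq hA) => //; first exact: valgC.
    by apply: valgC.
  by apply: (valg_mkquat hA) => //; exact: algC.
split=> [||//|i]; [exact: valgC | exact: valgC |].
have row3_alg (f g h : X -> R) : A f -> A g -> A h -> valg A (fun t => row3 (f t) (g t) (h t)).
  move=> hf hg hh; apply: ord3.
  - by apply: (alg_ext hA) hf => t; rewrite row3_0.
  - by apply: (alg_ext hA) hg => t; rewrite row3_1.
  - by apply: (alg_ext hA) hh => t; rewrite row3_2.
apply: (valg_ext hA (fun t => esym (ray_family _ _ _ _ _ _ i))).
apply: (valg_dmul hA) => //; apply: (valgZ hA); first exact: hl.
apply: (valg_mkdq hA); apply: (valg_mkquat hA); try exact: row3_alg; try exact: (algC hA).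
- exact: hs.
- by apply: row3_alg; [exact: hx | exact: hy | exact: algC].
apply: row3_alg; [exact: hy | exact: hx |].
apply: (algN hA); apply: (algM hA); last exact: hy.
by apply: (algM hA); [exact: algC | exact: hx].
Qed.
End Family.

Section Generic.
Variables (R : realType) (n : nat).
Implicit Types (D E : input R n) (f g : input R n -> R) (i j : 'I_n).

Definition curve_alg (f : R -> R) := exists p : {poly R}, forall t, f t = p.[t].

Lemma curve_algebra : fun_algebra curve_alg.
Proof.
split=> [k|f g [p hp] [q hq]|f g [p hp] [q hq]|f g e [p hp]].
- by exists k%:P => t; rewrite hornerC.
- by exists (p + q) => t; rewrite hornerD hp hq.
- by exists (p * q) => t; rewrite hornerM hp hq.
by exists p => t; rewrite -e.
Qed.

Lemma poly_nonroot (p : {poly R}) : p != 0 -> exists t, p.[t] != 0.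
Proof.
move=> p0; pose r := [seq k%:R : R | k <- iota 0 (size p)].
have [/max_poly_roots h|/allPn [t _ ht]] := boolP (all (root p) r); last by exists t.
have u : uniq r by rewrite map_inj_uniq ?iota_uniq // => k l /eqP; rewrite eqr_nat => /eqP.
by have := h p0 u; rewrite size_map size_iota ltnn.
Qed.

Definition segment m (u w : 'rV[R]_m) (t : R) := u + t *: (w - u).

Lemma segment_alg m (u w : 'rV[R]_m) : valg curve_alg (segment u w).
Proof.
have h := curve_algebra; apply: (valgD h); first exact: valgC.
apply: (valgZ h); last exact: valgC.
by exists 'X => t; rewrite hornerX.
Qed.
Lemma segment0 m (u w : 'rV[R]_m) : segment u w 0 = u.
Proof. by rewrite /segment scale0r addr0. Qed.
Lemma segment1 m (u w : 'rV[R]_m) : segment u w 1 = w.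
Proof. by rewrite /segment scale1r addrC subrK. Qed.

Definition generic f := exists2 D, sample D & f D != 0.

(** Two sample stars are joined by a segment in parameter space. Along it, f, g and the conditions
    that p and all l are nonzero are polynomials in t, each nonzero at one of the ends; some t
    avoids the roots of their product. *)
Lemma genericM f g : algebraic f -> algebraic g -> generic f -> generic g ->
  generic (fun D => f D * g D).
Proof.
move=> af ag [D sD fD] [E sE gE]; have h := curve_algebra.
have [p [v [l [s [x [y [p0 l0 eD]]]]]]] := sample_family sD.
have [p' [v' [l' [s' [x' [y' [p0' l0' eE]]]]]]] := sample_family sE.
pose F t := family (segment p p' t) (segment v v' t) (segment l l' t) (segment s s' t)
  (segment x x' t) (segment y y' t).
have aF : input_alg curve_alg F by apply: (input_alg_family h); exact: segment_alg.
have F0 : F 0 = D by rewrite /F !segment0.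
have F1 : F 1 = E by rewrite /F !segment1.
have [pf hf] := af _ _ h _ aF; have [pg hg] := ag _ _ h _ aF.
have [pp hp] := alg_dot h (@segment_alg _ p p') (@segment_alg _ p p').
have [pl hl] : curve_alg (fun t => \prod_i segment l l' t 0 i).
  by apply: (alg_prod h) => i _; exact: segment_alg.
have nz (q : {poly R}) t : q.[t] != 0 -> q != 0.
  by apply: contra_neq => ->; rewrite horner0.
have [t] : exists t, (pf * pg * (pp * pl)).[t] != 0.
  apply: poly_nonroot; rewrite !mulf_neq0 //.
  - by apply: (nz _ 0); rewrite -hf F0.
  - by apply: (nz _ 1); rewrite -hg F1.
  - by apply: (nz _ 0); rewrite -hp segment0 (lt0r_neq0 (dot_gt0 p0)).
  - by apply: (nz _ 0); rewrite -hl; apply/prodf_neq0 => i _; rewrite segment0.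
rewrite !hornerM -hf -hg -hp -hl !mulf_eq0 !negb_or => /andP [/andP [f0 g0] /andP [d0 k0]].
exists (F t); last by rewrite mulf_neq0.
apply: family_sample; last by move=> i; have /prodf_neq0 := k0; apply.
apply: contra_neq d0 => ->; rewrite /dot big1 // => i _; by rewrite mxE mul0r.
Qed.

Lemma generic_prod (I : Type) (r : seq I) (P : pred I) (f : I -> input R n -> R) :
  (forall k, P k -> algebraic (f k)) -> (forall k, P k -> generic (f k)) ->
  (exists D : input R n, sample D) ->
  generic (fun D => \prod_(k <- r | P k) f k D).
Proof.
move=> ha hg [D0 sD0]; elim: r => [|k r [D sD ih]].
  by exists D0; rewrite // big_nil oner_neq0.
case Pk: (P k); last by exists D; rewrite // big_cons Pk.
have [|E sE h] := genericM (ha k Pk) (algebraic_prod r ha) (hg k Pk) _.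
  by exists D.
by exists E; rewrite // big_cons Pk.
Qed.

(** A star D at which f and [star_gate] are both nonzero is, up to scale, the step of [step j D]; so
    [step j D] is the required witness. *)
Lemma generic_step f j : algebraic f -> homogeneous f -> generic f ->
  generic (@star_gate R n) -> generic (fun D => f (step j D)).
Proof.
move=> af hf gf gs; have [D [gD eM eN]] := genericM af (@algebraic_star_gate R n) gf gs.
rewrite mulf_eq0 negb_or => /andP [fD sD].
exists (step j D); first by split; [exact: good_step | exact: eM | exact: eN].
exact: homogeneous_neq0 hf (same_star_sym (step_step j gD sD)) fD.
Qed.

(** Each such star tests only the gates (i, j) with its own j, hence the other rays may coincide;
    [genericM] combines the stars afterwards. *)
Definition sample_star j : input R n :=
  Input (M0 R) (N0 R) (dq1 R) (\matrix_i (if i == j then rot2 R else rot1 R)).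

Lemma ray_sample j i : ray (sample_star j) i = if i == j then rot2 R else rot1 R.
Proof. exact: rowK. Qed.

Lemma sample_star_good j : sample (sample_star j).
Proof.
split=> //; split=> /=; [exact: is_line_M0 | exact: is_line_N0 | exact: skew0
  | exact: dq1_displacement |].
have e1 : rot1 R = rot 1 0 0 0.
  by rewrite rotE scale1r; congr dq4; apply: dnum_eq => /=; ring.
have e2 : rot2 R = rot 1 0 1 1.
  by rewrite rotE scale1r; congr dq4; apply: dnum_eq => /=; ring.
move=> i; rewrite ray_sample; case: eqP => _; rewrite ?e1 ?e2; apply: rot_edge;
exact: oner_neq0.
Qed.

Lemma sample_gate i j : i != j -> gate (sample_star j) i j != 0.
Proof.
move=> ij; have [lr1 lr2] := rot12_linked R.
have da := @dq1_displacement R.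
have [[_ _ _ _ h] _ _] := sample_star_good j.
have [_ [l1 _]] := h i; have [_ [l2 _]] := h j.
rewrite /gate /corner; rewrite !ray_sample eqxx (negbTE ij) in l1 l2 *.
(* Uniqueness identifies the corner with [rot12] up to scale without computing cofactors. *)
have [k hk] := unique4_fourth (test_det1 R) da l1 l2 (rot12_null R) lr1 lr2.
have ne : rot12 R != 0.
  by apply: contraTneq (volume_rot R) => ->; rewrite -(scale0r (rot2 R)) volume_refl eqxx.
have [|c [c0 hc]] := not_scale_same _ ne hk.
  move=> [c [_ e]]; have := congr1 (fun z => (qv o0 z).1) e.
  rewrite qvZ -!/(q1 _) !dq4E !dnE mulr0 => /eqP.
  by rewrite oppr_eq0 oner_eq0.
set F := fourth _ _ _ _ _ in hc *.
have eF : F = c^-1 *: rot12 R by rewrite hc scalerA mulVf // scale1r.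
have ci : c^-1 != 0 by rewrite invr_eq0.
have v1 := volumeZ 1 1 1 c^-1 (M0 R) (N0 R) (rot2 R) (rot12 R).
have t1 := test_detZ 1 1 1 c^-1 1 (M0 R) (N0 R) (rot2 R) (rot12 R) (dq1 R).
rewrite !scale1r -eF in v1 t1; rewrite v1 t1 !expr1n !mul1r !mulr1.
by rewrite !mulf_neq0 ?expf_neq0 ?test_det1 ?tilt_gap1 ?volume_rot ?test_det2.
Qed.

Lemma algebraic_gate i j : algebraic (fun D : input R n => gate D i j).
Proof. by move=> X A hA F hF; exact: alg_gate. Qed.

Lemma generic_star_gate : (0 < n)%N -> generic (@star_gate R n).
Proof.
move=> n0; pose j0 := Ordinal n0; have s0 := sample_star_good j0.
apply: genericM.
- by apply: algebraic_prod => i _ X A hA F [hM hN h0 h]; exact: (alg_volume hA).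
- by apply: algebraic_prod => -[i j] _; exact: algebraic_gate.
- exists (sample_star j0) => //; apply/prodf_neq0 => i _.
  by case: s0 => -[_ _ _ _ /(_ i) [_ []]].
apply: generic_prod => [[i j] _|[i j] ij|]; first exact: algebraic_gate.
  by exists (sample_star j); [exact: sample_star_good | exact: sample_gate].
by exists (sample_star j0).
Qed.

Lemma walk_class s : (0 < n)%N -> [/\ algebraic (fun D : input R n => star_gate (walk D s)),
  homogeneous (fun D : input R n => star_gate (walk D s)) &
  generic (fun D : input R n => star_gate (walk D s))].
Proof.
move=> n0; have gs := generic_star_gate n0.
elim: s => [|j s [ha hh hg]].
  by split; [exact: algebraic_star_gate | exact: homogeneous_star_gate | exact: gs].
split; first exact: (algebraic_step j ha).
  exact: (homogeneous_step j hh).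
exact: (generic_step j ha hh hg gs).
Qed.

(* Taking all sequences, not only enumerations of subsets, makes regularity
   stable under step and hence under reordering. *)
Definition obstruction D : R :=
  \prod_(m < n.+1) \prod_(s : m.-tuple 'I_n) star_gate (walk D s).

Lemma obstructionP D : obstruction D != 0 -> regular n D.
Proof.
move=> /prodf_neq0 h s hs; have /prodf_neq0 h' := h (Ordinal (hs : (size s < n.+1)%N)) isT.
exact: (h' (in_tuple s) isT).
Qed.

Lemma obstruction_class : (0 < n)%N ->
  [/\ algebraic obstruction, homogeneous obstruction & generic obstruction].
Proof.
move=> n0; have h s := walk_class s n0.
have s0 : exists D : input R n, sample D by exists (sample_star (Ordinal n0)); exact: sample_star_good.
have ha s := let: And3 a _ _ := h s in a.
split.
- by apply: algebraic_prod => m _; apply: algebraic_prod => s _; case: (h s).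
- by apply: homogeneous_prod => m _; apply: homogeneous_prod => s _; case: (h s).
apply: generic_prod => // m _.
  by apply: algebraic_prod => s _; case: (h s).
by apply: generic_prod => // s _; case: (h s).
Qed.

End Generic.

Theorem theorem9 (R : realType) (n : nat) (hn : (3 <= n)%N) :
  exists Z : input R n -> Prop,
    proper_algebraic_subset (@admissible R n) Z /\
    forall D : input R n, admissible D -> ~ Z D ->
      exists a : {set 'I_n} -> dquat R,
        extends_to_cube D a /\
        forall b : {set 'I_n} -> dquat R, extends_to_cube D b ->
          forall I : {set 'I_n}, same_point (a I) (b I).
Proof.
have n0 : (0 < n)%N by apply: leq_trans hn.
have [ha [mu [[dM [dN [d0 [d hm]]]] hh]] [E [gE _ _] hE]] := obstruction_class R n0.
have [p hp] := algebraic_polynomial ha.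
(* One multihomogeneous equation cuts out the excluded set, and the generic sample E is an
   admissible point outside it. *)
exists (fun D => admissible D /\ obstruction D = 0); split.
  split.
    exists [:: p]; split=> [q|D].
      rewrite inE => /eqP ->; exists dM, dN, d0, d => cM cN c0 c D.
      by rewrite !hp hh hm.
    split=> [[aD oD]|[aD oD]]; split=> //.
      by move=> q; rewrite inE => /eqP ->; rewrite hp.
    by rewrite -hp; apply: oD; rewrite mem_head.
  exists E; split; first exact/admissibleP.
  by move=> [_ /eqP]; rewrite (negbTE hE).
move=> D /admissibleP gD zD.
have rD : regular n D.
  apply: obstructionP; apply/eqP => oD; apply: zD; split=> //; exact/admissibleP.
exists (vertex D); split; first exact: vertex_extends.
by move=> b hb I; exact: extension_unique.
Qed.
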